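(* Let $K$ be an irreducible Markov kernel on $\mathcal{X}=\{1,\dots,n\}$ with stationary distribution $\pi$, Dirichlet form $\mathcal{E}$ and logarithmic Sobolev constant $\alpha$. For integers $d\ge 2$ and $m\ge 0$, let $\alpha_{d,m}$ be defined by $$\frac{1}{\alpha_{d,m}}:=\inf\Big\{\gamma\in\mathbb{R}\;:\;\exists\, p_1,\dots,p_n\in\mathbb{R}[t]_{2d}\text{ with } \gamma\,\mathcal{E}(x,x)-\sum_{i=1}^n\pi_i p_i(x_i)\in \mathsf{SOS}_d(S^\pi)\text{ and } S_m(t)p_i(t)-2t^2(t-1)R_m(t)\in \mathsf{SOS}_{d+\lceil m/2\rceil}([0,\pi_i^{-1/2}])\ (i=1,\dots,n)\Big\}.$$ Then this program is feasible, $0<\alpha_{d,m}\le\alpha$, and $$\lim_{m\to\infty}\lim_{d\to\infty}\alpha_{d,m}=\alpha.$$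
   Context: A Markov kernel $K$ on $\mathcal{X}$ is a matrix with $K_{ij}\ge0$, $\sum_j K_{ij}=1$; irreducibility gives a unique stationary distribution $\pi$ ($\pi K=\pi$) with all $\pi_i>0$. Dirichlet form: $\mathcal{E}(x,x)=\frac12\sum_{i,j}\pi_iK_{ij}(x_i-x_j)^2$. Write $\|x\|_\pi^2=\sum_i\pi_ix_i^2$ and $\mathrm{Ent}_\pi[x^2]=\sum_i\pi_ix_i^2\log(x_i^2/\|x\|_\pi^2)$. The logarithmic Sobolev constant $\alpha$ is the largest constant with $\mathcal{E}(x,x)\ge\alpha\,\mathrm{Ent}_\pi[x^2]$ for all $x\in\mathbb{R}^n$. Let $S^\pi=\{x\in\mathbb{R}^n_{\ge0}:\|x\|_\pi^2=1\}$. $\Sigma[x]_{2k}$ denotes sums of squares of polynomials of degree $\le k$, and $\mathbb{R}[x]_k$ polynomials of degree $\le k$. Define $\mathsf{SOS}_d(S^\pi)=\{f\in\mathbb{R}[x]_{2d}: f=\sigma_0+\sum_{i=1}^n x_i\sigma_i+\phi\,(\|x\|_\pi^2-1),\ \sigma_0\in\Sigma[x]_{2d},\ \sigma_i\in\Sigma[x]_{2d-2},\ \phi\in\mathbb{R}[x]_{2d-2}\}$. For an interval $[a,b]$, $\mathsf{SOS}_k([a,b])$ is the set of univariate polynomials of degree at most $2k$ that are nonnegative on $[a,b]$. For $m\ge0$, $\overline{r_m}(t)$ denotes the $(m+1,m)$ Padé approximant of $\log t$ at $t=1$, i.e. the rational function $R/S$ with $\deg R\le m+1$, $\deg S\le m$,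 $S(1)=1$, and $\log t-R(t)/S(t)=O((t-1)^{2m+2})$ as $t\to1$; it is written $\overline{r_m}(t)=(t-1)R_m(t)/S_m(t)$ with $R_m,S_m$ polynomials of degree $m$ and $S_m>0$ on $(0,\infty)$. *)

(* Defs.v *)
From HB Require Import structures.
From mathcomp Require Import all_boot all_order all_algebra.
From mathcomp Require Import mpoly.
From mathcomp Require Import all_classical all_reals all_analysis.
Set Implicit Arguments. Unset Strict Implicit. Unset Printing Implicit Defensive.
Import Order.TTheory GRing.Theory Num.Theory.
Local Open Scope ring_scope.
Local Open Scope classical_set_scope.

Section Defs.
Variables (R : realType) (n : nat).

Notation mpol := {mpoly R[n]}.

Definition Xc (i : 'I_n) : mpol := 'X_i.

Definition at_coord (p : {poly R}) (i : 'I_n) : mpol :=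
  (map_poly (@mpolyC n R) p).[Xc i].

Definition mdeg_le (k : nat) (f : mpol) : Prop := (msize f <= k.+1)%N.

Definition is_sos (k : nat) (f : mpol) : Prop :=
  exists s : seq mpol, all (fun q => (msize q <= k.+1)%N) s /\
                       f = \sum_(q <- s) q ^+ 2.

Definition sphere_poly (pi : 'I_n -> R) : mpol :=
  \sum_(i < n) pi i *: (Xc i ^+ 2) - 1.

Definition SOS_Spi (pi : 'I_n -> R) (d : nat) (f : mpol) : Prop :=
  mdeg_le (2 * d) f /\
  exists (s0 : mpol) (s : 'I_n -> mpol) (phi : mpol),
    is_sos d s0 /\ (forall i, is_sos d.-1 (s i)) /\ mdeg_le (2 * d - 2) phi /\
    f = s0 + \sum_(i < n) Xc i * s i + phi * sphere_poly pi.

Definition SOS_interval (k : nat) (a b : R) (q : {poly R}) : Prop :=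
  (size q <= (2 * k).+1)%N /\ forall t, a <= t <= b -> 0 <= q.[t].

Definition markov_kernel (K : 'M[R]_n) : Prop :=
  (forall i j, 0 <= K i j) /\ (forall i, \sum_(j < n) K i j = 1).

Definition irreducible (K : 'M[R]_n) : Prop :=
  forall i j, exists k : nat, 0 < (K ^+ k) i j.

Definition stationary (K : 'M[R]_n) (pi : 'I_n -> R) : Prop :=
  (forall i, 0 <= pi i) /\ \sum_(i < n) pi i = 1 /\
  forall j, \sum_(i < n) pi i * K i j = pi j.

Definition dirichlet (K : 'M[R]_n) (pi : 'I_n -> R) (x : 'I_n -> R) : R :=
  2^-1 * \sum_(i < n) \sum_(j < n) pi i * K i j * (x i - x j) ^+ 2.

Definition normpi2 (pi : 'I_n -> R) (x : 'I_n -> R) : R :=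
  \sum_(i < n) pi i * x i ^+ 2.

(* with the convention 0 log 0 = 0 (note ln 0 = 0 in mathcomp-analysis) *)
Definition entropy (pi : 'I_n -> R) (x : 'I_n -> R) : R :=
  \sum_(i < n) pi i * x i ^+ 2 * ln (x i ^+ 2 / normpi2 pi x).

Definition logsob (K : 'M[R]_n) (pi : 'I_n -> R) : R :=
  sup [set a : R | forall x : 'I_n -> R, a * entropy pi x <= dirichlet K pi x].

Definition dirichlet_poly (K : 'M[R]_n) (pi : 'I_n -> R) : mpol :=
  2^-1 *: \sum_(i < n) \sum_(j < n) (pi i * K i j) *: (Xc i - Xc j) ^+ 2.

End Defs.

(* (m+1,m) Pade approximant of log at t = 1, written (t-1) Rm(t) / Sm(t) *)
Definition pade_log (R : realType) (m : nat) (Rm Sm : {poly R}) : Prop :=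
  (size Rm <= m.+1)%N /\ (size Sm <= m.+1)%N /\ Sm.[1] = 1 /\
  exists (C delta : R), 0 < delta /\
    forall t : R, 0 < t -> `|t - 1| < delta ->
      `|ln t - (t - 1) * Rm.[t] / Sm.[t]| <= C * `|t - 1| ^+ (2 * m + 2).

Definition feasible (R : realType) (n : nat) (K : 'M[R]_n) (pi : 'I_n -> R)
    (Rm Sm : {poly R}) (d m : nat) (gamma : R) : Prop :=
  exists p : 'I_n -> {poly R},
    (forall i, (size (p i) <= (2 * d).+1)%N) /\
    SOS_Spi pi d (gamma *: dirichlet_poly K pi - \sum_(i < n) pi i *: at_coord (p i) i) /\
    forall i, SOS_interval (d + uphalf m) 0 (Num.sqrt (pi i))^-1
                (Sm * p i - 2%:P * 'X ^+ 2 * ('X - 1) * Rm).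

Definition alpha_dm (R : realType) (n : nat) (K : 'M[R]_n) (pi : 'I_n -> R)
    (Rm Sm : {poly R}) (d m : nat) : R :=
  (inf [set gamma : R | feasible K pi Rm Sm d m gamma])^-1.

(* Main.v *)
Require Import Defs.
From HB Require Import structures.
From mathcomp Require Import all_boot all_order all_algebra.
From mathcomp Require Import mpoly.
From mathcomp Require Import all_classical all_reals all_analysis.
From mathcomp Require Import ring lra zify.
Set Implicit Arguments. Unset Strict Implicit. Unset Printing Implicit Defensive.
Import Order.TTheory GRing.Theory Num.Theory numFieldNormedType.Exports.
Local Open Scope classical_set_scope.
Local Open Scope ring_scope.

(** Write [z = t - 1], [y = x - 1] and let [r = z Rm / Sm] be the approximant.

    Pade side.  Differentiating [Sm log t - z Rm] [m + 2] times forces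
    [Sm_k = Sm_0 C(m,k) C(m+1,k)] with [Sm_0 > 0]; a degree count gives
    [(log t - r)' = - Sm_0^2 z^(2m+1) / (t Sm^2)].  Hence [log t <= r <= t - 1]
    on the positive axis, and [t^2 (r - log t) = O(z^2 / m)] on bounded sets.

    Bounds.  A feasible [gamma] satisfies the log-Sobolev inequality, whence
    [alpha_dm <= alpha].  For [d = 2] the choice [p = t^2 - 1 + M z^2] is
    feasible, because a large multiple of the Dirichlet form minus the variance
    is a sum of squares (chain squares along paths of the kernel).

    Convergence.  Take [gamma > 1/alpha] and [p = t^2 - 1 + z^2 q], with [q] a
    close polynomial upper bound for [(2 t^2 r - t^2 + 1) / z^2].  Modulo the
    sphere the polynomial to certify is the quadratic form
    [gamma E(y) - \sum pi_i q(x_i) y_i^2] in [y]; it vanishes at [x = 1], so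
    positivity on the sphere does not suffice.  Replacing [y] by a free vector
    [v] gives a quadratic form with polynomial coefficients in [x]; adding
    forms that vanish for [v = y] (modulo the sphere) makes it positive
    definite for every [x] in the nonnegative part of the sphere.  Terms
    [x_i sigma(x_i)] and a multiple of the squared sphere equation extend this
    to a box containing the sphere.  There all Bernstein coefficients of high
    degree are positive definite, and the Bernstein basis itself consists of
    sums of squares modulo the sphere, since the factors [b +- x_i] do. *)

(** The step from [j] to [j + 1] loses exactly [(j + 1) u^2]. This form gives
    [(1 - u)^j <= 1 / (1 + j u)], the decay rate behind both the barrier and the geometric series
    below. *)
Lemma pow_bernoulli (R : realFieldType) (u : R) j : 0 <= u -> u <= 1 ->
  (1 - u) ^+ j * (1 + j%:R * u) <= 1.
Proof.
move=> u0 u1; elim: j => [|j IH]; first by rewrite expr0 mul0r addr0 mulr1.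
apply: le_trans IH; rewrite exprSr -mulrA ler_wpM2l ?exprn_ge0 ?subr_ge0 //.
rewrite -natr1; have : 0 <= j%:R :> R by []; set J := j%:R => J0.
by have := mulr_ge0 (mulr_ge0 J0 u0) u0; have := mulr_ge0 u0 u0; lra.
Qed.

(** * Pade approximants of the logarithm *)

Section LogTaylor.
Variable R : realFieldType.
Implicit Types (p P Q S : {poly R}).
Local Notation z := ('X - 1 : {poly R})%R.

Lemma dvdp_exp_deriv p P k : p ^+ k %| P -> p ^+ k.-1 %| P^`().
Proof.
case/dvdpP => Q ->; rewrite derivM dvdp_add //.
  by rewrite dvdp_mull // dvdp_exp2l // leq_pred.
by rewrite deriv_exp -mulr_natl !dvdp_mull.
Qed.

Lemma dvdp_exp_derivn p P k i : p ^+ k %| P -> p ^+ (k - i) %| P^`(i).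
Proof.
move=> pP; elim: i => [|i IH]; first by rewrite subn0.
by rewrite derivnS subnS; apply: dvdp_exp_deriv.
Qed.

(** Taylor polynomial of the logarithm at [1], up to degree [N]. *)
Definition log_taylor (N : nat) : {poly R} :=
  \sum_(j < N) ((-1) ^+ j / j.+1%:R) *: z ^+ j.+1.

Lemma deriv_subX1 : z^`() = 1.
Proof. by rewrite derivB derivX -polyC1 derivC subr0. Qed.

(** The derivative is a geometric sum of ratio [-z], and ['X] is [1 - (-z)]. *)
Lemma deriv_log_taylor N : 'X * (log_taylor N)^`() = 1 - (- z) ^+ N.
Proof.
have -> : (log_taylor N)^`() = \sum_(j < N) (- z) ^+ j.
  rewrite /log_taylor raddf_sum; apply: eq_bigr => j _ /=.
  rewrite derivZ deriv_exp deriv_subX1 mul1r /= -[X in _ *: X]scaler_nat scalerA divfK ?pnatr_eq0 //.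
  by rewrite (exprNn z) -mul_polyC rmorphXn /= polyCN.
have := subrX1 (- z) N.
set s := \sum_(i < N) _ => e; have : 1 - (- z) ^+ N = - ((- z - 1) * s) by rewrite -e; ring.
by move->; ring.
Qed.

Lemma log_taylor1 N : (log_taylor N).[1] = 0.
Proof.
rewrite /log_taylor horner_sum big1 // => j _.
by rewrite !hornerE subrr expr0n mulr0.
Qed.

Lemma dvdp_deriv_log_taylor N : z ^+ N %| 'X * (log_taylor N)^`() - 1.
Proof.
rewrite deriv_log_taylor (_ : 1 - _ - 1 = - (- z) ^+ N); last by ring.
by rewrite exprNn dvdpNr dvdp_mull.
Qed.

(** Truncated form of [(log t)^(j+1) = (-1)^j j! t^(-j-1)]; each further derivative costs one order
    of contact at [1]. *)
Lemma derivn_log_taylor N j :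
  z ^+ (N - j) %| 'X ^+ j.+1 * (log_taylor N)^`(j.+1) - ((-1) ^+ j * j`!%:R)%:P.
Proof.
elim: j => [|j IH].
  by rewrite subn0 expr1 derivn1 expr0 mul1r polyC1 dvdp_deriv_log_taylor.
set A := 'X ^+ j.+1 * _ in IH.
set c := ((-1) ^+ j * _) in IH.
have -> : 'X ^+ j.+2 * (log_taylor N)^`(j.+2) - ((-1) ^+ j.+1 * (j.+1)`!%:R)%:P
   = 'X * (A - c%:P)^`() - j.+1%:R%:P * (A - c%:P).
  rewrite derivB derivC subr0 /A derivM -derivnS derivXn.
  have -> : (-1) ^+ j.+1 * (j.+1)`!%:R = - (j.+1%:R * c).
    by rewrite /c factS natrM exprS; ring.
  by rewrite polyCN polyCM -[X in 'X * (X * _ + _)]mulr_natl polyC_natr !exprS /=; ring.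
rewrite subnS dvdp_sub //.
  by rewrite dvdp_mull // dvdp_exp_deriv.
by rewrite dvdp_mull // (dvdp_trans _ IH) // dvdp_exp2l // leq_pred.
Qed.

(** Truncated form of the fact that the [k]-th derivative of [t^k log t] is [k! log t] plus a
    constant. The recursion replaces [t] times the derivative of [T] by [1] modulo [z^N]. *)
Lemma derivn_Xn_log_taylor N k : exists a : R,
  z ^+ (N.+1 - k) %| ('X ^+ k * log_taylor N)^`(k) - (k`!%:R *: log_taylor N + a%:P).
Proof.
elim: k => [|k [a IH]].
  by exists 0; rewrite expr0 mul1r derivn0 scale1r addr0 subrr dvdp0.
exists (k.+1%:R * a + k`!%:R).
set T := log_taylor N in IH *; set E := 'X * T^`() - 1.
have zE : z ^+ N %| E by apply: dvdp_deriv_log_taylor.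
have -> : ('X ^+ k.+1 * T)^`(k.+1) =
    k.+1%:R *: ('X ^+ k * T)^`(k) + k`!%:R%:P + ('X ^+ k * E)^`(k).
  rewrite derivSn -derivnZ -(_ : ('X^k)^`(k) = k`!%:R%:P); last first.
    by rewrite derivnXn ffactnn subnn expr0 -polyC1 -polyCMn.
  rewrite -!derivnD; congr (_^`(_)).
  rewrite derivM derivXn -mulr_natl -mul_polyC polyC_natr /E exprS /=.
  ring.
rewrite (_ : _ + _ + _ - _ = k.+1%:R *: (('X ^+ k * T)^`(k) - (k`!%:R *: T + a%:P))
    + ('X ^+ k * E)^`(k)); last first.
  rewrite -!mul_polyC factS natrM polyCD !polyCM; ring.
apply: dvdp_add.
  by rewrite -mul_polyC dvdp_mull // (dvdp_trans _ IH) // dvdp_exp2l //; lia.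
by rewrite subSS; apply: dvdp_exp_derivn; rewrite dvdp_mull.
Qed.

(** * Explicit denominator and Wronskian of the approximant *)

Section PadeAlgebra.
Variables (m : nat) (Rm Sm : {poly R}).
Hypotheses (szR : (size Rm <= m.+1)%N) (szS : (size Sm <= m.+1)%N).
(** Order of contact stated between polynomials: truncating the logarithm after degree [2m + 1]
    alters only terms of order [2m + 2]. *)
Hypothesis contact : z ^+ (2 * m + 2) %| Sm * log_taylor (2 * m + 1) - z * Rm.

Let N := (2 * m + 1)%N.
Let T := log_taylor N.

Lemma size_subX1M : (size (z * Rm)%R <= m.+2)%N.
Proof.
rewrite (leq_trans (size_polyMleq _ _)) //.
by rewrite -polyC1 size_XsubC; lia.
Qed.

(* (m+2)-fold differentiation kills the numerator and turns [t^k log t] into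
   a multiple of [t^(k-m-2)]. *)
Lemma pade_coef_dvd :
  z ^+ m %| \sum_(k < m.+1) (Sm`_k * ((-1) ^+ (m.+1 - k) * k`!%:R * (m.+1 - k)`!%:R)) *: 'X^k.
Proof.
have h1 : z ^+ m %| 'X ^+ m.+2 * (Sm * T)^`(m.+2).
  have -> : (Sm * T)^`(m.+2) = (Sm * T - z * Rm)^`(m.+2).
    rewrite derivnB (@derivn_poly0 _ (z * Rm)) ?subr0 //; exact: size_subX1M.
  apply: dvdp_mull; rewrite (_ : m = 2 * m + 2 - m.+2)%N; last by lia.
  by rewrite {2}(_ : (_ - _)%N = m); [exact: dvdp_exp_derivn | lia].
have h2 : 'X ^+ m.+2 * (Sm * T)^`(m.+2) =
   \sum_(k < m.+1) Sm`_k *: ('X ^+ m.+2 * ('X^k * T)^`(m.+2)).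
  have -> : Sm = \sum_(k < m.+1) Sm`_k *: 'X^k.
    rewrite -poly_def; apply/polyP => i; rewrite coef_poly.
    by case: ltnP => // le; rewrite nth_default // (leq_trans szS).
  rewrite mulr_suml (big_morph (derivn m.+2) (derivnD m.+2) (@derivn_poly0 _ 0 m.+2 _)) ?size_poly0 //.
  rewrite mulr_sumr; apply: eq_bigr => k _.
  rewrite -scalerAl derivnZ -scalerAr -poly_def coef_poly.
  by rewrite ltn_ord.
rewrite h2 in h1; rewrite -(dvdp_subr _ h1) -sumrB.
apply: (big_ind (fun P => z ^+ m %| P)) => [|P Q|k _]; first exact: dvdp0.
  exact: dvdp_add.
have km : (k <= m)%N by rewrite -ltnS.
set i := (m.+1 - k)%N; set c := (_ * i`!%:R).
have -> : forall A : {poly R}, Sm`_k *: A - (Sm`_k * c) *: 'X^k = (Sm`_k)%:P * (A - c *: 'X^k).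
  by move=> A; rewrite mul_polyC scalerBr scalerA.
apply: dvdp_mull.
have [a ha] := derivn_Xn_log_taylor N k.
(* The [m + 2] derivatives are split: the first [k] turn [t^k log t] into [k! log t] plus a
   constant, the other [i + 1] remove the constant and leave a power of [1/t]. *)
have mk : (m.+2 = k + i.+1)%N by rewrite /i; lia.
set D := _^`(k) - _ in ha.
have -> : ('X^k * T)^`(m.+2) = D^`(i.+1) + k`!%:R *: T^`(i.+1).
  rewrite /D derivnB derivnD derivnZ derivnC addr0 subrK mk.
  by rewrite /derivn addnC iterD.
have -> : 'X^(m.+2) * (D^`(i.+1) + k`!%:R *: T^`(i.+1)) - c *: 'X^k =
    'X^(m.+2) * D^`(i.+1) +
    (k`!%:R%:P * 'X^k) * ('X^(i.+1) * T^`(i.+1) - ((-1) ^+ i * i`!%:R)%:P).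
  by rewrite mk exprD /c -!mul_polyC !polyCM; ring.
apply: dvdp_add; apply: dvdp_mull.
  apply: dvdp_trans (dvdp_exp_derivn i.+1 ha).
  by rewrite dvdp_exp2l // /N; lia.
apply: dvdp_trans (derivn_log_taylor N i).
by rewrite dvdp_exp2l // /N /i; lia.
Qed.

Lemma dvdp_monic_size p P : p \is monic -> p %| P -> (size P <= size p)%N ->
  exists c, P = c *: p.
Proof.
move=> mp /dvdpP[Q ->]; have [->|Q0] := eqVneq Q 0.
  by exists 0; rewrite mul0r scale0r.
rewrite size_Mmonic // => le.
have sQ : size Q = 1%N.
  have := size_poly_eq0 Q; have := monic_neq0 mp; rewrite -size_poly_eq0.
  by rewrite (negPf Q0); move: le; case: (size Q) => [|[|?]]; case: (size p) => [|?] //; lia.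
by move/eqP/size_poly1P: sQ => [c _ ->]; exists c; rewrite mul_polyC.
Qed.

Lemma coef_subX1_exp k n : (z ^+ n)`_k = (-1) ^+ (n + k) * 'C(n, k)%:R.
Proof.
have -> : z ^+ n = \poly_(i < n.+1) ((-1) ^+ (n + i) * 'C(n, i)%:R).
  rewrite poly_def -opprB exprNn exprBn mulr_sumr; apply: eq_bigr => i _.
  rewrite expr1n mulr1 exprD -mul_polyC -mulr_natr !polyCM !rmorphXn /=.
  by rewrite polyCN polyC1 polyC_natr; ring.
rewrite coef_poly; case: ltnP => // lt; by rewrite bin_small // mulr0.
Qed.

Lemma size_subX1_exp n : size (z ^+ n) = n.+1.
Proof. by rewrite -polyC1 size_exp_XsubC. Qed.

Lemma monic_subX1_exp n : z ^+ n \is monic.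
Proof. by rewrite monic_exp // -polyC1 monicXsubC. Qed.

(** By [pade_coef_dvd], a polynomial of degree at most [m] is divisible by [z^m], hence a multiple
    of it. Comparing coefficients makes [Sm_k k! (m+1-k)!] proportional to [C(m,k)], the alternating
    signs cancelling. *)
Lemma pade_coef k : (k <= m)%N -> Sm`_k = Sm`_0 * ('C(m, k) * 'C(m.+1, k))%:R.
Proof.
have := pade_coef_dvd; set P := \sum_(k < _) _ => zP.
have PE i : (i <= m)%N ->
    P`_i = Sm`_i * ((-1) ^+ (m.+1 - i) * i`!%:R * (m.+1 - i)`!%:R).
  move=> im; rewrite /P -(poly_def _ (fun k => Sm`_k * ((-1) ^+ (m.+1 - k) * k`!%:R * (m.+1 - k)`!%:R))).
  by rewrite coef_poly ltnS im.
have szP : (size P <= size (z ^+ m))%N.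
  rewrite size_subX1_exp /P -(poly_def _ (fun k => Sm`_k * ((-1) ^+ (m.+1 - k) * k`!%:R * (m.+1 - k)`!%:R))).
  exact: size_poly.
have [c Pc] := dvdp_monic_size (monic_subX1_exp m) zP szP.
have e i : (i <= m)%N -> Sm`_i * (i`!%:R * (m.+1 - i)`!%:R) = - c * 'C(m, i)%:R.
  move=> im; have := PE i im; rewrite Pc coefZ coef_subX1_exp => h.
  have sg : (-1) ^+ (m + i) * (-1) ^+ (m.+1 - i) = -1 :> R.
    rewrite -exprD (_ : (m + i + (m.+1 - i) = m.*2.+1)%N); last by lia.
    by rewrite exprS -mul2n exprM sqrrN expr1n expr1n mulr1.
  have sg2 : (-1) ^+ (m + i) * (-1) ^+ (m + i) = 1 :> R.
    by rewrite -exprD addnn -mul2n exprM sqrrN expr1n expr1n.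
  have -> : - c * 'C(m, i)%:R = - ((-1) ^+ (m + i) * (c * ((-1) ^+ (m + i) * 'C(m, i)%:R))).
    transitivity (- ((-1) ^+ (m + i) * (-1) ^+ (m + i) * (c * 'C(m, i)%:R))); last by ring.
    by rewrite sg2; ring.
  rewrite h.
  transitivity (- ((-1) ^+ (m + i) * (-1) ^+ (m.+1 - i)) * (Sm`_i * (i`!%:R * (m.+1 - i)`!%:R))); last by ring.
  by rewrite sg; ring.
move=> km; have := e 0%N isT; rewrite fact0 subn0 bin0 mulr1 mul1r => e0.
have := e k km; rewrite -e0 => ek.
have F0 : (k`!%:R * (m.+1 - k)`!%:R : R) != 0.
  by rewrite mulf_neq0 // pnatr_eq0 -lt0n fact_gt0.
apply: (mulIf F0); rewrite ek -mulrA -(bin_fact (leqW km)) !natrM; ring.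
Qed.

(** The left side is [t Sm^2] times the derivative of [log t - z Rm / Sm]. Contact makes it
    divisible by [z^(2m+1)], and its degree is at most [2m + 1]; the constant is read at [t = 0],
    where the odd power of [z] is [-1]. *)
Lemma pade_wronskian :
  Sm ^+ 2 - 'X * ((z * Rm)^`() * Sm - z * Rm * Sm^`()) = - Sm`_0 ^+ 2 *: z ^+ N.
Proof.
set Rt := z * Rm; set W := Sm * T - Rt.
set Q := LHS.
have zQ : z ^+ N %| Q.
  have -> : Q = 'X * (W^`() * Sm - W * Sm^`()) - Sm ^+ 2 * ('X * T^`() - 1).
    by rewrite /Q /W derivB [(Sm * T)^`()]derivM; ring.
  apply: dvdp_sub; last by rewrite dvdp_mull // dvdp_deriv_log_taylor.
  apply/dvdp_mull/dvdp_sub; apply: dvdp_mulr.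
    by rewrite (_ : N = (2 * m + 2).-1)%N; [exact: dvdp_exp_deriv | rewrite /N; lia].
  by apply: dvdp_trans contact; rewrite dvdp_exp2l // /N; lia.
have szRt : (size Rt <= m.+2)%N := size_subX1M.
have szQ : (size Q <= size (z ^+ N))%N.
  rewrite size_subX1_exp (leq_trans (size_polyD _ _)) // geq_max size_polyN; apply/andP; split.
    by rewrite expr2 (leq_trans (size_polyMleq _ _)) // /N; lia.
  rewrite (leq_trans (size_polyMleq _ _)) // size_polyX.
  have h1 := size_polyMleq Rt^`() Sm; have h2 := size_polyMleq Rt Sm^`().
  have lS : (size Sm^`() <= m)%N.
    have [->|S0] := eqVneq Sm 0; first by rewrite linear0 size_poly0.
    by have := lt_size_deriv S0; lia.
  have lR : (size Rt^`() <= m.+1)%N.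
    have [->|S0] := eqVneq Rt 0; first by rewrite linear0 size_poly0.
    by have := lt_size_deriv S0; lia.
  have h3 : (size (Rt^`() * Sm - Rt * Sm^`())%R <= N)%N.
    rewrite (leq_trans (size_polyD _ _)) // geq_max size_polyN /N.
    by apply/andP; split; [apply: (leq_trans h1) | apply: (leq_trans h2)]; move: lS lR szS szRt; do 4 move: (size _) => ?; lia.
  by move: h3; move: (size _) => ?; rewrite /N; lia.
have [c Qc] := dvdp_monic_size (monic_subX1_exp N) zQ szQ.
rewrite Qc; congr (_ *: _).
have : Q.[0] = Sm`_0 ^+ 2.
  rewrite /Q hornerD hornerN [('X * _).[0]]hornerM hornerX mul0r oppr0 addr0.
  by rewrite horner_exp horner_coef0.
rewrite Qc hornerZ horner_exp hornerD hornerN hornerX -polyC1 hornerC add0r.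
rewrite /N addn1 exprS exprM sqrrN !expr1n mulr1 => <-; ring.
Qed.

Hypothesis S1 : Sm.[1] = 1.

Lemma pade_denomE t : Sm.[t] = Sm`_0 * \sum_(k < m.+1) ('C(m, k) * 'C(m.+1, k))%:R * t ^+ k.
Proof.
rewrite (horner_coef_wide _ szS) mulr_sumr; apply: eq_bigr => k _.
by rewrite pade_coef -1?ltnS // mulrA.
Qed.

(** Up to the factor [Sm_0] all coefficients are nonnegative, so [Sm(1) = 1] fixes the sign of
    [Sm_0]. *)
Lemma pade_denom0_gt0 : 0 < Sm`_0.
Proof.
have := pade_denomE 1; rewrite S1; set s := \sum_(k < _) _ => e.
have s0 : 0 <= s by apply: sumr_ge0 => k _; rewrite mulr_ge0 // exprn_ge0.
rewrite lt_neqAle eq_sym; apply/andP; split.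
  by apply/eqP => c0; move: e; rewrite c0 mul0r => /eqP; rewrite oner_eq0.
rewrite leNgt; apply/negP => /ltW lt.
by have := mulr_le0_ge0 lt s0; rewrite -e; lra.
Qed.

Lemma pade_denom_ge_term t k : 0 <= t -> (k <= m)%N ->
  Sm`_0 * (('C(m, k) * 'C(m.+1, k))%:R * t ^+ k) <= Sm.[t].
Proof.
move=> t0; rewrite -ltnS => km.
rewrite pade_denomE ler_pM2l ?pade_denom0_gt0 // (bigD1 (Ordinal km)) //= lerDl.
by apply: sumr_ge0 => i _; rewrite mulr_ge0 // exprn_ge0.
Qed.

Lemma pade_denom_ge0 t : 0 <= t -> Sm`_0 <= Sm.[t].
Proof.
by move=> t0; have := pade_denom_ge_term t0 (leq0n m); rewrite !bin0 mul1r expr0 !mulr1.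
Qed.

Lemma pade_denom_gt0 t : 0 <= t -> 0 < Sm.[t].
Proof. by move=> t0; exact: lt_le_trans pade_denom0_gt0 (pade_denom_ge0 t0). Qed.

Lemma pade_denom_homo t u : 0 <= t -> t <= u -> Sm.[t] <= Sm.[u].
Proof.
move=> t0 tu; rewrite !pade_denomE ler_pM2l ?pade_denom0_gt0 //; apply: ler_sum => k _.
by rewrite ler_wpM2l // lerXn2r // ?nnegrE // (le_trans t0).
Qed.

(** Coefficientwise [C(m,k) C(m+1,k) >= C(m,k)], so the denominator dominates [Sm_0 (1 + t)^m]. *)
Lemma pade_denom_ge_exp t : 0 <= t -> Sm`_0 * `|t - 1| ^+ m <= Sm.[t].
Proof.
move=> t0; rewrite pade_denomE ler_pM2l ?pade_denom0_gt0 //.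
apply: (@le_trans _ _ ((1 + t) ^+ m)).
  by rewrite lerXn2r ?nnegrE //; [lra | rewrite ler_norml; apply/andP; split; lra].
rewrite exprDn; apply: ler_sum => k _; rewrite expr1n mul1r -mulr_natl.
rewrite ler_wpM2r ?exprn_ge0 // ler_nat leq_pmulr // bin_gt0.
by apply: ltnW; apply: ltn_ord.
Qed.

(** A single term already carries the factor [m + 1]: the leading one, [C(m+1,m) t^m], for [t >= 1],
    and the linear one, [m (m+1) t], for [t < 1] and [m > 0]. This is the source of the [1/m]
    rate. *)
Lemma pade_denom_ge_min t : 0 <= t ->
  Sm`_0 * (m.+1%:R * Num.min 1 t * `|t - 1| ^+ m) <= Sm.[t].
Proof.
move=> t0; have c0 := pade_denom0_gt0; have [t1|t1] := leP 1 t.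
  apply: le_trans (pade_denom_ge_term t0 (leqnn m)).
  rewrite ler_pM2l // binn mul1n binSn mulr1 ler_pM2l ?ltr0n //.
  by rewrite lerXn2r ?nnegrE //; rewrite ger0_norm; lra.
case: m szS pade_denom_ge_term => [|m'] szS' term.
  apply: le_trans (pade_denom_ge0 t0).
  by rewrite expr0 mul1r mulr1 ler_piMr // ltW.
apply: le_trans (term _ 1%N t0 isT).
rewrite ler_pM2l // !bin1 expr1 natrM -[X in X <= _]mulrA.
rewrite [X in _ <= X * t]mulrC -[X in _ <= X]mulrA ler_pM2l ?ltr0n //.
apply: (@le_trans _ _ t); last first.
  by rewrite ler_peMl // ler1n.
rewrite ler_piMr // exprn_ile1 // ler_norml; apply/andP; split; lra.
Qed.

End PadeAlgebra.
End LogTaylor.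

(** * Divisibility from one-sided flatness at [1] *)

Section PolyFlat.
Variable R : realType.
Implicit Types (P Q : {poly R}).

Lemma poly_flat_root P C delta : 0 < delta ->
  (forall t, 1 < t -> t < 1 + delta -> `|P.[t]| <= C * (t - 1)) -> P.[1] = 0.
Proof.
move=> d0 h; apply/eqP; rewrite -normr_le0.
have /factor_theorem[Q PQ] : root (P - P.[1]%:P) 1.
  by rewrite rootE !hornerE subrr.
have [M QM] := poly_itv_bound Q 1 2.
have M0 : 0 <= M by apply: le_trans (QM 1 _); rewrite ?normr_ge0 // lexx ler1n.
apply/ler_addgt0Pr => e e0; rewrite add0r.
pose c := `|C| + M + 1; have c0 : 0 < c by have := normr_ge0 C; rewrite /c; lra.
pose s := Num.min (Num.min (delta / 2) 1) (e / c).
have s0 : 0 < s by rewrite !lt_min divr_gt0 // ltr01 divr_gt0.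
have sd : s < delta by rewrite /s !gt_min; apply/orP; left; apply/orP; left; lra.
have s1 : s <= 1 by rewrite /s !ge_min lexx orbT.
have se : s * c <= e by rewrite -ler_pdivlMr // /s ge_min lexx orbT.
have := h (1 + s) ltac:(lra) ltac:(lra).
have /(congr1 (horner^~ (1 + s))) := PQ; rewrite !hornerE => e1.
have := QM (1 + s) ltac:(apply/andP; split; lra).
have -> : P.[1] = P.[1 + s] - Q.[1 + s] * s by move: e1; rewrite addrAC subrr add0r => <-; ring.
move=> h1 h2; apply: le_trans (ler_normB _ _) _; rewrite normrM (gtr0_norm s0).
have := ler_norm C; have : `|Q.[1 + s]| * s <= M * s by rewrite ler_wpM2r // ltW.
move: h2; rewrite addrAC subrr add0r /c in se * => h2 h3 h4.
have : C * s <= `|C| * s by rewrite ler_wpM2r // ltW.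
lra.
Qed.

(** One factor [z] is removed at a time: the bound forces a root at [1], and dividing by [t - 1 > 0]
    lowers the exponent. *)
Lemma poly_flat_dvd P k C delta : 0 < delta ->
  (forall t, 1 < t -> t < 1 + delta -> `|P.[t]| <= C * (t - 1) ^+ k) ->
  ('X - 1) ^+ k %| P.
Proof.
move=> d0; elim: k P => [|k IH] P h; first by rewrite expr0 dvd1p.
have : P.[1] = 0.
  apply: (@poly_flat_root P `|C| (Num.min delta 1)); first by rewrite lt_min d0 ltr01.
  move=> t t1; rewrite -ltrBlDl lt_min => /andP[td tt]; apply: le_trans (h _ t1 _) _; first lra.
  apply: (@le_trans _ _ (`|C| * (t - 1) ^+ k.+1)).
    by rewrite ler_wpM2r ?ler_norm // exprn_ge0; lra.
  rewrite ler_wpM2l // exprS ler_piMr ?subr_ge0 ?(ltW t1) //.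
  by apply: exprn_ile1; rewrite ?subr_ge0 ltW.
move/rootP/factor_theorem => [Q PQ]; rewrite PQ polyC1 exprSr dvdp_mul2r; last first.
  by rewrite -polyC1 polyXsubC_eq0.
apply: IH => t t1 td; have := h t t1 td; rewrite PQ hornerM normrM !hornerE.
rewrite (gtr0_norm (_ : 0 < t - 1)); last lra.
by rewrite exprSr mulrA ler_pM2r //; lra.
Qed.
End PolyFlat.

Section MVT1.
Variable R : realType.

(** The sign of [(c - 1) * (t - 1)] is recorded so that points on either side of [1] can later be
    treated alike. *)
Lemma MVT_from_1 (f df : R -> R) (t : R) : 0 < t ->
  (forall s : R, 0 < s -> is_derive s 1 f (df s)) ->
  exists c, [/\ 0 < c, Num.min 1 t <= c, c <= Num.max 1 t,
    0 <= (c - 1) * (t - 1) <= (t - 1) ^+ 2 & f t - f 1 = df c * (t - 1)].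
Proof.
move=> t0 fd.
have cont a b : 0 < a -> {within `[a, b], continuous f}.
  move=> a0; apply: continuous_in_subspaceT => x.
  rewrite inE /= in_itv /= => /andP[ax _].
  have x0 : 0 < x by lra.
  apply/differentiable_continuous; rewrite -derivable1_diffP.
  by have [] := fd x x0.
have [lt|gt|lt] := ltrgtP 1 t.
- have [c] := @MVT R f df _ _ lt (fun x => ltac:(rewrite in_itv /= => /andP[? _]; apply: fd; lra)) (cont _ _ ltr01).
  rewrite in_itv /= => /andP[tc c1] e; exists c; split; rewrite ?(ltW tc) ?(ltW c1) //; first lra.
  by apply/andP; split; nra.
- have [c] := @MVT R f df _ _ gt (fun x => ltac:(rewrite in_itv /= => /andP[? _]; apply: fd; lra)) (cont _ _ t0).
  rewrite in_itv /= => /andP[tc c1] e; exists c; split; rewrite ?(ltW tc) ?(ltW c1) //; [lra | | by nra].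
  by apply/andP; split; nra.
exists 1; rewrite subrr mul0r lt; split => //; first lra.
by rewrite !subrr mulr0.
Qed.

(** The difference has derivative [(1 - s)^N / s], at most [(t - 1)^N] in absolute value for
    [1 <= s <= t]. *)
Lemma ln_log_taylor N (t : R) : 1 < t ->
  `|ln t - (log_taylor R N).[t]| <= (t - 1) ^+ N.+1.
Proof.
move=> t1.
have fd (s : R) : 0 < s -> is_derive s 1 (fun x => ln x - (log_taylor R N).[x])
    ((1 - s) ^+ N / s).
  move=> s0.
  have -> : (1 - s) ^+ N / s = s^-1 - (log_taylor R N)^`().[s].
    have /(congr1 (horner^~ s)) := deriv_log_taylor R N.
    rewrite !hornerE => e.
    have -> : (log_taylor R N)^`().[s] = (1 - (1 - s) ^+ N) / s.
      by apply: (mulfI (lt0r_neq0 s0)); rewrite e mulrCA divff ?lt0r_neq0 // mulr1 opprB.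
    by ring.
  exact: (is_deriveB (is_derive1_ln s0) (is_derive_poly _ s)).
have [c [c0 + + _]] := MVT_from_1 (lt_trans ltr01 t1) fd.
rewrite ln1 log_taylor1 !subr0 (min_l (ltW t1)) (max_r (ltW t1)) => h1 h2 ->.
rewrite normrM (gtr0_norm (_ : 0 < t - 1)); last by rewrite subr_gt0.
rewrite exprSr ler_wpM2r //; first by rewrite subr_ge0 ltW.
rewrite normrM normrX normfV (gtr0_norm c0) distrC ger0_norm ?subr_ge0 //.
rewrite ler_pdivrMr //; apply: (@le_trans _ _ ((t - 1) ^+ N)).
  by rewrite lerXn2r ?nnegrE ?subr_ge0 ?lerB // ltW.
by rewrite ler_peMr // exprn_ge0 // subr_ge0 ltW.
Qed.
End MVT1.

(** * Error of the approximant on the positive axis *)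

Section PadeLog.
Variables (R : realType) (m : nat) (Rm Sm : {poly R}).
Hypothesis pade : pade_log m Rm Sm.

Let szR : (size Rm <= m.+1)%N. Proof. by case: pade. Qed.
Let szS : (size Sm <= m.+1)%N. Proof. by case: pade => _ []. Qed.
Let S1 : Sm.[1] = 1. Proof. by case: pade => _ [_ []]. Qed.

(** Multiplying the analytic estimate by [Sm] and replacing the logarithm by its Taylor polynomial
    leaves a polynomial that is flat to order [2m + 2] on the right of [1]. *)
Lemma pade_contact :
  ('X - 1) ^+ (2 * m + 2) %| Sm * log_taylor R (2 * m + 1) - ('X - 1) * Rm.
Proof.
case: pade => _ [_ [_ [C [delta [d0 h]]]]].
have /factor_theorem[Q SQ] : root (Sm - 1%:P) 1 by rewrite rootE !hornerE S1 subrr.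
have [M QM] := poly_itv_bound Q 1 2.
have M0 : 0 <= M by apply: le_trans (QM 1 _); rewrite ?normr_ge0 // lexx ler1n.
have [M' SM] := poly_itv_bound Sm 1 2.
(* [M] bounds [(Sm - 1) / (t - 1)] on [[1, 2]]; the radius [(M + 1)^-1] keeps [|Sm - 1| < 1], so
   that [Sm] has no zero there. *)
pose dd := Num.min (Num.min delta 1) (M + 1)^-1.
apply: (@poly_flat_dvd R _ _ (M' * (1 + C)) dd).
  by rewrite !lt_min d0 ltr01 invr_gt0; lra.
move=> t t1; rewrite -ltrBlDl !lt_min => /andP[/andP[td tt] tM].
have tI : 1 <= t <= 2 by apply/andP; split; lra.
have S0 : Sm.[t] != 0.
  have /(congr1 (horner^~ t)) := SQ; rewrite !hornerE => e.
  have lt1 : `|Q.[t] * (t - 1)| < 1.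
    rewrite normrM (gtr0_norm (_ : 0 < t - 1)) ?subr_gt0 //.
    apply: (@le_lt_trans _ _ (M * (t - 1))); first by rewrite ler_wpM2r ?QM // subr_ge0 ltW.
    have : (M + 1) * (t - 1) < 1 by rewrite mulrC -ltr_pdivlMr ?div1r //; lra.
    by lra.
  apply/eqP => s0; move: e lt1; rewrite s0 => <-; rewrite sub0r normrN normr1 ltxx.
  by [].
have e : (Sm * log_taylor R (2 * m + 1) - ('X - 1) * Rm).[t] =
   Sm.[t] * ((ln t - (t - 1) * Rm.[t] / Sm.[t]) - (ln t - (log_taylor R (2 * m + 1)).[t])).
  by rewrite !hornerE; field.
have h1 := SM t tI.
have h2 : `|ln t - (t - 1) * Rm.[t] / Sm.[t] - (ln t - (log_taylor R (2 * m + 1)).[t])|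
    <= (1 + C) * (t - 1) ^+ (2 * m + 2).
  apply: (le_trans (ler_normB _ _)); rewrite [X in _ <= X]mulrDl mul1r addrC lerD //.
    by have := ln_log_taylor (2 * m + 1) t1; rewrite addn2 addn1.
  have t0 : 0 < t by lra.
  by have := h t t0; rewrite (gtr0_norm (_ : 0 < t - 1)) ?subr_gt0 //; exact.
by rewrite e normrM -[X in _ <= X]mulrA; apply: ler_pM.
Qed.

Let S_gt0 t : 0 <= t -> 0 < Sm.[t].
Proof. exact: pade_denom_gt0 szR szS pade_contact S1 _. Qed.

Let S0_gt0 : 0 < Sm`_0.
Proof. exact: pade_denom0_gt0 szR szS pade_contact S1. Qed.

Definition pade_rat (t : R) : R := (t - 1) * Rm.[t] / Sm.[t].

(** Measures the error in the derivative: that of [pade_rat] is [(1 + (c - 1) * pade_err c) / c],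
    against [1 / c] for the logarithm. *)
Definition pade_err (c : R) : R := (Sm`_0 * (c - 1) ^+ m / Sm.[c]) ^+ 2.

Lemma pade_err_le1 c : 0 <= c -> pade_err c <= 1.
Proof.
move=> c0; have Sc := S_gt0 c0.
rewrite /pade_err -real_normK ?num_real // exprn_ile1 // !normrM normfV normrX.
rewrite (gtr0_norm Sc) (gtr0_norm S0_gt0) ler_pdivrMr // mul1r.
exact: pade_denom_ge_exp szR szS pade_contact S1 _ c0.
Qed.

(** With [rho = Sm_0 |c - 1|^m / Sm(c)], both [rho <= 1] and [(m + 1) min(1, c) rho <= 1] hold, and
    [pade_err] is [rho^2]. *)
Lemma pade_err_le_min c : 0 <= c -> pade_err c * Num.min 1 c <= m.+1%:R^-1.
Proof.
move=> c0; have Sc := S_gt0 c0.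
have := pade_denom_ge_min szR szS pade_contact S1 c0.
have := pade_denom_ge_exp szR szS pade_contact S1 c0.
rewrite /pade_err -real_normK ?num_real // !normrM normfV normrX.
rewrite (gtr0_norm Sc) (gtr0_norm S0_gt0).
set r := Sm`_0 * `|c - 1| ^+ m => h1 h2.
have r0 : 0 <= r by rewrite mulr_ge0 ?exprn_ge0 // ltW.
have rS0 : 0 <= r / Sm.[c] by rewrite divr_ge0 // ltW.
have rS1 : r / Sm.[c] <= 1 by rewrite ler_pdivrMr // mul1r.
have mn0 : 0 <= Num.min 1 c by rewrite le_min ler01.
apply: (@le_trans _ _ (r / Sm.[c] * Num.min 1 c)).
  by rewrite ler_wpM2r // expr2 ler_piMr.
rewrite -[X in _ <= X]div1r ler_pdivlMr ?ltr0n // mulrAC.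
rewrite mulrAC -mulrA mulrAC ler_pdivrMr // mul1r; apply: le_trans h2.
by rewrite le_eqVlt; apply/orP; left; apply/eqP; rewrite /r; ring.
Qed.

Lemma pade_wronskian_horner s :
  s * ((('X - 1) * Rm)^`() * Sm - ('X - 1) * Rm * Sm^`()).[s] =
  Sm.[s] ^+ 2 + Sm`_0 ^+ 2 * (s - 1) ^+ (2 * m).+1.
Proof.
have := pade_wronskian szR szS pade_contact; set d := _ - _ * Sm^`() => /(congr1 (horner^~ s)).
rewrite hornerD hornerN [('X * _).[s]]hornerM hornerX !hornerE addn1 => e.
by move: e; lra.
Qed.

Lemma is_derive_pade_rat (s : R) : 0 < s ->
  is_derive s 1 pade_rat ((1 + (s - 1) * pade_err s) / s).
Proof.
move=> s0; have Ss := S_gt0 (ltW s0).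
have -> : (1 + (s - 1) * pade_err s) / s =
   (((('X - 1) * Rm)^`() * Sm - ('X - 1) * Rm * Sm^`()).[s]) / Sm.[s] ^+ 2.
  have e := pade_wronskian_horner s.
  apply: (mulfI (lt0r_neq0 s0)); rewrite [RHS]mulrA e mulrCA divff ?lt0r_neq0 // mulr1.
  rewrite /pade_err expr_div_n exprMn -exprM [(m * 2)%N]mulnC [(s - 1) ^+ _.+1]exprS.
  by field; rewrite !lt0r_neq0.
have -> : pade_rat = (fun t => (('X - 1) * Rm).[t] * (Sm.[t])^-1).
  by apply/funext => t; rewrite /pade_rat !hornerE.
have dV := @is_deriveV R (horner Sm) s Sm^`().[s] 1 (lt0r_neq0 Ss) (is_derive_poly Sm s).
apply: (is_derive_eq (is_deriveM (is_derive_poly (('X - 1) * Rm) s) dV)).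
rewrite /GRing.scale /= hornerD hornerN !hornerM.
by field; rewrite !lt0r_neq0.
Qed.

Lemma pade_rat1 : pade_rat 1 = 0.
Proof. by rewrite /pade_rat subrr !mul0r. Qed.

(** The difference has derivative [(s - 1) pade_err(s) / s], so the mean value theorem from [1]
    gives a product of nonnegative factors. *)
Lemma pade_sub_ln t : 0 < t -> exists c, [/\ 0 < c, Num.min 1 t <= c, c <= Num.max 1 t,
    0 <= (c - 1) * (t - 1) <= (t - 1) ^+ 2 &
    pade_rat t - ln t = pade_err c / c * ((c - 1) * (t - 1))].
Proof.
move=> t0.
have fd (s : R) : 0 < s -> is_derive s 1 (fun x => pade_rat x - ln x)
    ((1 + (s - 1) * pade_err s) / s - s^-1).
  by move=> s0; exact: (is_deriveB (is_derive_pade_rat s0) (is_derive1_ln s0)).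
have [c [c0 c1 c2 c3]] := MVT_from_1 t0 fd.
rewrite pade_rat1 ln1 !subr0 => ->; exists c; split => //.
by field; rewrite lt0r_neq0.
Qed.

Lemma pade_ge_ln t : 0 < t -> ln t <= pade_rat t.
Proof.
move=> /pade_sub_ln[c [c0 _ _ /andP[h _] e]].
by rewrite -subr_ge0 e mulr_ge0 // divr_ge0 ?sqr_ge0 // ltW.
Qed.

Lemma pade_le_sub1 t : 0 < t -> pade_rat t <= t - 1.
Proof.
move=> t0.
have fd (s : R) : 0 < s -> is_derive s 1 (fun x => x - pade_rat x)
    (1 - (1 + (s - 1) * pade_err s) / s).
  by move=> s0; exact: (is_deriveB (is_derive_id s 1) (is_derive_pade_rat s0)).
have [c [c0 c1 c2 /andP[c3 _]]] := MVT_from_1 t0 fd.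
rewrite pade_rat1 subr0 => e; rewrite -subr_ge0 -addrA [- 1 - _]addrC addrA e.
rewrite (_ : _ * _ = (1 - pade_err c) / c * ((c - 1) * (t - 1))); last first.
  by field; rewrite lt0r_neq0.
by rewrite mulr_ge0 // divr_ge0 ?subr_ge0 ?pade_err_le1 // ltW.
Qed.

(** The factor [t^2] compensates the division by [c min(1, c)]: for [t < 1] the intermediate point
    satisfies [t <= c <= 1], hence [t^2 <= c^2]. *)
Lemma pade_close t B : 0 < t -> t <= B -> 1 <= B ->
  t ^+ 2 * (pade_rat t - ln t) <= B ^+ 2 / m.+1%:R * (t - 1) ^+ 2.
Proof.
move=> t0 tB B1; have [c [c0 c1 c2 /andP[c3 c4] ->]] := pade_sub_ln t0.
have e0 : 0 <= pade_err c by exact: sqr_ge0.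
have h := pade_err_le_min (ltW c0).
have key : t ^+ 2 * (pade_err c / c) <= B ^+ 2 / m.+1%:R.
  apply: (@le_trans _ _ (B ^+ 2 * (pade_err c * Num.min 1 c))); last first.
    by rewrite ler_wpM2l // sqr_ge0.
  have h2 : t ^+ 2 <= B ^+ 2 * Num.min 1 c * c.
    have [t1|t1] := leP 1 t.
      have c1' : 1 <= c by rewrite (min_l t1) in c1.
      rewrite (min_l c1') mulr1; apply: (@le_trans _ _ (B ^+ 2)).
        by rewrite lerXn2r // nnegrE; lra.
      by rewrite ler_peMr // sqr_ge0.
    rewrite (min_r (ltW t1)) in c1; rewrite (max_l (ltW t1)) in c2.
    rewrite (min_r c2) -mulrA -expr2; apply: (@le_trans _ _ (c ^+ 2)).
      by rewrite lerXn2r // nnegrE; lra.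
    by rewrite ler_peMl ?sqr_ge0 // expr_ge1 //; lra.
  rewrite mulrCA [X in _ <= X]mulrCA ler_wpM2l // ler_pdivrMr //.
rewrite mulrA; apply: ler_pM => //; rewrite mulr_ge0 ?sqr_ge0 // divr_ge0 // ltW //.
Qed.

End PadeLog.

(** * Sums of squares *)

Section AtCoord.
Variables (R : realType) (n : nat).
Implicit Types (p q : {poly R}) (i : 'I_n).

Lemma at_coordD p q i : at_coord (p + q) i = at_coord p i + at_coord q i.
Proof. by rewrite /at_coord rmorphD hornerD. Qed.

Lemma at_coordM p q i : at_coord (p * q) i = at_coord p i * at_coord q i.
Proof. by rewrite /at_coord rmorphM hornerM. Qed.

Lemma at_coordC (c : R) i : at_coord c%:P i = c%:MP.
Proof. by rewrite /at_coord map_polyC hornerC. Qed.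

Lemma at_coordX i : at_coord 'X i = Xc R i.
Proof. by rewrite /at_coord map_polyX hornerX. Qed.

Lemma at_coordN p i : at_coord (- p) i = - at_coord p i.
Proof. by rewrite /at_coord rmorphN hornerN. Qed.

Lemma at_coord1 i : at_coord (1 : {poly R}) i = 1.
Proof. by rewrite -polyC1 at_coordC mpolyC1. Qed.

Lemma at_coordXn p k i : at_coord (p ^+ k) i = at_coord p i ^+ k.
Proof. by rewrite /at_coord rmorphXn horner_exp. Qed.

Lemma at_coordZ c p i : at_coord (c *: p) i = c *: at_coord p i.
Proof. by rewrite -mul_polyC at_coordM at_coordC mul_mpolyC. Qed.

Lemma at_coord_sum (I : Type) (r : seq I) (P : pred I) (F : I -> {poly R}) i :
  at_coord (\sum_(j <- r | P j) F j) i = \sum_(j <- r | P j) at_coord (F j) i.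
Proof. by rewrite /at_coord rmorph_sum horner_sum. Qed.

Lemma meval_at_coord x p i : (at_coord p i).@[x] = p.[x i].
Proof.
elim/poly_ind: p => [|p c IH].
  by rewrite -polyC0 at_coordC mevalC hornerC.
by rewrite at_coordD at_coordM at_coordX at_coordC mevalD mevalM mevalC mevalXU IH !hornerE.
Qed.

End AtCoord.

Section SumOfSquares.
Variables (R : realType) (n : nat).
Implicit Types (f g q : {mpoly R[n]}).

Lemma is_sos_mono k l f : (k <= l)%N -> is_sos k f -> is_sos l f.
Proof.
move=> kl [s [/allP a ->]]; exists s; split=> //.
by apply/allP => q /a h; apply: leq_trans h _.
Qed.

Lemma is_sos0 k : is_sos k (0 : {mpoly R[n]}).
Proof. by exists [::]; rewrite big_nil. Qed.

Lemma is_sosD k f g : is_sos k f -> is_sos k g -> is_sos k (f + g).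
Proof.
move=> [s [a ->]] [t [b ->]]; exists (s ++ t).
by rewrite all_cat a b big_cat.
Qed.

Lemma is_sos_sqr k q : (msize q <= k.+1)%N -> is_sos k (q ^+ 2).
Proof. by move=> h; exists [:: q]; rewrite /= h big_seq1. Qed.

Lemma is_sosZ k c f : 0 <= c -> is_sos k f -> is_sos k (c *: f).
Proof.
move=> c0 [s [/allP a ->]]; exists [seq Num.sqrt c *: q | q <- s]; split.
  apply/allP => _ /mapP[q /a h ->]; exact: leq_trans (msizeZ_le _ _) h.
rewrite big_map scaler_sumr; apply: eq_bigr => q _.
by rewrite exprZn sqr_sqrtr.
Qed.

Lemma is_sos_sum k (I : Type) (r : seq I) (P : pred I) (F : I -> {mpoly R[n]}) :
  (forall i, P i -> is_sos k (F i)) -> is_sos k (\sum_(i <- r | P i) F i).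
Proof.
move=> h; apply: (big_ind (is_sos k)) => //; first exact: is_sos0.
by move=> ? ?; exact: is_sosD.
Qed.

Lemma is_sosM k l f g : is_sos k f -> is_sos l g -> is_sos (k + l) (f * g).
Proof.
move=> [s [/allP a ->]] [t [/allP b ->]].
rewrite mulr_suml; rewrite big_seq; apply: is_sos_sum => p /a hp.
rewrite mulr_sumr; rewrite big_seq; apply: is_sos_sum => q /b hq.
rewrite -exprMn; apply: is_sos_sqr.
have [->|p0] := eqVneq p 0; first by rewrite mul0r msize0.
have [->|q0] := eqVneq q 0; first by rewrite mulr0 msize0.
have hp' : (msize p <= k.+1)%N := hp; have hq' : (msize q <= l.+1)%N := hq.
apply: leq_trans (eq_leq (msizeM p0 q0)) _.
by move: hp' hq'; move: (msize p) (msize q) => u v; lia.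
Qed.

Lemma meval_is_sos k f x : is_sos k f -> 0 <= f.@[x].
Proof.
move=> [s [_ ->]]; rewrite raddf_sum; apply: sumr_ge0 => q _ /=.
by rewrite rmorphXn /= sqr_ge0.
Qed.

Definition sos f := exists k, is_sos k f.

Lemma sosD f g : sos f -> sos g -> sos (f + g).
Proof.
move=> [k hk] [l hl]; exists (maxn k l); apply: is_sosD.
  exact: is_sos_mono (leq_maxl _ _) hk.
exact: is_sos_mono (leq_maxr _ _) hl.
Qed.

Lemma sosM f g : sos f -> sos g -> sos (f * g).
Proof. by move=> [k hk] [l hl]; exists (k + l)%N; apply: is_sosM. Qed.

Lemma sos_sqr q : sos (q ^+ 2).
Proof. by exists (msize q); apply: is_sos_sqr. Qed.

Lemma sosZ c f : 0 <= c -> sos f -> sos (c *: f).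
Proof. by move=> c0 [k h]; exists k; apply: is_sosZ. Qed.

Lemma sos_sum (I : Type) (r : seq I) (P : pred I) (F : I -> {mpoly R[n]}) :
  (forall i, P i -> sos (F i)) -> sos (\sum_(i <- r | P i) F i).
Proof.
move=> h; apply: (big_ind sos) => //; first by exists 0%N; exact: is_sos0.
by move=> ? ?; exact: sosD.
Qed.

Lemma sosC c : 0 <= c -> sos (c%:MP : {mpoly R[n]}).
Proof.
move=> c0; rewrite -[c%:MP]mulr1 mul_mpolyC -(expr1n _ 2).
by apply: sosZ => //; exact: sos_sqr.
Qed.

(* The rows are removed one at a time by completing the square. *)
Lemma psd_sos (a : 'I_n -> 'I_n -> R) (L : 'I_n -> {mpoly R[n]}) :
  (forall i j, a i j = a j i) ->
  (forall v : 'I_n -> R, 0 <= \sum_i \sum_j a i j * (v i * v j)) ->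
  sos (\sum_i \sum_j a i j *: (L i * L j)).
Proof.
move=> sym psd.
suff main : forall (s : seq 'I_n) (b : 'I_n -> 'I_n -> R),
    (forall i j, b i j = b j i) ->
    (forall v : 'I_n -> R, 0 <= \sum_i \sum_j b i j * (v i * v j)) ->
    (forall i j, i \notin s -> b i j = 0) ->
    sos (\sum_i \sum_j b i j *: (L i * L j)).
  by apply: (main (enum 'I_n)) => // i j; rewrite mem_enum.
elim=> [|k s IH] b bsym bpsd bs.
  rewrite big1; first by exists 0%N; exact: is_sos0.
  by move=> i _; rewrite big1 // => j _; rewrite bs // scale0r.
have ev (v : 'I_n -> R) (t : R) :
    \sum_i \sum_j b i j * ((v i + t * (i == k)%:R) * (v j + t * (j == k)%:R)) =
    \sum_i \sum_j b i j * (v i * v j) + 2 * t * (\sum_j b k j * v j) + t ^+ 2 * b k k.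
  have e1 (G : 'I_n -> R) : \sum_i G i * (i == k)%:R = G k.
    rewrite (bigD1 k) //= eqxx mulr1 big1 ?addr0 // => i /negPf ->.
    by rewrite mulr0.
  under eq_bigr => i _.
    rewrite (_ : \sum_j _ = \sum_j b i j * (v i * v j) +
       (\sum_j b i j * v j) * t * (i == k)%:R + (t * b i k * v i + t ^+ 2 * b i k * (i == k)%:R)).
      over.
    rewrite -(e1 (fun j => t * b i j * v i)) -(e1 (fun j => t ^+ 2 * b i j)) !mulr_suml.
    rewrite -!big_split /=; apply: eq_bigr => j _; ring.
  rewrite !big_split /= !e1.
  have -> : \sum_i t * b i k * v i = t * \sum_j b k j * v j.
    by rewrite mulr_sumr; apply: eq_bigr => i _; rewrite bsym mulrA.
  ring.
have bkk : 0 <= b k k.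
  have := bpsd (fun i => 0 + 1 * (i == k)%:R).
  rewrite (ev (fun=> 0) 1) big1 => [|i _]; last by rewrite big1 // => j _; rewrite !mulr0.
  by rewrite big1 => [|j _]; rewrite ?mulr0 // !add0r expr1n mul1r.
have [b0|b0] := eqVneq (b k k) 0.
  apply: IH => // i j; have [ei _|ik nis] := eqVneq i k; last first.
    by apply: bs; rewrite inE negb_or ik.
  apply/eqP; apply: contraT => bij; rewrite ei in bij *.
  (* Since the diagonal entry is zero, the form is affine in the [k]-th coordinate; the coefficient
     [-(Q + 1) / (2 c)] brings its value down from [Q] to [-1]. *)
  pose c := b k j; pose Q := \sum_i0 \sum_j0 b i0 j0 * ((i0 == j)%:R * (j0 == j)%:R : R).
  have := bpsd (fun i0 => (i0 == j)%:R + (- (Q + 1) / (2 * c)) * (i0 == k)%:R).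
  rewrite ev b0 mulr0 addr0 (_ : \sum_j0 b k j0 * _ = c); last first.
    rewrite (bigD1 j) //= eqxx mulr1 big1 ?addr0 // => i0 /negPf ->.
    by rewrite mulr0.
  rewrite -/Q (_ : _ + _ = -1); first by rewrite lerNr oppr0 ler10.
  by field.
have bk : 0 < b k k by rewrite lt_neqAle eq_sym b0.
pose b' i j := b i j - b i k * b k j / b k k.
have -> : \sum_i \sum_j b i j *: (L i * L j) =
   \sum_i \sum_j b' i j *: (L i * L j) + (b k k)^-1 *: (\sum_i b k i *: L i) ^+ 2.
  rewrite expr2 mulr_suml scaler_sumr -big_split /=; apply: eq_bigr => i _.
  rewrite mulr_sumr scaler_sumr -big_split /=; apply: eq_bigr => j _.
  rewrite -scalerAl -scalerAr !scalerA -scalerDl /b' (bsym i k); congr (_ *: _).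
  by field.
apply: sosD; last by apply: sosZ; [rewrite invr_ge0 | exact: sos_sqr].
apply: IH => [i j|v|i j].
- by rewrite /b' (bsym i j) (bsym i k) (bsym k j); ring.
- pose l := \sum_j b k j * v j.
  have := bpsd (fun i => v i + (- l / b k k) * (i == k)%:R); rewrite ev -/l.
  rewrite (_ : \sum_i \sum_j b' i j * _ = \sum_i \sum_j b i j * (v i * v j) - l ^+ 2 / b k k).
    by move=> h; apply: le_trans h _; rewrite le_eqVlt; apply/orP; left; apply/eqP; field.
  rewrite expr2 {1}/l mulr_suml mulr_suml -sumrB; apply: eq_bigr => i _.
  rewrite /l mulr_sumr mulr_suml -sumrB; apply: eq_bigr => j _.
  by rewrite /b' (bsym i k); field.
- have [ei _|ik nis] := eqVneq i k; last first.
    by rewrite /b' !(bs i) ?inE ?negb_or ?ik // mul0r mul0r subrr.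
  by rewrite /b' ei mulrAC divff // mul1r subrr.
Qed.

End SumOfSquares.

(** * Bernstein expansions *)

Section Bernstein.
Variables (R : realType) (b : R).
Hypothesis b0 : 0 < b.

Let ub : {poly R} := (2 * b)^-1 *: ('X + b%:P).
Let wb : {poly R} := (2 * b)^-1 *: (b%:P - 'X).

(** Bernstein basis of [[-b, b]], written in the barycentric coordinates [ub] and [wb] of that
    interval. *)
Definition bern (k j : nat) : {poly R} := 'C(k, j)%:R *: (ub ^+ j * wb ^+ (k - j)).

Definition node (k j : nat) : R := b * (2 * j%:R / k%:R - 1).

Let b20 : 2 * b != 0. Proof. by rewrite mulf_neq0 ?pnatr_eq0 // lt0r_neq0. Qed.

Let ubD : ub + wb = 1.
Proof.
rewrite /ub /wb -scalerDr (_ : 'X + b%:P + (b%:P - 'X) = (2 * b)%:P).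
  by rewrite -mul_polyC -polyCM mulVf // polyC1.
by rewrite mulr_natl mulr2n polyCD; ring.
Qed.

Let XE : 'X = b *: (ub - wb).
Proof.
rewrite /ub /wb -scalerBr scalerA (_ : _ - _ = (2 : R) *: 'X).
  by rewrite scalerA (_ : _ * _ = 1) ?scale1r //; field; rewrite lt0r_neq0.
by rewrite scaler_nat mulr2n; ring.
Qed.

Let ub_bern k j : ub * bern k j = (j.+1%:R / k.+1%:R) *: bern k.+1 j.+1.
Proof.
rewrite /bern scalerA -scalerAr subSS mulrA -exprS; congr (_ *: _).
have := mul_bin_diag k.+1 j; rewrite /= => /(congr1 (fun x => x%:R : R)).
rewrite !natrM => e; apply: (mulfI (_ : k.+1%:R != 0)); first by rewrite pnatr_eq0.
by rewrite e; field; rewrite addrC natr1 pnatr_eq0.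
Qed.

Let wb_bern k j : (j <= k)%N -> wb * bern k j = ((k.+1 - j)%:R / k.+1%:R) *: bern k.+1 j.
Proof.
move=> jk; rewrite /bern scalerA -scalerAr (subSn jk) mulrCA -exprS -(subSn jk); congr (_ *: _).
have := mul_bin_down k.+1 j; rewrite /= => /(congr1 (fun x => x%:R : R)).
rewrite !natrM => e; apply: (mulfI (_ : k.+1%:R != 0)); first by rewrite pnatr_eq0.
by rewrite e; field; rewrite addrC natr1 pnatr_eq0.
Qed.

(** Since ['X = b (ub - wb)], multiplication raises the Bernstein degree by one. The truncated
    predecessor at [j = 0] and the coefficient at [j = k + 1] both come with weight [0]. *)
Lemma bern_mulX k (c : nat -> R) :
  'X * (\sum_(j < k.+1) c j *: bern k j) =
  \sum_(j < k.+2) (b * (j%:R / k.+1%:R * c j.-1 - (k.+1 - j)%:R / k.+1%:R * c j)) *: bern k.+1 j.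
Proof.
have -> : 'X * (\sum_(j < k.+1) c j *: bern k j) =
   b *: (\sum_(j < k.+1) c j *: (ub * bern k j) - \sum_(j < k.+1) c j *: (wb * bern k j)).
  rewrite {1}XE -scalerAl mulrBl !mulr_sumr; congr (_ *: (_ - _));
  by apply: eq_bigr => j _; rewrite -scalerAr.
under [X in _ = X]eq_bigr => j _ do rewrite mulrBr scalerBl -!scalerA.
rewrite sumrB scalerBr -!scaler_sumr; congr (_ *: _ - _ *: _).
  rewrite [RHS]big_ord_recl /= scale0r add0r; apply: eq_bigr => j _.
  by rewrite /bump leq0n add1n /= ub_bern !scalerA; congr (_ *: _); ring.
rewrite [RHS]big_ord_recr /= subnn scale0r addr0; apply: eq_bigr => j _.
by rewrite wb_bern ?scalerA -1?ltnS //; congr (_ *: _); ring.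
Qed.

Lemma sum_bern k : \sum_(j < k.+1) bern k j = 1.
Proof.
rewrite -(expr1n _ k) -ubD addrC exprDn; apply: eq_bigr => j _.
by rewrite /bern scaler_nat mulrC.
Qed.

Lemma node_norm k j : (0 < k)%N -> (j <= k)%N -> `|node k j| <= b.
Proof.
move=> k0 jk; rewrite /node normrM (gtr0_norm b0) ler_piMr ?(ltW b0) //.
have k0' : 0 < k%:R :> R by rewrite ltr0n.
have jk' : j%:R / k%:R <= 1 :> R by rewrite ler_pdivrMr // mul1r ler_nat.
have j0 : 0 <= j%:R / k%:R :> R by rewrite divr_ge0.
by rewrite -mulrA ler_norml; apply/andP; split; lra.
Qed.

Lemma lip_exp m : exists2 L : R, 0 <= L &
  forall x y, `|x| <= b -> `|y| <= b -> `|x ^+ m - y ^+ m| <= L * `|x - y|.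
Proof.
elim: m => [|m [L L0 IH]].
  by exists 0 => // x y _ _; rewrite !expr0 subrr normr0 mul0r.
exists (b * L + b ^+ m) => [|x y xb yb].
  by rewrite addr_ge0 ?mulr_ge0 ?exprn_ge0 // ltW.
have -> : x ^+ m.+1 - y ^+ m.+1 = x * (x ^+ m - y ^+ m) + y ^+ m * (x - y).
  by rewrite !exprS; ring.
rewrite (le_trans (ler_normD _ _)) // mulrDl lerD // normrM.
  by rewrite -mulrA ler_pM // IH.
by rewrite ler_wpM2r // normrX lerXn2r // nnegrE // ltW.
Qed.

(** Induction through [bern_mulX]: the new coefficient is formed with the same weights that express
    the node itself, and the relevant nodes of consecutive degrees differ by [O(1/k)]. *)
Lemma bern_pow m : exists2 E : R, 0 <= E & forall k, (m < k)%N ->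
  exists c : nat -> R, 'X^m = \sum_(j < k.+1) c j *: bern k j /\
    forall j, (j <= k)%N -> `|c j - node k j ^+ m| <= E / k%:R.
Proof.
elim: m => [|m [E E0 IH]].
  exists 0 => // k k0; exists (fun=> 1); split.
    by rewrite expr0 -[LHS](sum_bern k); apply: eq_bigr => j _; rewrite scale1r.
  by move=> j _; rewrite expr0 subrr normr0 mul0r.
have [L L0 hL] := lip_exp m.
(* [E + 2 b L] collects the inductive error and the Lipschitz cost of moving the node; [b] comes
   from [bern_mulX], and [2] from [1/l <= 2/(l+1)]. *)
exists (2 * b * (E + 2 * b * L)) => [|[//|l] ml].
  by rewrite !mulr_ge0 ?addr_ge0 ?mulr_ge0 // ltW.
have l0 : (0 < l)%N by exact: leq_ltn_trans (leq0n m) ml.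
have [c [Xc cc]] := IH l ml.
exists (fun j => b * (j%:R / l.+1%:R * c j.-1 - (l.+1 - j)%:R / l.+1%:R * c j)); split.
  by rewrite exprS Xc bern_mulX.
move=> j jl.
have l0' : 0 < l%:R :> R by rewrite ltr0n.
have L1 : 0 < l.+1%:R :> R by rewrite ltr0n.
set nu := node l.+1 j.
have close i : (i <= l)%N -> `|i%:R / l%:R - j%:R / l.+1%:R| <= l%:R^-1 :> R ->
    `|c i - nu ^+ m| <= (E + 2 * b * L) / l%:R.
  move=> il h; have -> : c i - nu ^+ m = (c i - node l i ^+ m) + (node l i ^+ m - nu ^+ m) by ring.
  rewrite (le_trans (ler_normD _ _)) // mulrDl lerD ?cc //.
  apply: le_trans (hL _ _ (node_norm _ _) (node_norm _ _)) _ => //.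
  rewrite mulrC -mulrA [2 * b * _]mulrC -[L * _ * _]mulrA.
  have -> : node l i - nu = 2 * b * (i%:R / l%:R - j%:R / l.+1%:R) by rewrite /nu /node; ring.
  rewrite normrM (gtr0_norm (_ : 0 < 2 * b)) ?mulr_gt0 //.
  by rewrite [X in X <= _]mulrC ler_wpM2l // mulrC ler_wpM2r ?mulr_ge0 ?(ltW b0).
have e1 : j%:R / l.+1%:R * `|c j.-1 - nu ^+ m| <= j%:R / l.+1%:R * ((E + 2 * b * L) / l%:R).
  case: j jl @nu close => [|j] jl nu close; first by rewrite !mul0r.
  rewrite ler_wpM2l ?divr_ge0 //; apply: close => //=.
  have -> : j%:R / l%:R - j.+1%:R / l.+1%:R = - ((l%:R - j%:R) / l.+1%:R / l%:R) :> R.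
    by field; rewrite addrC natr1 !lt0r_neq0.
  have jl' : j%:R <= l%:R :> R by rewrite ler_nat -ltnS.
  rewrite normrN ger0_norm ?divr_ge0 ?subr_ge0 // ler_piMl ?invr_ge0 //.
  by rewrite ler_pdivrMr // mul1r -natr1; have : 0 <= j%:R :> R by []; lra.
have e2 : (l.+1 - j)%:R / l.+1%:R * `|c j - nu ^+ m| <= (l.+1 - j)%:R / l.+1%:R * ((E + 2 * b * L) / l%:R).
  have [->|jl1] := eqVneq j l.+1; first by rewrite subnn !mul0r.
  have jl2 : (j <= l)%N by rewrite -ltnS ltn_neqAle jl1.
  rewrite ler_wpM2l ?divr_ge0 //; apply: close => //=.
  have -> : j%:R / l%:R - j%:R / l.+1%:R = j%:R / l.+1%:R / l%:R :> R.
    by field; rewrite addrC natr1 !lt0r_neq0.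
  rewrite ger0_norm ?divr_ge0 // ler_piMl ?invr_ge0 //.
  by rewrite ler_pdivrMr // mul1r ler_nat.
have nuE : nu = b * (j%:R / l.+1%:R - (l.+1 - j)%:R / l.+1%:R).
  by rewrite /nu /node natrB //; field; rewrite addrC natr1 lt0r_neq0.
have -> : b * (j%:R / l.+1%:R * c j.-1 - (l.+1 - j)%:R / l.+1%:R * c j) - nu ^+ m.+1 =
  b * (j%:R / l.+1%:R * (c j.-1 - nu ^+ m) - (l.+1 - j)%:R / l.+1%:R * (c j - nu ^+ m)).
  by rewrite exprS {1}nuE; ring.
have G0 : 0 <= E + 2 * b * L by rewrite addr_ge0 ?mulr_ge0 ?(ltW b0).
move: e1 e2 G0; set G := E + _ => e1 e2 G0.
have -> : 2 * b * G / l.+1%:R = b * (G * (2 / l.+1%:R)) by ring.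
rewrite normrM (gtr0_norm b0) ler_pM2l //.
apply: le_trans (ler_normB _ _) _; rewrite !normrM !normfV !normr_nat.
apply: le_trans (lerD e1 e2) _.
rewrite -mulrDl -mulrDl -natrD subnKC // divff ?lt0r_neq0 // mul1r ler_wpM2l //.
by rewrite ler_pdivlMr // mulrC ler_pdivrMr // -natrM ler_nat; lia.
Qed.
End Bernstein.

Section BernsteinMpoly.
Variables (R : realType) (n : nat) (b : R).
Hypothesis b0 : 0 < b.

Lemma prod_close (M : R) : 0 <= M -> forall s : seq 'I_n, exists2 K : R, 0 <= K &
  forall (x y : 'I_n -> R) e, 0 <= e <= 1 -> (forall i, `|y i| <= M) ->
    (forall i, `|x i - y i| <= e) ->
    `|\prod_(i <- s) x i - \prod_(i <- s) y i| <= K * e.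
Proof.
move=> M0; elim=> [|a s [K K0 IH]].
  by exists 0 => // x y e _ _ _; rewrite !big_nil subrr normr0 mul0r.
have [P P0 hP] : exists2 P : R, 0 <= P & forall y : 'I_n -> R, (forall i, `|y i| <= M) ->
    `|\prod_(i <- s) y i| <= P.
  exists (M ^+ size s) => [|y yM]; first exact: exprn_ge0.
  elim: (s) => [|c t IH']; first by rewrite big_nil normr1.
  by rewrite big_cons normrM exprS ler_pM.
exists ((M + 1) * K + P) => [|x y e /andP[e0 e1] yM xy].
  by rewrite addr_ge0 // mulr_ge0 // addr_ge0.
rewrite !big_cons; set X := \prod_(i <- s) x i; set Y := \prod_(i <- s) y i.
have -> : x a * X - y a * Y = x a * (X - Y) + (x a - y a) * Y by ring.
rewrite (le_trans (ler_normD _ _)) // [X in _ <= X]mulrDl lerD // normrM.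
  rewrite -mulrA ler_pM //; last by apply: IH => //; rewrite e0 e1.
  have -> : x a = y a + (x a - y a) by ring.
  by rewrite (le_trans (ler_normD _ _)) // lerD // (le_trans (xy a)).
by rewrite mulrC ler_pM // hP.
Qed.

Definition bernm (k : nat) (f : {ffun 'I_n -> 'I_k.+1}) : {mpoly R[n]} :=
  \prod_i at_coord (bern b k (f i)) i.

Definition nodem (k : nat) (f : {ffun 'I_n -> 'I_k.+1}) (i : 'I_n) : R := node b k (f i).

Definition bern_approx (g : {mpoly R[n]}) := forall e : R, 0 < e -> exists k0, forall k, (k0 <= k)%N ->
  exists C : {ffun 'I_n -> 'I_k.+1} -> R, g = \sum_f C f *: bernm f /\
    forall f, `|C f - g.@[nodem f]| <= e.

Lemma bern_approxX (m : 'X_{1..n}) : bern_approx 'X_[m].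
Proof.
have /choice[E hE] (j : nat) : exists E : R, 0 <= E /\ forall k, (j < k)%N ->
  exists c : nat -> R, 'X^j = \sum_(i < k.+1) c i *: bern b k i /\
    forall i, (i <= k)%N -> `|c i - node b k i ^+ j| <= E / k%:R.
  by have [E ? ?] := bern_pow b0 j; exists E.
pose M := \sum_i b ^+ m i; pose F := \sum_i E (m i).
have M0 : 0 <= M by apply: sumr_ge0 => i _; rewrite exprn_ge0 // ltW.
have F0 : 0 <= F by apply: sumr_ge0 => i _; case: (hE (m i)).
have [K K0 hK] := prod_close M0 (index_enum 'I_n).
move=> e e0.
(* [k] must exceed every exponent, and [F + K F / e <= k] ensures both [F / k <= 1], as [prod_close]
   requires, and [K F / k <= e]. *)
pose k0 := (mdeg m + Num.bound (F + K * F / e)).+1.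
exists k0 => k kk.
have kgt : (0 < k)%N by apply: leq_trans kk.
have kgt' : 0 < k%:R :> R by rewrite ltr0n.
have Fk : F + K * F / e <= k%:R.
  apply: le_trans (ltW (archi_boundP _)) _.
    by rewrite addr_ge0 // divr_ge0 ?mulr_ge0 // ltW.
  by rewrite ler_nat (leq_trans _ kk) // /k0 leqW // leq_addl.
have mk i : (m i < k)%N.
  apply: leq_trans kk; rewrite /k0 ltnS (leq_trans _ (leq_addr _ _)) // mdegE.
  by rewrite (bigD1 i) //= leq_addr.
have /choice[c hc] (i : 'I_n) : exists c : nat -> R,
    'X^(m i) = \sum_(j < k.+1) c j *: bern b k j /\
    forall j, (j <= k)%N -> `|c j - node b k j ^+ m i| <= E (m i) / k%:R.
  by have [_ /(_ k (mk i))] := hE (m i).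
exists (fun f : {ffun 'I_n -> 'I_k.+1} => \prod_i c i (f i)); split.
  rewrite mpolyXE_id.
  have -> : \prod_i 'X_i ^+ m i = \prod_i \sum_(j < k.+1) c i j *: at_coord (bern b k j) i :> {mpoly R[n]}.
    apply: eq_bigr => i _; rewrite -[in LHS]/(Xc R i) -at_coordX -at_coordXn (hc i).1 at_coord_sum.
    by apply: eq_bigr => j _; rewrite at_coordZ.
  rewrite bigA_distr_bigA; apply: eq_bigr => f _.
  by rewrite scaler_prod.
move=> f; rewrite mevalX; apply: le_trans (hK _ _ (F / k%:R) _ _ _) _.
- rewrite divr_ge0 //= ler_pdivrMr // mul1r (le_trans _ Fk) // lerDl.
  by rewrite divr_ge0 ?mulr_ge0 // ltW.
- move=> i; rewrite normrX; apply: (@le_trans _ _ (b ^+ m i)).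
    by rewrite lerXn2r ?nnegrE ?(ltW b0) // node_norm // -ltnS.
  by rewrite /M (bigD1 i) //= lerDl; apply: sumr_ge0 => j _; rewrite exprn_ge0 // ltW.
- move=> i; apply: le_trans ((hc i).2 _ _) _; first by rewrite -ltnS.
  rewrite ler_pM2r ?invr_gt0 // /F (bigD1 i) //= lerDl.
  by apply: sumr_ge0 => j _; case: (hE (m j)).
- rewrite mulrA ler_pdivrMr // [e * _]mulrC -ler_pdivrMr // (le_trans _ Fk) //.
  by rewrite lerDr.
Qed.

Lemma bern_approxP (g : {mpoly R[n]}) : bern_approx g.
Proof.
elim/mpolyind: g => [|c m p _ _ IH] e e0.
  exists 0%N => k _; exists (fun=> 0); split.
    by rewrite big1 // => f _; rewrite scale0r.
  by move=> f; rewrite meval0 subrr normr0 ltW.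
have e1 : 0 < e / 2 / (`|c| + 1) by rewrite !divr_gt0 // ltr_wpDl.
have e2 : 0 < e / 2 by rewrite divr_gt0.
have [k1 h1] := bern_approxX m e1; have [k2 h2] := IH _ e2.
exists (maxn k1 k2) => k; rewrite geq_max => /andP[/h1[C1 [E1 hC1]] /h2[C2 [E2 hC2]]].
exists (fun f => c * C1 f + C2 f); split.
  rewrite {1}E1 {1}E2 scaler_sumr -big_split /=; apply: eq_bigr => f _.
  by rewrite scalerA scalerDl.
move=> f; rewrite mevalD mevalZ.
have -> : c * C1 f + C2 f - (c * ('X_[m]).@[nodem f] + p.@[nodem f]) =
   c * (C1 f - ('X_[m]).@[nodem f]) + (C2 f - p.@[nodem f]) by ring.
rewrite (le_trans (ler_normD _ _)) // [leRHS](splitr e) lerD //.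
rewrite normrM; apply: (@le_trans _ _ (`|c| * (e / 2 / (`|c| + 1)))); first by rewrite ler_wpM2l.
rewrite mulrA ler_pdivrMr ?ltr_wpDl // mulrC ler_pM2l // lerDl //.
Qed.
End BernsteinMpoly.

(** * Sums of squares modulo the sphere *)

Section SphereCone.
Variables (R : realType) (n : nat) (pi : 'I_n -> R) (b : R).
Hypotheses (pi_gt0 : forall i, 0 < pi i) (b0 : 0 < b).
(** Places the sphere inside the box [|x i| <= b]. *)
Hypothesis pib : forall i, 1 <= pi i * b ^+ 2.
Implicit Types (f g : {mpoly R[n]}).
Local Notation sph := (sphere_poly pi).

(** Degree bounds are dropped here; they are recovered at the end by taking [d] large. *)
Definition sphere_cone f := exists s phi, sos s /\ f = s + phi * sph.

Lemma sphere_coneD f g : sphere_cone f -> sphere_cone g -> sphere_cone (f + g).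
Proof.
move=> [s [phi [hs ->]]] [t [psi [ht ->]]]; exists (s + t), (phi + psi).
by split; [exact: sosD | ring].
Qed.

Lemma sphere_coneM f g : sphere_cone f -> sphere_cone g -> sphere_cone (f * g).
Proof.
move=> [s [phi [hs ->]]] [t [psi [ht ->]]].
exists (s * t), (phi * t + s * psi + phi * psi * sph).
by split; [exact: sosM | ring].
Qed.

Lemma sphere_cone_sos f : sos f -> sphere_cone f.
Proof. by move=> h; exists f, 0; split => //; ring. Qed.

Lemma sphere_coneZ c f : 0 <= c -> sphere_cone f -> sphere_cone (c *: f).
Proof.
move=> c0 [s [phi [hs ->]]]; exists (c *: s), (c *: phi).
by split; [exact: sosZ | rewrite scalerDr scalerAl].
Qed.

Lemma sphere_cone1 : sphere_cone 1.
Proof. by apply: sphere_cone_sos; rewrite -(expr1n _ 2); exact: sos_sqr. Qed.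

Lemma sphere_coneX f k : sphere_cone f -> sphere_cone (f ^+ k).
Proof.
move=> h; elim: k => [|k IH]; first by rewrite expr0; exact: sphere_cone1.
by rewrite exprS; exact: sphere_coneM.
Qed.

(** On the sphere [x_i^2] equals [1 / pi_i] minus a sum of squares, and [1 / pi_i <= b^2]. *)
Lemma sphere_cone_sqr_le i : sphere_cone ((b ^+ 2)%:MP - Xc R i ^+ 2).
Proof.
exists ((b ^+ 2 - (pi i)^-1)%:MP + (pi i)^-1 *: \sum_(j < n | j != i) pi j *: Xc R j ^+ 2),
  (- (pi i)^-1)%:MP; split.
  apply: sosD; first by apply: sosC; rewrite subr_ge0 -div1r ler_pdivrMr // mulrC.
  apply: sosZ; first by rewrite invr_ge0 ltW.
  by apply: sos_sum => j _; apply: sosZ; [exact: ltW | exact: sos_sqr].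
set S := \sum_(j < n | _) _.
have -> : sph = pi i *: Xc R i ^+ 2 + S - 1 by rewrite /sphere_poly (bigD1 i).
rewrite -!mul_mpolyC mpolyCB mpolyCN.
have e : ((pi i)^-1)%:MP * (pi i)%:MP = 1 :> {mpoly R[n]}.
  by rewrite -mpolyCM mulVf ?mpolyC1 // lt0r_neq0.
rewrite -[X in _ - X]mul1r -{1}e; ring.
Qed.

(** From [2 b (b + c x) = (b + c x)^2 + (b^2 - x^2)] for [c = 1] or [c = -1]. *)
Lemma sphere_cone_bound i (c : R) : c ^+ 2 = 1 -> sphere_cone (b%:MP + c *: Xc R i).
Proof.
move=> c2.
have -> : b%:MP + c *: Xc R i =
   (2 * b)^-1 *: ((b%:MP + c *: Xc R i) ^+ 2 + ((b ^+ 2)%:MP - Xc R i ^+ 2)).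
  have -> : (b%:MP + c *: Xc R i) ^+ 2 + ((b ^+ 2)%:MP - Xc R i ^+ 2) =
     (2 * b)%:MP * (b%:MP + c *: Xc R i).
    rewrite -!mul_mpolyC [(2 * b)%:MP]mpolyCM [(b ^+ 2)%:MP]mpolyCM mpolyC_nat.
    have e : c%:MP ^+ 2 = 1 :> {mpoly R[n]} by rewrite expr2 -mpolyCM -expr2 c2 mpolyC1.
    have -> : (b%:MP + c%:MP * Xc R i) ^+ 2 =
      b%:MP * b%:MP + 2 * b%:MP * (c%:MP * Xc R i) + c%:MP ^+ 2 * Xc R i ^+ 2 by ring.
    by rewrite e; ring.
  by rewrite mul_mpolyC scalerA mulVf ?scale1r // mulf_neq0 ?pnatr_eq0 // lt0r_neq0.
apply: sphere_coneZ; first by rewrite invr_ge0 mulr_ge0 // ltW.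
by apply: sphere_coneD; [apply/sphere_cone_sos/sos_sqr | exact: sphere_cone_sqr_le].
Qed.

Lemma sphere_cone_bern k j i : sphere_cone (at_coord (bern b k j) i).
Proof.
rewrite /bern at_coordZ at_coordM !at_coordXn !at_coordZ !at_coordD at_coordN at_coordX at_coordC.
have ib : 0 <= (2 * b)^-1 by rewrite invr_ge0 mulr_ge0 // ltW.
apply: sphere_coneZ => //; apply: sphere_coneM; apply/sphere_coneX/sphere_coneZ => //.
  by rewrite addrC -[Xc R i]scale1r; apply: sphere_cone_bound; rewrite expr1n.
by rewrite -scaleN1r; apply: sphere_cone_bound; rewrite sqrrN expr1n.
Qed.

Lemma sphere_cone_bernm k (f : {ffun 'I_n -> 'I_k.+1}) : sphere_cone (bernm b f).
Proof.
rewrite /bernm; apply: (big_ind sphere_cone) => [|? ? ? ?|i _]; first exact: sphere_cone1.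
  exact: sphere_coneM.
exact: sphere_cone_bern.
Qed.

Lemma sphere_cone_sum (I : Type) (r : seq I) (P : pred I) (F : I -> {mpoly R[n]}) :
  (forall i, P i -> sphere_cone (F i)) -> sphere_cone (\sum_(i <- r | P i) F i).
Proof.
move=> h; apply: (big_ind sphere_cone) => //.
  by exists 0, 0; split; [exists 0%N; exact: is_sos0 | ring].
by move=> ? ?; exact: sphere_coneD.
Qed.

(* A matrix polynomial that is uniformly positive definite on the box has
   positive definite Bernstein coefficients in high degree. *)
Lemma box_posdef_cone (A : 'I_n -> 'I_n -> {mpoly R[n]}) (Y : 'I_n -> {mpoly R[n]}) (eta : R) :
  0 < eta ->
  (forall x : 'I_n -> R, (forall i, `|x i| <= b) -> forall v : 'I_n -> R,
     eta * \sum_i v i ^+ 2 <= \sum_i \sum_j (A i j).@[x] * (v i * v j)) ->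
  sphere_cone (\sum_i \sum_j A i j * (Y i * Y j)).
Proof.
(* An entrywise error [e] changes the form by at most [e n] times the squared Euclidean norm;
   [n + 1] avoids a division by zero. *)
move=> eta0 pos; pose e := eta / n.+1%:R.
have e0 : 0 < e by rewrite divr_gt0.
have /choice[k0 hk0] (ij : 'I_n * 'I_n) : exists k0, forall k, (k0 <= k)%N ->
    exists C : {ffun 'I_n -> 'I_k.+1} -> R, A ij.1 ij.2 = \sum_f C f *: bernm b f /\
    forall f : {ffun 'I_n -> 'I_k.+1}, `|C f - (A ij.1 ij.2).@[nodem b f]| <= e.
  exact: bern_approxP.
pose k := (\sum_ij k0 ij).+1.
have /choice[C hC] (ij : 'I_n * 'I_n) : exists C : {ffun 'I_n -> 'I_k.+1} -> R,
    A ij.1 ij.2 = \sum_f C f *: bernm b f /\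
    forall f : {ffun 'I_n -> 'I_k.+1}, `|C f - (A ij.1 ij.2).@[nodem b f]| <= e.
  by apply: hk0; rewrite /k leqW // (bigD1 ij) //= leq_addr.
(* [psd_sos] asks for symmetric matrices, so each Bernstein coefficient is averaged with its
   transpose, which leaves the form unchanged. *)
have -> : \sum_i \sum_j A i j * (Y i * Y j) =
   \sum_f bernm b f * \sum_i \sum_j (2^-1 * (C (i, j) f + C (j, i) f)) *: (Y i * Y j).
  have -> : \sum_i \sum_j A i j * (Y i * Y j) =
     \sum_f bernm b f * \sum_i \sum_j C (i, j) f *: (Y i * Y j).
    under [RHS]eq_bigr => f _ do rewrite mulr_sumr.
    rewrite [RHS]exchange_big; apply: eq_bigr => i _ /=.
    under [RHS]eq_bigr => f _ do rewrite mulr_sumr.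
    rewrite [RHS]exchange_big; apply: eq_bigr => j _ /=.
    rewrite (hC (i, j)).1 /= mulr_suml; apply: eq_bigr => f _.
    by rewrite -scalerAl -scalerAr.
  apply: eq_bigr => f _; congr (_ * _).
  have -> : \sum_i \sum_j (2^-1 * (C (i, j) f + C (j, i) f)) *: (Y i * Y j) =
    2^-1 *: (\sum_i \sum_j C (i, j) f *: (Y i * Y j) + \sum_i \sum_j C (j, i) f *: (Y i * Y j)).
    rewrite -big_split scaler_sumr; apply: eq_bigr => i _ /=.
    rewrite -big_split scaler_sumr; apply: eq_bigr => j _ /=.
    by rewrite -scalerA scalerDl.
  have -> : \sum_i \sum_j C (j, i) f *: (Y i * Y j) = \sum_i \sum_j C (i, j) f *: (Y i * Y j).
    by rewrite exchange_big; apply: eq_bigr => i _; apply: eq_bigr => j _; rewrite (mulrC (Y j)).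
  by rewrite scalerDr -scalerDl (_ : 2^-1 + 2^-1 = 1) ?scale1r //; field.
apply: sphere_cone_sum => f _; apply: sphere_coneM; first exact: sphere_cone_bernm.
apply: sphere_cone_sos; apply: psd_sos => [i j|v]; first by rewrite addrC.
have -> : \sum_i \sum_j 2^-1 * (C (i, j) f + C (j, i) f) * (v i * v j) =
    \sum_i \sum_j C (i, j) f * (v i * v j).
  have -> : \sum_i \sum_j 2^-1 * (C (i, j) f + C (j, i) f) * (v i * v j) =
    2^-1 * (\sum_i \sum_j C (i, j) f * (v i * v j) + \sum_i \sum_j C (j, i) f * (v i * v j)).
    rewrite -big_split mulr_sumr; apply: eq_bigr => i _ /=.
    rewrite -big_split mulr_sumr; apply: eq_bigr => j _ /=; ring.
  have -> : \sum_i \sum_j C (j, i) f * (v i * v j) = \sum_i \sum_j C (i, j) f * (v i * v j).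
    by rewrite exchange_big; apply: eq_bigr => i _; apply: eq_bigr => j _; rewrite (mulrC (v j)).
  by set S := \sum_i _; field.
have nb i : `|nodem b f i| <= b by apply: node_norm => //; rewrite -ltnS.
have := pos _ nb v.
have diff : \sum_i \sum_j (A i j).@[nodem b f] * (v i * v j) -
    \sum_i \sum_j C (i, j) f * (v i * v j) <= eta * \sum_i v i ^+ 2.
  rewrite -sumrB.
  apply: (@le_trans _ _ (\sum_(i < n) \sum_(j < n) e * (2^-1 * (v i ^+ 2 + v j ^+ 2)))).
    apply: ler_sum => i _; rewrite -sumrB; apply: ler_sum => j _.
    rewrite -mulrBl; apply: le_trans (ler_norm _) _; rewrite normrM.
    apply: ler_pM => //; first by rewrite distrC; exact: (hC (i, j)).2.
    rewrite ler_norml; apply/andP; split.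
      by have := sqr_ge0 (v i + v j); rewrite sqrrD; lra.
    by have := sqr_ge0 (v i - v j); rewrite sqrrB; lra.
  have -> : \sum_(i < n) \sum_(j < n) e * (2^-1 * (v i ^+ 2 + v j ^+ 2)) =
     e * n%:R * \sum_i v i ^+ 2.
    under eq_bigr => i _ do rewrite -mulr_sumr -mulr_sumr big_split /= sumr_const card_ord.
    rewrite -mulr_sumr -mulr_sumr big_split /= sumr_const card_ord -sumrMnl.
    by rewrite ?sumrMnl; set S := \sum_(i < n) _; rewrite -[S *+ n]mulr_natr; field.
  rewrite ler_wpM2r ?sumr_ge0 // => [i _|]; first exact: sqr_ge0.
  by rewrite /e mulrAC ler_pdivrMr // ler_wpM2l ?ler_nat // ltW.
lra.
Qed.

End SphereCone.

(** * Quadratic forms in [x - 1] with a free vector in place of [x - 1] *)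

Section QuadraticForms.
Variables (R : realType) (n : nat).
Local Notation Y := (fun k : 'I_n => Xc R k - 1).

(* [P] is a quadratic form in the [X_k - 1] with polynomial coefficients and
   [ev x v] its value at coefficients evaluated in [x] and vector [v]. *)
Definition qform (P : {mpoly R[n]}) (ev : ('I_n -> R) -> ('I_n -> R) -> R) :=
  exists A : 'I_n -> 'I_n -> {mpoly R[n]},
    P = \sum_i \sum_j A i j * (Y i * Y j) /\
    forall x v, ev x v = \sum_i \sum_j (A i j).@[x] * (v i * v j).

Lemma qformD P Q f g : qform P f -> qform Q g -> qform (P + Q) (fun x v => f x v + g x v).
Proof.
move=> [A [-> hf]] [B [-> hg]]; exists (fun i j => A i j + B i j); split.
  rewrite -big_split; apply: eq_bigr => i _; rewrite -big_split; apply: eq_bigr => j _ /=.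
  by rewrite [RHS]mulrDl.
move=> x v; rewrite hf hg -big_split; apply: eq_bigr => i _; rewrite -big_split.
by apply: eq_bigr => j _ /=; rewrite mevalD mulrDl.
Qed.

Lemma qformM (h : {mpoly R[n]}) P f : qform P f -> qform (h * P) (fun x v => h.@[x] * f x v).
Proof.
move=> [A [-> hf]]; exists (fun i j => h * A i j); split.
  rewrite mulr_sumr; apply: eq_bigr => i _; rewrite mulr_sumr; apply: eq_bigr => j _.
  by rewrite mulrA.
move=> x v; rewrite hf mulr_sumr; apply: eq_bigr => i _; rewrite mulr_sumr.
by apply: eq_bigr => j _; rewrite mevalM mulrA.
Qed.

Lemma qform_ext P Q f g : P = Q -> (forall x v, f x v = g x v) -> qform P f -> qform Q g.
Proof. by move=> -> h [A [e hf]]; exists A; split => // x v; rewrite -h hf. Qed.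

Lemma qform0 : qform 0 (fun _ _ => 0).
Proof.
exists (fun _ _ => 0); split=> [|x v]; rewrite big1 // => i _; rewrite big1 // => j _.
  by rewrite mul0r.
by rewrite meval0 mul0r.
Qed.

Lemma qform_sum (I : eqType) (r : seq I) (P : I -> {mpoly R[n]}) f :
  (forall i, qform (P i) (f i)) ->
  qform (\sum_(i <- r) P i) (fun x v => \sum_(i <- r) f i x v).
Proof.
move=> h; elim: r => [|a r IH].
  by apply: qform_ext qform0 => [|x v]; rewrite big_nil.
by apply: qform_ext (qformD (h a) IH) => [|x v]; rewrite big_cons.
Qed.

Lemma qform_lin (l : 'I_n -> {mpoly R[n]}) :
  qform ((\sum_k l k * Y k) ^+ 2) (fun x v => (\sum_k (l k).@[x] * v k) ^+ 2).
Proof.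
exists (fun i j => l i * l j); split=> [|x v].
  rewrite expr2 mulr_suml; apply: eq_bigr => i _; rewrite mulr_sumr; apply: eq_bigr => j _; ring.
rewrite expr2 mulr_suml; apply: eq_bigr => i _; rewrite mulr_sumr; apply: eq_bigr => j _.
rewrite mevalM; ring.
Qed.

Lemma qform_homog P f x v r : qform P f -> f x (fun i => r * v i) = r ^+ 2 * f x v.
Proof.
move=> [A [_ hf]]; rewrite !hf mulr_sumr; apply: eq_bigr => i _; rewrite mulr_sumr.
by apply: eq_bigr => j _; ring.
Qed.

End QuadraticForms.

(** * Penalty argument *)

Section Continuity.
Variables (R : realType) (T : topologicalType).
Implicit Types f g : T -> R.

Lemma continuous_add f g : continuous f -> continuous g -> continuous (fun w => f w + g w).
Proof. by move=> hf hg w; apply: cvgD; [exact: hf | exact: hg]. Qed.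

Lemma continuous_sub f g : continuous f -> continuous g -> continuous (fun w => f w - g w).
Proof. by move=> hf hg w; apply: cvgB; [exact: hf | exact: hg]. Qed.

Lemma continuous_mul f g : continuous f -> continuous g -> continuous (fun w => f w * g w).
Proof. by move=> hf hg w; apply: cvgM; [exact: hf | exact: hg]. Qed.

Lemma continuous_inv f : (forall w, f w != 0) -> continuous f -> continuous (fun w => (f w)^-1).
Proof. by move=> h hf w; apply: cvgV => //; exact: hf. Qed.

Lemma continuous_norm f : continuous f -> continuous (fun w => `|f w|).
Proof. by move=> hf w; apply: cvg_norm; exact: hf. Qed.

Lemma continuous_pow f k : continuous f -> continuous (fun w => f w ^+ k).
Proof.
move=> hf; elim: k => [|k IH].
  by rewrite (_ : (fun w => _) = cst 1); [exact: cst_continuous | apply/funext => w; rewrite expr0].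
rewrite (_ : (fun w => _) = (fun w => f w * f w ^+ k)); first exact: continuous_mul.
by apply/funext => w; rewrite exprS.
Qed.

Lemma continuous_sum (I : Type) (r : seq I) (F : I -> T -> R) :
  (forall i, continuous (F i)) -> continuous (fun w => \sum_(i <- r) F i w).
Proof.
move=> h; elim: r => [|a r IH].
  by rewrite (_ : (fun w => _) = cst 0); [exact: cst_continuous | apply/funext => w; rewrite big_nil].
rewrite (_ : (fun w => _) = (fun w => F a w + \sum_(i <- r) F i w)); first exact: continuous_add.
by apply/funext => w; rewrite big_cons.
Qed.

Lemma continuous_poly (p : {poly R}) f : continuous f -> continuous (fun w => p.[f w]).
Proof.
move=> hf w; apply: (@continuous_comp _ _ _ f (horner p)); first exact: hf.
exact: continuous_horner.
Qed.

(* The set where [F <= 0] is compact and [P] is bounded away from [0] on it. *)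
Lemma penalty (K : set T) (F P H : T -> R) :
  compact K -> continuous F -> continuous P -> continuous H ->
  (forall w, K w -> H w = 0 -> 0 <= P w) ->
  (forall w, K w -> H w = 0 -> P w = 0 -> 0 < F w) ->
  exists2 N : R, 0 <= N & forall w, K w -> H w = 0 -> 0 < F w + N * P w.
Proof.
move=> cK cF cP cH P0 F0.
pose B := K `&` [set w | H w = 0] `&` [set w | F w <= 0].
have cB : compact B.
  apply: compact_closedI; first apply: compact_closedI => //.
    apply: (@closed_comp _ _ H [set x | x = 0]); last exact: closed_eq.
    by move=> w _; exact: cH.
  apply: (@closed_comp _ _ F [set x | x <= 0]); last exact: closed_le.
  by move=> w _; exact: cF.
have [[w0 Bw0]|/set0P/negP/negPn/eqP B0] := pselect (B !=set0); last first.
  exists 0 => // w Kw Hw; rewrite mul0r addr0 ltNge; apply/negP => Fw.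
  by have : B w by []; rewrite B0.
have nB : B !=set0 by exists w0.
have [p pB hp] := compact_EVT_min nB cB (continuous_subspaceT cP).
have [q qB hq] := compact_EVT_min nB cB (continuous_subspaceT cF).
have Pp : 0 < P p.
  move: pB; rewrite inE => -[[Kp Hp] /= Fp]; rewrite lt_neqAle P0 // andbT eq_sym.
  by apply/eqP => /(F0 p Kp Hp); rewrite ltNge Fp.
have Fq : F q <= 0 by move: qB; rewrite inE => -[].
(* On [B] one has [F >= F q] and [P >= P p > 0], so the quotient already makes the sum nonnegative;
   the extra [1] makes it positive. *)
exists (- F q / P p + 1).
  by rewrite addr_ge0 // divr_ge0 ?oppr_ge0 // ltW.
move=> w Kw Hw; have [Fw|Fw] := ltP 0 (F w).
  rewrite ltr_pwDl // mulr_ge0 ?P0 // addr_ge0 // divr_ge0 ?oppr_ge0 // ltW //.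
have wB : w \in B by rewrite inE.
have := hp w wB; have := hq w wB => h1 h2.
have : - F q / P p * P p <= - F q / P p * P w.
  by rewrite ler_wpM2l // divr_ge0 ?oppr_ge0 // ltW.
rewrite divfK ?lt0r_neq0 // => h3.
by rewrite mulrDl mul1r; lra.
Qed.

End Continuity.

Section Box.
Variables (R : realType) (n : nat) (b : R).

(** A pair [(x, v)] is packed into one row vector, so that compactness is that of a product of
    segments. *)
Definition xpart (w : 'rV[R]_(n + n)) (i : 'I_n) : R := w ord0 (lshift n i).
Definition vpart (w : 'rV[R]_(n + n)) (i : 'I_n) : R := w ord0 (rshift n i).

Definition box2 : set 'rV[R]_(n + n) := [set w | forall i, w ord0 i \in `[- b, b]].

Lemma compact_box2 : compact box2.
Proof.
by apply: (@rV_compact _ _ (fun=> [set` `[- b, b]])) => i; exact: segment_compact.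
Qed.

Lemma continuous_xpart i : continuous (xpart^~ i).
Proof. exact: coord_continuous. Qed.

Lemma continuous_vpart i : continuous (vpart^~ i).
Proof. exact: coord_continuous. Qed.

Lemma box2_pair (x v : 'I_n -> R) : (forall i, `|x i| <= b) -> (forall i, `|v i| <= b) ->
  exists w, [/\ box2 w, xpart w = x & vpart w = v].
Proof.
move=> hx hv; exists (row_mx (\row_i x i) (\row_i v i)); split.
- move=> i; rewrite in_itv /= -ler_norml.
  by rewrite mxE; case: splitP => j _; rewrite mxE.
- by apply/funext => i; rewrite /xpart row_mxEl mxE.
- by apply/funext => i; rewrite /vpart row_mxEr mxE.
Qed.

End Box.

(** * The certificate *)

Section Core.
Variables (R : realType) (n : nat) (K : 'M[R]_n) (pi : 'I_n -> R) (b gamma delta : R) (q : {poly R}).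
Hypotheses (pi_gt0 : forall i, 0 < pi i) (pi1 : \sum_i pi i = 1).
Hypotheses (b0 : 0 < b) (pib : forall i, 1 <= pi i * b ^+ 2) (delta0 : 0 < delta).
(** The inequality to be certified, with a margin quadratic in the distance to [x = 1], where both
    sides vanish. *)
Hypothesis star : forall x : 'I_n -> R, (forall i, 0 <= x i) -> normpi2 pi x = 1 ->
  delta * normpi2 pi (fun i => x i - 1) <=
  gamma * dirichlet K pi x - \sum_i pi i * (x i - 1) ^+ 2 * q.[x i].
Implicit Types (x v : 'I_n -> R).

Let mean v := \sum_i pi i * v i.
Let Phi x v := gamma * dirichlet K pi v - \sum_i pi i * v i ^+ 2 * q.[x i].
Let dot x v := \sum_i pi i * (x i - 1) * v i.
(** [P1] is the Gram determinant of [x - 1] and [v]. [P2] vanishes at [v = x - 1] on the sphere,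
    where the squared norm of [x - 1] is [2 (1 - mean x)]. At [x = 1], where [P1] vanishes for every
    [v], [P2 = 0] still selects the tangent directions [mean v = 0]. *)
Let P1 x v := normpi2 pi (fun i => x i - 1) * normpi2 pi v - dot x v ^+ 2.
Let P2 x v := mean v ^+ 2 - (1 - mean x) / 2 * normpi2 pi v.
(** Twice the total negative part: zero exactly on the nonnegative orthant. *)
Let negp x := \sum_i (`|x i| - x i).

Lemma normpi2_ge0 v : 0 <= normpi2 pi v.
Proof. by apply: sumr_ge0 => i _; rewrite mulr_ge0 ?sqr_ge0 // ltW. Qed.

Lemma normpi2_eq0 v : normpi2 pi v = 0 -> forall i, v i = 0.
Proof.
move=> e i; have := @psumr_eq0P R _ predT (fun i => pi i * v i ^+ 2).
move=> /(_ (fun i _ => mulr_ge0 (ltW (pi_gt0 i)) (sqr_ge0 _)) e i isT) /eqP.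
by rewrite mulf_eq0 sqrf_eq0 (gt_eqF (pi_gt0 i)) => /eqP.
Qed.

Lemma normpi2D (u v : 'I_n -> R) t : normpi2 pi (fun i => u i + t * v i) =
  normpi2 pi u + 2 * t * (\sum_i pi i * u i * v i) + t ^+ 2 * normpi2 pi v.
Proof.
rewrite /normpi2 !mulr_sumr -!big_split; apply: eq_bigr => i _ /=; ring.
Qed.

Lemma normpi2_sub1 x : normpi2 pi (fun i => x i - 1) = normpi2 pi x - 2 * mean x + 1.
Proof.
have -> : normpi2 pi (fun i => x i - 1) = normpi2 pi (fun i => x i + (-1) * 1).
  by apply: eq_bigr => i _; rewrite mulr1.
rewrite normpi2D.
have -> : normpi2 pi (fun=> 1) = 1 by rewrite -[RHS]pi1; apply: eq_bigr => i _; rewrite expr1n mulr1.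
have -> : \sum_i pi i * x i * 1 = mean x by apply: eq_bigr => i _; rewrite mulr1.
ring.
Qed.

Lemma cauchy_schwarz_pi (u v : 'I_n -> R) :
  (\sum_i pi i * u i * v i) ^+ 2 <= normpi2 pi u * normpi2 pi v.
Proof.
set c := \sum_i _; have [v0|v0] := eqVneq (normpi2 pi v) 0.
  rewrite v0 mulr0 /c big1 ?expr0n // => i _.
  by rewrite (normpi2_eq0 v0) mulr0.
have v1 : 0 < normpi2 pi v by rewrite lt_neqAle eq_sym v0 normpi2_ge0.
have := normpi2_ge0 (fun i => u i + (- c / normpi2 pi v) * v i).
rewrite normpi2D -/c (_ : _ + _ = normpi2 pi u - c ^+ 2 / normpi2 pi v); last by field.
by rewrite subr_ge0 ler_pdivrMr.
Qed.

Lemma normpi2_le_b v i : normpi2 pi v = 1 -> `|v i| <= b.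
Proof.
move=> e; have h : pi i * v i ^+ 2 <= 1.
  rewrite -e /normpi2 (bigD1 i) //= lerDl; apply: sumr_ge0 => j _.
  by rewrite mulr_ge0 ?sqr_ge0 // ltW.
have : v i ^+ 2 <= b ^+ 2 by rewrite -(ler_pM2l (pi_gt0 i)) (le_trans h).
by rewrite -[v i ^+ 2]real_normK ?num_real // ler_pXn2r // nnegrE // ltW.
Qed.

Lemma dirichlet_affine v (t c : R) x : (forall i, x i = c + t * v i) ->
  dirichlet K pi x = t ^+ 2 * dirichlet K pi v.
Proof.
move=> e; rewrite /dirichlet mulrCA; congr (_ * _); rewrite mulr_sumr; apply: eq_bigr => i _.
rewrite mulr_sumr; apply: eq_bigr => j _; rewrite !e; ring.
Qed.

Lemma P1_collinear x v : normpi2 pi v = 1 -> P1 x v = 0 ->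
  forall i, x i = 1 + dot x v * v i.
Proof.
move=> v1 p1 i.
have h : normpi2 pi (fun i => (x i - 1) + (- dot x v) * v i) = 0.
  rewrite normpi2D -/(dot x v) v1; move: p1; rewrite /P1 v1; lra.
by have := normpi2_eq0 h i; lra.
Qed.

(** Here [x = 1 + t v], and the sphere equation reads [2 t mean v + t^2 = 0]; modulo it [P2] is the
    square [(mean v + t / 2)^2]. *)
Lemma P2_ge0 x v : normpi2 pi x = 1 -> normpi2 pi v = 1 -> P1 x v = 0 -> 0 <= P2 x v.
Proof.
move=> x1 v1 p1; set t := dot x v.
have e := P1_collinear v1 p1.
have m : mean x = 1 + t * mean v.
  rewrite /mean mulr_sumr -pi1 -big_split; apply: eq_bigr => i _ /=.
  by rewrite e -/t; ring.
have h : 2 * t * mean v + t ^+ 2 = 0.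
  have := normpi2_sub1 x; rewrite x1 m.
  have -> : normpi2 pi (fun i => x i - 1) = t ^+ 2.
    by move: p1; rewrite /P1 v1 mulr1 -/t; lra.
  lra.
rewrite /P2 m v1 mulr1.
have -> : mean v ^+ 2 - (1 - (1 + t * mean v)) / 2 =
  (mean v + t / 2) ^+ 2 - (2 * t * mean v + t ^+ 2) / 4 by field.
by rewrite h mul0r subr0 sqr_ge0.
Qed.

(* Second-order information at [x = 1]: approach it along the points
   [1 + theta (v - s)] of the sphere, with [theta = 2 s / (1 + s^2)]. *)
Lemma Phi_at1 v : normpi2 pi v = 1 -> mean v = 0 -> delta <= Phi (fun=> 1) v.
Proof.
move=> v1 mv; rewrite leNgt; apply/negP => lt.
pose th (s : R) := 2 * s / (1 + s ^+ 2).
(* [g s] is the gap in [star] at the point of parameter [s], divided by [th s ^+ 2]; its value at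
   [0] is [Phi (fun=> 1) v - delta], assumed negative. *)
pose g (s : R) := gamma * dirichlet K pi v
   - \sum_i pi i * (v i - s) ^+ 2 * q.[1 + th s * (v i - s)] - delta * (1 + s ^+ 2).
have s2 (s : R) : 0 < 1 + s ^+ 2 by rewrite ltr_pwDl // sqr_ge0.
have cid : continuous (fun s : R => s) by move=> s; exact: cvg_id.
have cth : continuous th.
  apply: continuous_mul; first by apply: continuous_mul => //; exact: cst_continuous.
  apply: continuous_inv => [s|]; first by rewrite lt0r_neq0.
  by apply: continuous_add; [exact: cst_continuous | exact: continuous_pow].
have cg : continuous g.
  apply: continuous_sub; last first.
    by apply: continuous_mul; [exact: cst_continuous | apply: continuous_add; [exact: cst_continuous | exact: continuous_pow]].
  apply: continuous_sub; first exact: cst_continuous.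
  apply: continuous_sum => i.
  have cvs : continuous (fun s : R => v i - s) by apply: continuous_sub => //; exact: cst_continuous.
  apply: continuous_mul; first by apply: continuous_mul; [exact: cst_continuous | exact: continuous_pow].
  apply: continuous_poly; apply: continuous_add; first exact: cst_continuous.
  exact: continuous_mul.
have g0 : g 0 < 0.
  rewrite /g /th mulr0 mul0r expr0n addr0 mulr1.
  under eq_bigr => i _ do rewrite subr0 mul0r addr0.
  by rewrite subr_lt0.
have : \forall s \near (0 : R), g s < 0.
  exact: (cvgr_lt _ (cg 0) _ g0).
move=> /nbhs_ballP[e /= e0 he].
(* [s < e] keeps [g s] negative, while [2 s (b + 1) <= 1] keeps the point in the nonnegative
   orthant, as [|v i| <= b] and [th s <= 2 s]. *)
pose s := Num.min (e / 2) (Num.min 1 (2 * (b + 1))^-1).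
have b1 : 0 < 2 * (b + 1) by rewrite mulr_gt0 // addr_gt0.
have s0 : 0 < s by rewrite !lt_min divr_gt0 // ltr01 invr_gt0.
have se : s < e by rewrite /s gt_min; apply/orP; left; lra.
have s1 : s <= 1 by rewrite /s !ge_min lexx orbT.
have sb : s * (2 * (b + 1)) <= 1.
  by rewrite -ler_pdivlMr // div1r /s !ge_min lexx !orbT.
have : g s < 0 by apply: he; rewrite /ball /= sub0r normrN gtr0_norm.
apply/negP; rewrite -leNgt.
pose x i := 1 + th s * (v i - s).
have th0 : 0 < th s by rewrite divr_gt0 // mulr_gt0.
have thE : th s * (1 + s ^+ 2) = 2 * s by rewrite divfK // lt0r_neq0.
have vs : normpi2 pi (fun i => v i - s) = 1 + s ^+ 2.
  have -> : normpi2 pi (fun i => v i - s) = normpi2 pi (fun i => v i + (- s) * 1).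
    by apply: eq_bigr => i _; rewrite mulr1.
  rewrite normpi2D v1.
  have -> : normpi2 pi (fun=> 1) = 1 by rewrite -[RHS]pi1; apply: eq_bigr => i _; rewrite expr1n mulr1.
  have -> : \sum_i pi i * v i * 1 = 0 by rewrite -[RHS]mv; apply: eq_bigr => i _; rewrite mulr1.
  by rewrite mulr0 addr0 sqrrN mulr1.
have mvs : mean (fun i => v i - s) = - s.
  rewrite /mean; under eq_bigr => i _ do rewrite mulrBr.
  by rewrite sumrB -mulr_suml pi1 mul1r -/(mean v) mv sub0r.
have y i : x i - 1 = th s * (v i - s) by rewrite /x; ring.
have nx : normpi2 pi x = 1.
  have -> : normpi2 pi x = normpi2 pi (fun i => 1 + th s * (v i - s)) by [].
  rewrite normpi2D vs.
  have -> : normpi2 pi (fun=> 1) = 1 by rewrite -[RHS]pi1; apply: eq_bigr => i _; rewrite expr1n mulr1.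
  have -> : \sum_i pi i * 1 * (v i - s) = - s by rewrite -[RHS]mvs; apply: eq_bigr => i _; rewrite mulr1.
  have -> : th s ^+ 2 * (1 + s ^+ 2) = th s * (2 * s) by rewrite -thE; ring.
  ring.
have th2 : th s <= 2 * s by rewrite -thE ler_peMr ?(ltW th0) // lerDl sqr_ge0.
have x0 i : 0 <= x i.
  have := normpi2_le_b i v1; rewrite ler_norml => /andP[vb _].
  have : - (b + 1) <= v i - s by lra.
  move=> h; have : th s * (- (b + 1)) <= th s * (v i - s) by rewrite ler_pM2l.
  have : th s * (b + 1) <= 2 * s * (b + 1) by rewrite ler_pM2r // addr_gt0.
  by rewrite /x; lra.
have := star x0 nx.
have -> : dirichlet K pi x = th s ^+ 2 * dirichlet K pi v.
  by apply: (@dirichlet_affine _ _ (1 - th s * s)) => i; rewrite /x; ring.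
have -> : normpi2 pi (fun i => x i - 1) = th s ^+ 2 * (1 + s ^+ 2).
  rewrite -vs /normpi2 mulr_sumr; apply: eq_bigr => i _; rewrite y; ring.
have -> : \sum_i pi i * (x i - 1) ^+ 2 * q.[x i] =
   th s ^+ 2 * \sum_i pi i * (v i - s) ^+ 2 * q.[1 + th s * (v i - s)].
  rewrite mulr_sumr; apply: eq_bigr => i _; rewrite y /x; ring.
move=> h; rewrite /g; have : 0 < th s ^+ 2 by rewrite exprn_gt0.
move: h; set A := dirichlet _ _ _; set B := \sum_i _; set t := th s ^+ 2; set C := 1 + s ^+ 2.
move=> h t0; rewrite -(pmulr_rge0 _ t0); move: h; lra.
Qed.

(** With [x = 1 + t v], either [t] is nonzero and [star] is divided by [t^2], or [x = 1] and
    [P2 = 0] reduces to the tangent case [Phi_at1]. *)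
Lemma Phi_ge x v : (forall i, 0 <= x i) -> normpi2 pi x = 1 -> normpi2 pi v = 1 ->
  P1 x v = 0 -> P2 x v = 0 -> delta <= Phi x v.
Proof.
move=> x0 x1 v1 p1 p2; have e := P1_collinear v1 p1; set t := dot x v in e.
have [t0|t0] := eqVneq t 0.
  have e1 i : x i = 1 by rewrite e t0 mul0r addr0.
  have ex : x = fun=> 1 by apply/funext.
  have mx : mean x = 1 by rewrite -[RHS]pi1; apply: eq_bigr => i _; rewrite e1 mulr1.
  rewrite ex; apply: Phi_at1 => //; move: p2; rewrite /P2 mx subrr mul0r mul0r subr0.
  by move/eqP; rewrite sqrf_eq0 => /eqP.
have := star x0 x1.
rewrite (dirichlet_affine e).
have -> : normpi2 pi (fun i => x i - 1) = t ^+ 2.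
  by move: p1; rewrite /P1 v1 mulr1 -/t; lra.
have -> : \sum_i pi i * (x i - 1) ^+ 2 * q.[x i] = t ^+ 2 * \sum_i pi i * v i ^+ 2 * q.[x i].
  by rewrite mulr_sumr; apply: eq_bigr => i _; rewrite {1}e; ring.
have t2 : 0 < t ^+ 2 by rewrite lt_neqAle eq_sym sqrf_eq0 t0 sqr_ge0.
move=> h; rewrite -(ler_pM2l t2) /Phi; lra.
Qed.

(** [penalty] is used twice: first with [P2], whose sign is known only on the set [H = 0], then
    under a trivial constraint with [H] itself, which is nonnegative everywhere. *)
Lemma penalty_bound : exists c N : R, 0 <= N /\ forall x v,
  (forall i, `|x i| <= b) -> normpi2 pi v = 1 ->
  delta / 2 < Phi x v + c * P2 x v + N * (P1 x v + (normpi2 pi x - 1) ^+ 2) + N * negp x.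
Proof.
pose X := @xpart R n; pose V := @vpart R n.
have cX i : continuous (X^~ i) := @continuous_xpart R n i.
have cV i : continuous (V^~ i) := @continuous_vpart R n i.
have cc (c : R) : continuous (fun _ : 'rV[R]_(n + n) => c) by exact: cst_continuous.
have cnorm (f : 'rV[R]_(n + n) -> 'I_n -> R) : (forall i, continuous (f^~ i)) ->
    continuous (fun w => normpi2 pi (f w)).
  move=> h; apply: continuous_sum => i; apply: continuous_mul => //.
  exact: continuous_pow.
have cmean (f : 'rV[R]_(n + n) -> 'I_n -> R) : (forall i, continuous (f^~ i)) ->
    continuous (fun w => mean (f w)).
  by move=> h; apply: continuous_sum => i; apply: continuous_mul.
have cP1 : continuous (fun w => P1 (X w) (V w)).
  apply: continuous_sub.
    apply: continuous_mul; last exact: cnorm.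
    by apply: (cnorm (fun w i => X w i - 1)) => i; apply: continuous_sub.
  apply: continuous_pow; apply: continuous_sum => i; apply: continuous_mul => //.
  by apply: continuous_mul => //; apply: continuous_sub.
have cP2 : continuous (fun w => P2 (X w) (V w)).
  apply: continuous_sub; first by apply: continuous_pow; exact: cmean.
  apply: continuous_mul; last exact: cnorm.
  by apply: continuous_mul => //; apply: continuous_sub => //; exact: cmean.
have cPhi : continuous (fun w => Phi (X w) (V w) - delta / 2).
  apply: continuous_sub => //; apply: continuous_sub.
    apply: continuous_mul => //; apply: continuous_mul => //.
    apply: continuous_sum => i; apply: continuous_sum => j; apply: continuous_mul => //.
    by apply: continuous_pow; apply: continuous_sub.
  apply: continuous_sum => i; apply: continuous_mul; last exact: continuous_poly.
  by apply: continuous_mul => //; apply: continuous_pow.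
have cneg : continuous (fun w => negp (X w)).
  by apply: continuous_sum => i; apply: continuous_sub => //; apply: continuous_norm.
pose H w := P1 (X w) (V w) + negp (X w) + (normpi2 pi (X w) - 1) ^+ 2 + (normpi2 pi (V w) - 1) ^+ 2.
have cH : continuous H.
  do 2 (apply: continuous_add; last by apply: continuous_pow; apply: continuous_sub => //; exact: cnorm).
  exact: continuous_add.
have neg0 x : 0 <= negp x by apply: sumr_ge0 => i _; rewrite subr_ge0 ler_norm.
have P10 x v : 0 <= P1 x v by rewrite subr_ge0; exact: cauchy_schwarz_pi.
have H0 w : H w = 0 -> [/\ P1 (X w) (V w) = 0, (forall i, 0 <= X w i),
     normpi2 pi (X w) = 1 & normpi2 pi (V w) = 1].
  move=> h; have h1 := P10 (X w) (V w); have h2 := neg0 (X w).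
  have h3 := sqr_ge0 (normpi2 pi (X w) - 1); have h4 := sqr_ge0 (normpi2 pi (V w) - 1).
  have z (a c : R) : (a - c) ^+ 2 = 0 -> a = c.
    by move/eqP; rewrite sqrf_eq0 subr_eq0 => /eqP.
  split; [move: h; rewrite /H; lra | | apply: z; move: h; rewrite /H; lra
    | apply: z; move: h; rewrite /H; lra].
  move=> i; have : negp (X w) = 0 by move: h; rewrite /H; lra.
  have g0 j : true -> 0 <= `|X w j| - X w j by rewrite subr_ge0 ler_norm.
  by move=> /(@psumr_eq0P R _ predT _ g0) /(_ i isT) /eqP; rewrite subr_eq0 => /eqP <-.
have [c c0 hc] : exists2 c : R, 0 <= c & forall w, box2 b w -> H w = 0 ->
    0 < Phi (X w) (V w) - delta / 2 + c * P2 (X w) (V w).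
  apply: penalty => //; first exact: compact_box2.
    by move=> w _ /H0[p1 _ x1 v1]; exact: P2_ge0.
  move=> w _ /H0[p1 x0 x1 v1] p2; have := Phi_ge x0 x1 v1 p1 p2; move: delta0; lra.
have [N N0 hN] : exists2 N : R, 0 <= N & forall w, box2 b w -> 0 = 0 :> R ->
    0 < Phi (X w) (V w) - delta / 2 + c * P2 (X w) (V w) + N * H w.
  apply: (@penalty _ _ _ _ _ (fun=> 0)) => //; first exact: compact_box2.
  - by apply: continuous_add => //; apply: continuous_mul.
  - move=> w _ _; apply: addr_ge0; last exact: sqr_ge0.
    by apply: addr_ge0; [exact: addr_ge0 | exact: sqr_ge0].
  - by move=> w Kw _; exact: hc.
exists c, N; split => // x v xb v1.
have [w [Kw ex ev]] := box2_pair xb (fun i => normpi2_le_b i v1).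
have := hN w Kw erefl; rewrite /H /X /V ex ev v1 subrr expr0n /=; lra.
Qed.

Lemma mul_pow_le k (u : R) : 0 <= u -> u <= 1 -> u * (1 - u) ^+ k <= k.+1%:R^-1.
Proof.
move=> u0 u1; rewrite -[X in _ <= X]div1r ler_pdivlMr // mulrAC.
apply: le_trans (pow_bernoulli k u0 u1); rewrite mulrC ler_wpM2l ?exprn_ge0 ?subr_ge0 //.
by rewrite -natr1 mulrDr mulr1 addrC lerD // mulrC.
Qed.

(** A polynomial substitute for the negative part: for [t >= 0] the left side is [O(1/k)], and for
    [t < 0] the even power is at least [1], so the left side is at most [2 N t]. *)
Lemma barrier (N eta : R) : 0 <= N -> 0 < eta -> exists k : nat, forall t, `|t| <= b ->
  t * (2 * N * (1 - b^-1 * t) ^+ (2 * k)) <= eta - N * (`|t| - t).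
Proof.
move=> N0 eta0; exists (Num.bound (2 * N * b / eta)); set k := Num.bound _ => t tb.
have kb : 2 * N * b / eta < k%:R.
  by apply: archi_boundP; rewrite divr_ge0 ?mulr_ge0 // ltW.
have b1 : 0 < b^-1 by rewrite invr_gt0.
have [t0|t0] := leP 0 t.
  rewrite (ger0_norm t0) subrr mulr0 subr0.
  have u1 : b^-1 * t <= 1 by rewrite mulrC ler_pdivrMr // mul1r (le_trans _ tb) // ler_norm.
  have u0 : 0 <= b^-1 * t by rewrite mulr_ge0 // ltW.
  have := mul_pow_le (2 * k) u0 u1; set P := _ ^+ _ => h.
  have -> : t * (2 * N * P) = 2 * N * b * (b^-1 * t * P) by field; rewrite lt0r_neq0.
  apply: (@le_trans _ _ (2 * N * b * (2 * k).+1%:R^-1)).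
    by rewrite ler_wpM2l // !mulr_ge0 // ltW.
  by rewrite ler_pdivrMr // [eta * _]mulrC -ler_pdivrMr // (le_trans (ltW kb)) // ler_nat leqW // leq_pmull.
rewrite (ltr0_norm t0).
have p1 : 1 <= (1 - b^-1 * t) ^+ (2 * k).
  by apply: exprn_ege1; rewrite lerDl oppr_ge0 pmulr_rle0 // ltW.
have : t * (2 * N * (1 - b^-1 * t) ^+ (2 * k)) <= t * (2 * N * 1).
  by rewrite ler_wnM2l ?(ltW t0) // ler_wpM2l // mulr_ge0.
by lra.
Qed.

Local Notation sph := (sphere_poly pi).
Local Notation Y := (fun k : 'I_n => Xc R k - 1).
Let Vp : {mpoly R[n]} := \sum_i pi i *: (Y i) ^+ 2.
Let up : {mpoly R[n]} := \sum_i pi i *: Xc R i.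

Lemma qform_norm : qform Vp (fun x v => normpi2 pi v).
Proof.
apply: qform_ext (@qform_sum R n _ (index_enum 'I_n) (fun i => (pi i)%:MP * (Y i) ^+ 2)
   (fun i x v => pi i * v i ^+ 2) _) => [|//|i].
  by apply: eq_bigr => i _; rewrite mul_mpolyC.
apply: qform_ext (qformM (pi i)%:MP (qform_lin (fun k => (k == i)%:R))) => [|x v].
  congr (_ * _ ^+ 2); rewrite (bigD1 i) //= eqxx mul1r big1 ?addr0 // => j /negPf ->.
  by rewrite mul0r.
rewrite mevalC; congr (_ * _ ^+ 2); rewrite (bigD1 i) //= eqxx meval1 mul1r big1 ?addr0 // => j /negPf ->.
by rewrite meval0 mul0r.
Qed.

Lemma qform_dirichlet : qform (dirichlet_poly K pi) (fun x v => dirichlet K pi v).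
Proof.
have h i j : qform ((pi i * K i j) *: (Xc R i - Xc R j) ^+ 2)
    (fun x v => pi i * K i j * (v i - v j) ^+ 2).
  apply: qform_ext (qformM (pi i * K i j)%:MP
     (qform_lin (fun k => (k == i)%:R - (k == j)%:R))) => [|x v].
    rewrite mul_mpolyC; congr (_ *: _ ^+ 2).
    under eq_bigr => k _ do rewrite mulrBl.
    rewrite sumrB (bigD1 i) //= eqxx mul1r big1 => [|k /negPf ->]; last by rewrite mul0r.
    rewrite (bigD1 j) //= eqxx mul1r big1 => [|k /negPf ->]; last by rewrite mul0r.
    by rewrite !addr0; ring.
  rewrite mevalC; congr (_ * _ ^+ 2).
  under eq_bigr => k _ do rewrite mevalB mulrBl.
  rewrite sumrB (bigD1 i) //= eqxx meval1 mul1r big1 => [|k /negPf ->]; last by rewrite meval0 mul0r.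
  rewrite (bigD1 j) //= eqxx meval1 mul1r big1 => [|k /negPf ->]; last by rewrite meval0 mul0r.
  by rewrite !addr0.
apply: qform_ext (qformM (2^-1)%:MP (@qform_sum R n _ (index_enum 'I_n) _ _
   (fun i => @qform_sum R n _ (index_enum 'I_n) _ _ (fun j => h i j)))) => [|x v].
  by rewrite mul_mpolyC.
by rewrite mevalC.
Qed.

Lemma qform_Phi : qform (gamma *: dirichlet_poly K pi -
   \sum_i pi i *: (at_coord q i * (Y i) ^+ 2)) Phi.
Proof.
apply: qform_ext (qformD (qformM gamma%:MP qform_dirichlet)
  (@qform_sum R n _ (index_enum 'I_n) (fun i => (- pi i)%:MP * (at_coord q i * (Y i) ^+ 2))
   (fun i x v => - pi i * (q.[x i] * v i ^+ 2)) _)) => [|x v|i].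
- rewrite mul_mpolyC -sumrN; congr (_ + _); apply: eq_bigr => i _.
  by rewrite mul_mpolyC scaleNr.
- rewrite /Phi mevalC -sumrN; congr (_ + _); apply: eq_bigr => i _; ring.
apply: qform_ext (qformM (- pi i)%:MP (qformM (at_coord q i) (qform_lin (fun k => (k == i)%:R)))) => [|x v].
  congr (_ * (_ * _ ^+ 2)); rewrite (bigD1 i) //= eqxx mul1r big1 ?addr0 // => j /negPf ->.
  by rewrite mul0r.
rewrite mevalC meval_at_coord; congr (_ * (_ * _ ^+ 2)); rewrite (bigD1 i) //= eqxx meval1 mul1r big1 ?addr0 // => j /negPf ->.
by rewrite meval0 mul0r.
Qed.

Lemma meval_up x : up.@[x] = mean x.
Proof.
rewrite /up raddf_sum; apply: eq_bigr => i _ /=.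
by rewrite mevalZ mevalXU.
Qed.

Lemma meval_sph x : sph.@[x] = normpi2 pi x - 1.
Proof.
rewrite /sphere_poly mevalB meval1 raddf_sum; congr (_ - _); apply: eq_bigr => i _ /=.
by rewrite mevalZ rmorphXn /= mevalXU.
Qed.

Lemma meval_Vp x : Vp.@[x] = normpi2 pi (fun i => x i - 1).
Proof.
rewrite /Vp raddf_sum; apply: eq_bigr => i _ /=.
by rewrite mevalZ rmorphXn /= mevalB mevalXU meval1.
Qed.

Lemma sum_pi_poly : \sum_i (pi i)%:MP = 1 :> {mpoly R[n]}.
Proof. by rewrite -raddf_sum /= pi1 mpolyC1. Qed.

Lemma sum_piY : \sum_i (pi i)%:MP * (Y i) = up - 1.
Proof.
rewrite -[X in _ = _ - X]sum_pi_poly /up -sumrB; apply: eq_bigr => i _.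
by rewrite mulrBr mulr1 mul_mpolyC.
Qed.

Lemma Vp_sph : Vp = sph + 2 - 2 * up.
Proof.
have -> : sph = \sum_i (pi i)%:MP * Xc R i ^+ 2 - 1.
  by rewrite /sphere_poly; congr (_ - _); apply: eq_bigr => i _; rewrite mul_mpolyC.
have -> : up = \sum_i (pi i)%:MP * Xc R i by apply: eq_bigr => i _; rewrite mul_mpolyC.
transitivity (\sum_i (pi i)%:MP * Xc R i ^+ 2 + \sum_i (pi i)%:MP - 2 * \sum_i (pi i)%:MP * Xc R i).
  rewrite mulr_sumr -big_split -sumrB; apply: eq_bigr => i _ /=; rewrite -mul_mpolyC; ring.
rewrite sum_pi_poly; ring.
Qed.

(** [PT] adds to the target the penalties of [penalty_bound] and subtracts the barriers. As a form
    in a free [v] it is positive definite on the box, hence lies in [sphere_cone]; at [v = x - 1]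
    the penalties reduce to multiples of [sph], and the barriers return as the terms with a factor
    [Xc R i]. *)
Lemma positive_certificate : exists (s0 : {mpoly R[n]}) (s : 'I_n -> {mpoly R[n]}) (phi : {mpoly R[n]}),
  [/\ sos s0, forall i, sos (s i) &
   gamma *: dirichlet_poly K pi - \sum_i pi i *: (at_coord q i * (Y i) ^+ 2) =
   s0 + \sum_i Xc R i * s i + phi * sph].
Proof.
have [c [N [N0 hcN]]] := penalty_bound.
have e0 : 0 < delta / 4 / n.+1%:R by rewrite !divr_gt0.
have [k hk] := barrier N0 e0.
pose sg i : {mpoly R[n]} := (2 * N) *: ((1 - b^-1 *: Xc R i) ^+ (2 * k)).
have msg i x : (sg i).@[x] = 2 * N * (1 - b^-1 * x i) ^+ (2 * k).
  by rewrite /sg mevalZ rmorphXn /= mevalB meval1 mevalZ mevalXU.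
pose PP1 : {mpoly R[n]} := Vp * Vp - (\sum_i (pi i *: (Xc R i - 1)) * (Y i)) ^+ 2.
pose PP2 : {mpoly R[n]} := (up - 1) ^+ 2 - (2^-1)%:MP * (1 - up) * Vp.
(* The squared sphere equation and the barriers are multiplied by [Vp] so that they, too, are
   quadratic in [v]. *)
pose PT := gamma *: dirichlet_poly K pi - \sum_i pi i *: (at_coord q i * (Y i) ^+ 2)
   + c%:MP * PP2 + N%:MP * (PP1 + sph ^+ 2 * Vp) - (\sum_i Xc R i * sg i) * Vp.
have qPT : qform PT (fun x v => Phi x v + c * P2 x v
   + N * (P1 x v + (normpi2 pi x - 1) ^+ 2 * normpi2 pi v)
   - (\sum_i x i * (2 * N * (1 - b^-1 * x i) ^+ (2 * k))) * normpi2 pi v).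
  have q1 : qform PP1 P1.
    apply: qform_ext (qformD (qformM Vp qform_norm)
      (qformM (-1)%:MP (qform_lin (fun i => pi i *: (Xc R i - 1))))) => [|x v].
      by rewrite /PP1 mpolyCN mpolyC1 mulN1r.
    rewrite /P1 mevalC mulN1r meval_Vp; congr (_ - _ ^+ 2); apply: eq_bigr => i _.
    by rewrite mevalZ mevalB mevalXU meval1.
  have q2 : qform PP2 P2.
    apply: qform_ext (qformD (qform_lin (fun i => (pi i)%:MP))
      (qformM (- ((2^-1)%:MP * (1 - up))) qform_norm)) => [|x v].
      by rewrite /PP2 sum_piY mulNr.
    rewrite /P2 mevalN mevalM mevalC mevalB meval1 meval_up mulNr mulrC [_ / 2]mulrC.
    by rewrite mulrC; congr (_ ^+ 2 - _); apply: eq_bigr => i _; rewrite mevalC.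
  apply: qform_ext (qformD (qformD (qformD qform_Phi (qformM c%:MP q2))
     (qformM N%:MP (qformD q1 (qformM (sph ^+ 2) qform_norm))))
     (qformM (- \sum_i Xc R i * sg i) qform_norm)) => [|x v].
    by rewrite mulNr.
  rewrite !mevalC rmorphXn /= meval_sph mevalN mulNr raddf_sum /=.
  congr (_ - _ * _); apply: eq_bigr => i _.
  by rewrite mevalM mevalXU msg.
have posT x v : (forall i, `|x i| <= b) -> normpi2 pi v = 1 ->
   delta / 4 <= Phi x v + c * P2 x v
   + N * (P1 x v + (normpi2 pi x - 1) ^+ 2 * normpi2 pi v)
   - (\sum_i x i * (2 * N * (1 - b^-1 * x i) ^+ (2 * k))) * normpi2 pi v.
  move=> xb v1; have := hcN x v xb v1; rewrite v1 !mulr1.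
  have : \sum_i x i * (2 * N * (1 - b^-1 * x i) ^+ (2 * k)) <= delta / 4 - N * negp x.
    apply: (@le_trans _ _ (\sum_(i < n) (delta / 4 / n.+1%:R - N * (`|x i| - x i)))).
      by apply: ler_sum => i _; exact: hk.
    rewrite sumrB -[X in _ - X <= _]mulr_sumr lerD2r sumr_const card_ord.
    rewrite -[(_ / n.+1%:R) *+ n]mulr_natr -[X in X <= _]mulrA ler_piMr ?divr_ge0 ?(ltW delta0) //.
    by rewrite mulrC ler_pdivrMr // mul1r ler_nat.
  by move: delta0; lra.
have TPT : sphere_cone pi PT.
  case: (qPT) => A [PTE evE]; rewrite PTE.
  apply: (@box_posdef_cone R n pi b pi_gt0 b0 pib A (fun k => Xc R k - 1) (delta / 4 / b ^+ 2)).
    by rewrite !divr_gt0 // exprn_gt0.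
  move=> x xb v; rewrite -evE.
  (* The Euclidean norm is traded for [normpi2] at the price of [b^2]; homogeneity then reduces to
     unit [v]. *)
  have nb : (\sum_i v i ^+ 2) / b ^+ 2 <= normpi2 pi v.
    rewrite mulr_suml; apply: ler_sum => i _.
    rewrite ler_pdivrMr ?exprn_gt0 // mulrAC ler_peMl ?sqr_ge0 //.
  apply: (@le_trans _ _ (delta / 4 * normpi2 pi v)).
    by rewrite -[X in X <= _]mulrA ler_wpM2l ?divr_ge0 ?(ltW delta0) // mulrC.
  have [v0|v0] := eqVneq (normpi2 pi v) 0.
    rewrite evE v0 mulr0 big1 // => i _; rewrite big1 // => j _.
    by rewrite (normpi2_eq0 v0) mul0r mulr0.
  have v1 : 0 < normpi2 pi v by rewrite lt_neqAle eq_sym v0 normpi2_ge0.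
  pose r := Num.sqrt (normpi2 pi v); have r0 : 0 < r by rewrite sqrtr_gt0.
  have r2 : r ^+ 2 = normpi2 pi v by rewrite sqr_sqrtr // ltW.
  pose v' i := r^-1 * v i.
  have vE : v = (fun i => r * v' i).
    by apply/funext => i; rewrite /v' mulrA divff ?mul1r // lt0r_neq0.
  have v'1 : normpi2 pi v' = 1.
    rewrite -(mulVf v0) -{1}r2 /normpi2 mulr_sumr; apply: eq_bigr => i _.
    by rewrite /v' exprMn exprVn; ring.
  rewrite [X in _ <= X](_ : _ = r ^+ 2 * (Phi x v' + c * P2 x v'
   + N * (P1 x v' + (normpi2 pi x - 1) ^+ 2 * normpi2 pi v')
   - (\sum_i x i * (2 * N * (1 - b^-1 * x i) ^+ (2 * k))) * normpi2 pi v')); last first.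
    by rewrite -(qform_homog x v' r qPT) -vE.
  by rewrite -r2 mulrC ler_pM2l ?exprn_gt0 // posT.
have [s0 [phi [s0sos PTE]]] := TPT.
exists s0, (fun i => sg i * Vp),
  (phi + c%:MP * ((2^-1)%:MP * (1 - up)) - N%:MP * (sph * Vp)); split => //.
  move=> i; apply: sosM; last first.
    by apply: sos_sum => j _; apply: sosZ; [exact: ltW | exact: sos_sqr].
  by apply: sosZ; [rewrite mulr_ge0 | rewrite mulnC exprM; exact: sos_sqr].
have -> : gamma *: dirichlet_poly K pi - \sum_i pi i *: (at_coord q i * (Y i) ^+ 2) =
   PT - c%:MP * PP2 - N%:MP * (PP1 + sph ^+ 2 * Vp) + (\sum_i Xc R i * sg i) * Vp.
  by rewrite /PT; ring.
(* At [v = x - 1] the Gram determinant vanishes identically; [PP2] becomes a multiple of [sph]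
   through [Vp_sph]. *)
have -> : PP1 = 0.
  rewrite /PP1 (_ : \sum_i _ = Vp) ?expr2 ?subrr //; apply: eq_bigr => i _.
  by rewrite -scalerAl expr2.
have -> : PP2 = - ((2^-1)%:MP * (1 - up)) * sph.
  rewrite /PP2 Vp_sph.
  have h2 : (2^-1)%:MP * 2 = 1 :> {mpoly R[n]} by rewrite -(mpolyC_nat n R 2) -mpolyCM mulVf ?mpolyC1 // pnatr_eq0.
  have -> : (2^-1)%:MP * (1 - up) * (sph + 2 - 2 * up) =
     (2^-1)%:MP * (1 - up) * sph + ((2^-1)%:MP * 2) * (1 - up) ^+ 2 by ring.
  rewrite h2; ring.
have -> : \sum_i Xc R i * (sg i * Vp) = (\sum_i Xc R i * sg i) * Vp.
  by rewrite mulr_suml; apply: eq_bigr => i _; rewrite mulrA.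
rewrite PTE; ring.
Qed.

End Core.

(** * Poincare inequality and polynomial majorants *)

Section Degree.
Variables (R : realType) (n : nat).
Implicit Types (f g : {mpoly R[n]}).

Lemma mdeg_leW k l f : (k <= l)%N -> mdeg_le k f -> mdeg_le l f.
Proof. by move=> kl h; apply: leq_trans h _. Qed.

Lemma mdeg_leD k f g : mdeg_le k f -> mdeg_le k g -> mdeg_le k (f + g).
Proof. by move=> hf hg; apply: leq_trans (msizeD_le _ _) _; rewrite geq_max hf hg. Qed.

Lemma mdeg_leN k f : mdeg_le k f -> mdeg_le k (- f).
Proof. by rewrite /mdeg_le msizeN. Qed.

Lemma mdeg_leZ k c f : mdeg_le k f -> mdeg_le k (c *: f).
Proof. by move=> h; apply: leq_trans (msizeZ_le _ _) h. Qed.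

Lemma mdeg_leC k (c : R) : mdeg_le k (c%:MP : {mpoly R[n]}).
Proof. by rewrite /mdeg_le msizeC; case: (c != 0). Qed.

Lemma mdeg_le1 k : mdeg_le k (1 : {mpoly R[n]}).
Proof. by rewrite -mpolyC1; exact: mdeg_leC. Qed.

Lemma mdeg_leX i : mdeg_le 1 (Xc R i : {mpoly R[n]}).
Proof. by rewrite /mdeg_le /Xc msizeX mdeg1. Qed.

Lemma mdeg_leM k l f g : mdeg_le k f -> mdeg_le l g -> mdeg_le (k + l) (f * g).
Proof.
rewrite /mdeg_le => hf hg.
have [->|f0] := eqVneq f 0; first by rewrite mul0r msize0.
have [->|g0] := eqVneq g 0; first by rewrite mulr0 msize0.
apply: leq_trans (eq_leq (msizeM f0 g0)) _.
by move: hf hg; move: (msize f) (msize g) => u v; lia.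
Qed.

Lemma mdeg_leXn k f j : mdeg_le k f -> mdeg_le (j * k) (f ^+ j).
Proof.
move=> h; elim: j => [|j IH]; first by rewrite expr0; exact: mdeg_le1.
by rewrite exprS mulSn; exact: mdeg_leM.
Qed.

Lemma mdeg_le_sum k (I : Type) (r : seq I) (P : pred I) (F : I -> {mpoly R[n]}) :
  (forall i, P i -> mdeg_le k (F i)) -> mdeg_le k (\sum_(i <- r | P i) F i).
Proof.
move=> h; apply: (big_ind (mdeg_le k)) => //; last by move=> ? ?; exact: mdeg_leD.
by rewrite /mdeg_le msize0.
Qed.

Lemma mdeg_le_msize f : mdeg_le (msize f) f.
Proof. exact: leqnSn. Qed.

End Degree.

Section Poincare.
Variables (R : realType) (n : nat) (K : 'M[R]_n) (pi : 'I_n -> R).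
Hypotheses (mk : markov_kernel K) (irr : irreducible K) (st : stationary K pi).

Lemma kernel_powS k i j : (K ^+ k.+1) i j = \sum_l K i l * (K ^+ k) l j.
Proof. by rewrite exprS -[K * _]/(K *m K ^+ k) mxE. Qed.

Lemma kernel_pow_ge0 k i j : 0 <= (K ^+ k) i j.
Proof.
elim: k i j => [|k IH] i j.
  by rewrite expr0 mxE; case: (i == j).
rewrite kernel_powS; apply: sumr_ge0 => l _.
by rewrite mulr_ge0 // (proj1 mk).
Qed.

Lemma stationary_pow k j : \sum_i pi i * (K ^+ k) i j = pi j.
Proof.
elim: k j => [|k IH] j.
  rewrite (bigD1 j) //= expr0 mxE eqxx mulr1 big1 ?addr0 // => i /negPf ij.
  by rewrite mxE ij mulr0.
rewrite -[RHS]IH; have [_ [_ pK]] := st.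
under [RHS]eq_bigr => i _ do rewrite -pK mulr_suml.
rewrite exchange_big; apply: eq_bigr => i _ /=.
rewrite kernel_powS mulr_sumr; apply: eq_bigr => l _.
by rewrite mulrA.
Qed.

(** Some state has positive mass, and stationarity under a suitable power of [K] carries part of it
    to [j]. *)
Lemma stationary_gt0 j : 0 < pi j.
Proof.
have [p0 [p1 _]] := st.
have [i pi0] : exists i, 0 < pi i.
  apply/not_existsP => h; move: p1; rewrite big1 => [/eqP|i _].
    by rewrite eq_sym oner_eq0.
  by apply/eqP; rewrite eq_le p0 andbT leNgt; apply/negP/h.
have [k Kk] := irr i j; rewrite -(stationary_pow k) (bigD1 i) //=.
rewrite ltr_pwDl ?mulr_gt0 //; apply: sumr_ge0 => l _.
by rewrite mulr_ge0 ?kernel_pow_ge0.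
Qed.

Local Notation Ep := (dirichlet_poly K pi).
(** Domination by a multiple of the Dirichlet form, certified by squares of polynomials of degree at
    most [1]. *)
Let dom (f : {mpoly R[n]}) := exists2 C : R, 0 <= C & is_sos 1 (C *: Ep - f).

Let domD f g : dom f -> dom g -> dom (f + g).
Proof.
move=> [C C0 hC] [D D0 hD]; exists (C + D); first exact: addr_ge0.
have -> : (C + D) *: Ep - (f + g) = (C *: Ep - f) + (D *: Ep - g).
  by rewrite scalerDl; ring.
exact: is_sosD.
Qed.

Let domZ c f : 0 <= c -> dom f -> dom (c *: f).
Proof.
move=> c0 [C C0 hC]; exists (c * C); first exact: mulr_ge0.
by rewrite -scalerA -scalerBr; exact: is_sosZ.
Qed.

Let dom0 : dom 0.
Proof. by exists 0 => //; rewrite scale0r subr0; exact: is_sos0. Qed.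

Lemma mdeg_le_XcB i j : mdeg_le 1 (Xc R i - Xc R j : {mpoly R[n]}).
Proof. by apply: mdeg_leD; [exact: mdeg_leX | apply: mdeg_leN; exact: mdeg_leX]. Qed.

Let c0 i j : 0 <= pi i * K i j.
Proof. by rewrite mulr_ge0 ?(proj1 mk) // ltW // stationary_gt0. Qed.

Let dom_edge i j : 0 < K i j -> dom ((Xc R i - Xc R j) ^+ 2).
Proof.
move=> Kij; have p0 : 0 < pi i * K i j by rewrite mulr_gt0 // stationary_gt0.
(* This constant turns the edge's own term, halved in the Dirichlet form, into the square to be
   subtracted; the other terms remain as squares. *)
exists (2 / (pi i * K i j)); first by rewrite divr_ge0 // ltW.
have -> : (2 / (pi i * K i j)) *: Ep - (Xc R i - Xc R j) ^+ 2 =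
   (pi i * K i j)^-1 *: (\sum_(l < n | l != j) (pi i * K i l) *: (Xc R i - Xc R l) ^+ 2
     + \sum_(k < n | k != i) \sum_(l < n) (pi k * K k l) *: (Xc R k - Xc R l) ^+ 2).
  rewrite /dirichlet_poly scalerA mulrAC divff ?pnatr_eq0 // mul1r.
  rewrite [in LHS](bigD1 i) //= [in X in X - _](bigD1 j) //=.
  by rewrite -addrA scalerDr scalerA mulVf ?lt0r_neq0 // scale1r; ring.
apply: is_sosZ; first by rewrite invr_ge0 ltW.
have sq k l : is_sos 1 ((pi k * K k l) *: (Xc R k - Xc R l) ^+ 2).
  by apply: is_sosZ => //; apply: is_sos_sqr; exact: mdeg_le_XcB.
by apply: is_sosD; apply: is_sos_sum => k _ //; apply: is_sos_sum.
Qed.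

(** Rests on [2 a^2 + 2 c^2 - (a + c)^2 = (a - c)^2], for the two steps [a] and [c] from [i] to [j]
    through [l]. *)
Let dom_tri i l j : dom ((Xc R i - Xc R l) ^+ 2) -> dom ((Xc R l - Xc R j) ^+ 2) ->
  dom ((Xc R i - Xc R j) ^+ 2).
Proof.
move=> [C C0 hC] [D D0 hD]; exists (2 * C + 2 * D); first by rewrite addr_ge0 // mulr_ge0.
have -> : (2 * C + 2 * D) *: Ep - (Xc R i - Xc R j) ^+ 2 =
   (2 : R) *: (C *: Ep - (Xc R i - Xc R l) ^+ 2) + (2 : R) *: (D *: Ep - (Xc R l - Xc R j) ^+ 2)
   + (Xc R i - Xc R l - (Xc R l - Xc R j)) ^+ 2.
  rewrite scalerDl -!scalerA !scaler_nat; ring.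
apply: is_sosD; first by apply: is_sosD; exact: is_sosZ.
apply: is_sos_sqr; apply: mdeg_leD; first exact: mdeg_le_XcB.
by apply: mdeg_leN; exact: mdeg_le_XcB.
Qed.

Let dom_pair i j : dom ((Xc R i - Xc R j) ^+ 2).
Proof.
have [k] := irr i j; elim: k i => [|k IH] i.
  rewrite expr0 mxE; case: eqVneq => [-> _|_]; last by rewrite ltxx.
  by rewrite subrr expr0n; exact: dom0.
rewrite kernel_powS => lt.
have [l [h1 h2]] : exists l, 0 < K i l /\ 0 < (K ^+ k) l j.
  apply/not_existsP => h; move: lt; rewrite big1 ?ltxx // => l _.
  apply/eqP; rewrite mulf_eq0 -[K i l == 0]negbK -[X in _ || X]negbK -negb_and.
  apply/negP => /andP[a1 a2]; apply: (h l); rewrite !lt_neqAle !(eq_sym 0) a1 a2.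
  by rewrite (proj1 mk) kernel_pow_ge0.
by apply: dom_tri (IH _ h2); exact: dom_edge.
Qed.

Definition var_poly : {mpoly R[n]} :=
  \sum_i pi i *: Xc R i ^+ 2 - (\sum_i pi i *: Xc R i) ^+ 2.

Lemma var_polyE : var_poly =
  \sum_i \sum_j (2^-1 * (pi i * pi j)) *: (Xc R i - Xc R j) ^+ 2.
Proof.
pose a i : {mpoly R[n]} := (pi i)%:MP.
have a1 : \sum_i a i = 1 by rewrite -raddf_sum /= (proj1 (proj2 st)) mpolyC1.
have e1 : \sum_i pi i *: Xc R i ^+ 2 = \sum_i a i * Xc R i ^+ 2.
  by apply: eq_bigr => i _; rewrite mul_mpolyC.
have e2 : \sum_i pi i *: Xc R i = \sum_i a i * Xc R i.
  by apply: eq_bigr => i _; rewrite mul_mpolyC.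
have -> : \sum_i \sum_j (2^-1 * (pi i * pi j)) *: (Xc R i - Xc R j) ^+ 2 =
  (2^-1 : R) *: \sum_i \sum_j a i * a j * (Xc R i - Xc R j) ^+ 2.
  rewrite scaler_sumr; apply: eq_bigr => i _; rewrite scaler_sumr; apply: eq_bigr => j _.
  by rewrite -scalerA -mpolyCM mul_mpolyC.
have -> : \sum_i \sum_j a i * a j * (Xc R i - Xc R j) ^+ 2 =
   var_poly *+ 2; last first.
  by rewrite mulr2n scalerDr -scalerDl (_ : 2^-1 + 2^-1 = 1) ?scale1r //; field.
rewrite /var_poly e1 e2 mulr2n.
have d1 : \sum_i a i * Xc R i ^+ 2 = \sum_i \sum_j a i * a j * Xc R i ^+ 2.
  apply: eq_bigr => i _; rewrite -mulr_suml -mulr_sumr a1 mulr1 //.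
have d2 : \sum_i a i * Xc R i ^+ 2 = \sum_i \sum_j a i * a j * Xc R j ^+ 2.
  rewrite d1 exchange_big; apply: eq_bigr => i _; apply: eq_bigr => j _; ring.
have d3 : (\sum_i a i * Xc R i) ^+ 2 = \sum_i \sum_j (a i * Xc R i) * (a j * Xc R j).
  by rewrite expr2 mulr_suml; apply: eq_bigr => i _; rewrite mulr_sumr.
rewrite {1}d1 d2 d3 addrACA -opprD -!big_split -sumrB; apply: eq_bigr => i _ /=.
rewrite -!big_split -sumrB; apply: eq_bigr => j _ /=; ring.
Qed.

Lemma poincare_sos : exists2 C : R, 0 < C & is_sos 1 (C *: Ep - var_poly).
Proof.
have [C C0 hC] : dom var_poly.
  rewrite var_polyE; apply: (big_ind dom) => // i _; apply: (big_ind dom) => // j _.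
  apply: domZ => //; rewrite mulr_ge0 ?invr_ge0 // mulr_ge0 // ltW // stationary_gt0 //.
(* Adding the Dirichlet form, itself a sum of squares, makes the constant strictly positive. *)
exists (C + 1); first by rewrite ltr_wpDl.
have -> : (C + 1) *: Ep - var_poly = (C *: Ep - var_poly) + Ep by rewrite scalerDl scale1r; ring.
apply: is_sosD => //; apply: is_sosZ; first by rewrite invr_ge0.
apply: is_sos_sum => i _; apply: is_sos_sum => j _; apply: is_sosZ => //.
by apply: is_sos_sqr; exact: mdeg_le_XcB.
Qed.

End Poincare.

(** * The interval condition and polynomial majorants of the approximant *)

Section IntervalCondition.
Variables (R : realType) (m : nat) (Rm Sm : {poly R}).
Hypothesis pade : pade_log m Rm Sm.

Let szR : (size Rm <= m.+1)%N. Proof. by case: pade. Qed.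
Let szS : (size Sm <= m.+1)%N. Proof. by case: pade => _ []. Qed.
Let S1 : Sm.[1] = 1. Proof. by case: pade => _ [_ []]. Qed.

Lemma pade_S_gt0 t : 0 <= t -> 0 < Sm.[t].
Proof. exact: pade_denom_gt0 szR szS (pade_contact pade) S1 _. Qed.

(** The contact has order at least [2], so the first derivative also vanishes at [1]; it equals
    [Sm(1) - Rm(1)] there. *)
Lemma pade_numer1 : Rm.[1] = 1.
Proof.
have := dvdp_exp_deriv (pade_contact pade).
rewrite (_ : (2 * m + 2).-1 = (2 * m).+1)%N; last by lia.
move=> /(dvdp_trans (_ : 'X - 1 %| _)) h.
have /h : ('X - 1 : {poly R}) %| ('X - 1) ^+ (2 * m).+1 by rewrite exprS dvdp_mulr.
rewrite -polyC1 dvdp_XsubCl polyC1 => /rootP.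
rewrite derivB !derivM deriv_subX1 !(hornerD, hornerN, hornerM).
rewrite log_taylor1 hornerX -polyC1 !hornerC S1 subrr mulr0 mul0r add0r addr0 !mul1r.
have /(congr1 (horner^~ 1)) := deriv_log_taylor R (2 * m + 1).
rewrite hornerM hornerX mul1r hornerD hornerN horner_exp hornerN hornerD hornerN hornerX.
rewrite -polyC1 !hornerC subrr oppr0 addn1 expr0n subr0 => -> /eqP.
by rewrite subr_eq0 eq_sym => /eqP.
Qed.

Lemma horner_2X2 t : (2%:P * 'X ^+ 2 : {poly R}).[t] = 2 * t ^+ 2.
Proof. by rewrite mul_polyC hornerZ hornerXn. Qed.

Lemma interval_horner (p : {poly R}) t : 0 <= t ->
  (Sm * p - 2%:P * 'X ^+ 2 * ('X - 1) * Rm).[t] =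
  Sm.[t] * (p.[t] - 2 * t ^+ 2 * pade_rat Rm Sm t).
Proof.
move=> t0; have := lt0r_neq0 (pade_S_gt0 t0) => Sn.
have e1 : ('X - 1 : {poly R}).[t] = t - 1 by rewrite !hornerE.
rewrite /pade_rat hornerD hornerN [(Sm * p).[t]]hornerM [(_ * Rm).[t]]hornerM.
by rewrite [(_ * ('X - 1)).[t]]hornerM horner_2X2 e1; field.
Qed.

Lemma interval_size (p : {poly R}) d : (2 <= d)%N -> (size p <= (2 * d).+1)%N ->
  (size (Sm * p - 2%:P * 'X ^+ 2 * ('X - 1) * Rm)%R <= (2 * (d + uphalf m)).+1)%N.
Proof.
move=> d2 sp; rewrite (leq_trans (size_polyD _ _)) // geq_max size_polyN; apply/andP; split.
  apply: leq_trans (size_polyMleq _ _) _.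
  by move: sp szS; move: (size p) (size Sm) => u v; lia.
have h1 : (size (2%:P * 'X ^+ 2 * ('X - 1) : {poly R})%R <= 4)%N.
  apply: leq_trans (size_polyMleq _ _) _; rewrite -polyC1 size_XsubC.
  suff : (size (2%:P * 'X ^+ 2 : {poly R})%R <= 3)%N by move: (size _) => u; lia.
  rewrite mul_polyC; apply: leq_trans (size_scale_leq _ _) _.
  by rewrite size_polyXn.
apply: leq_trans (size_polyMleq _ _) _.
by move: h1 szR; move: (size _) (size Rm) => u v; lia.
Qed.

(* [1 / Sm] is approximated by the partial sums of its geometric series
   [\sum_j (1 - Sm / s) ^+ j / s], which converges uniformly on [[0, B]] for
   [s = Sm.[B]]. *)
Lemma pade_majorant (B e : R) : 1 <= B -> 0 < e -> 2 * B ^+ 2 / m.+1%:R <= e ->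
  exists q : {poly R}, forall t, 0 <= t -> t <= B ->
    2 * t ^+ 2 * pade_rat Rm Sm t <= t ^+ 2 - 1 + (t - 1) ^+ 2 * q.[t] /\
    (t - 1) ^+ 2 * q.[t] <= 2 * t ^+ 2 * ln t - (t ^+ 2 - 1) + 3 * e * (t - 1) ^+ 2.
Proof.
move=> B1 e0 me.
have B0 : 0 <= B by lra.
(* This polynomial vanishes at [1], both products being [2] there. Together with the factor [t - 1]
   already taken out, it gives the double zero of [2 t^2 r - (t^2 - 1)]. *)
have /factor_theorem[Q0 Q0E] : root (2%:P * 'X ^+ 2 * Rm - ('X + 1) * Sm) 1.
  rewrite rootE hornerD hornerN [(_ * Rm).[1]]hornerM [(_ * Sm).[1]]hornerM horner_2X2 pade_numer1 S1 expr1n.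
  by rewrite (_ : ('X + 1).[1] = 2) ?mulr1 ?subrr // !hornerE.
have QE (t : R) : (t - 1) ^+ 2 * Q0.[t] = 2 * t ^+ 2 * (t - 1) * Rm.[t] - (t ^+ 2 - 1) * Sm.[t].
  have /(congr1 (horner^~ t)) := Q0E.
  rewrite hornerD hornerN [(_ * Rm).[t]]hornerM [(_ * Sm).[t]]hornerM [(Q0 * _).[t]]hornerM horner_2X2.
  have e1 : ('X + 1 : {poly R}).[t] = t + 1 by rewrite !hornerE.
  rewrite e1 hornerXsubC => h.
  transitivity ((t - 1) * (Q0.[t] * (t - 1))); first by ring.
  by rewrite -h; ring.
have [M0 hM0] := poly_itv_bound Q0 0 B.
pose M := `|M0| + 1.
have M_gt0 : 0 < M by rewrite ltr_wpDl.
have hM t : 0 <= t -> t <= B -> `|Q0.[t]| <= M.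
  move=> t0 tB; have := hM0 t; rewrite t0 tB => /(_ isT) h.
  by apply: le_trans h _; apply: le_trans (ler_norm _) _; rewrite lerDl.
pose s := Sm.[B]; have s0 : 0 < s by exact: pade_S_gt0.
have S0 : 0 < Sm`_0 by exact: pade_denom0_gt0 szR szS (pade_contact pade) S1.
have SB t : 0 <= t -> t <= B -> Sm.[t] <= s.
  exact: pade_denom_homo szR szS (pade_contact pade) S1 _ _.
have S0t t : 0 <= t -> Sm`_0 <= Sm.[t].
  exact: pade_denom_ge0 szR szS (pade_contact pade) S1 _.
pose u := Sm`_0 / s.
have u0 : 0 < u by rewrite divr_gt0.
have u1 : u <= 1 by rewrite ler_pdivrMr // mul1r; apply: S0t.
(* By [pow_bernoulli] this many terms make [M (1 - u)^k <= e Sm_0]; adding [e] to the truncated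
   series then yields an upper bound. *)
pose k := Num.bound (M / (e * Sm`_0 * u)).
have kP : M / (e * Sm`_0 * u) < k%:R by apply: archi_boundP; exact: ltW (divr_gt0 M_gt0 (mulr_gt0 (mulr_gt0 e0 S0) u0)).
pose r : {poly R} := 1 - s^-1 *: Sm.
pose q := Q0 * (s^-1 *: \sum_(j < k) r ^+ j) + e%:P.
have SqE t : Sm.[t] * q.[t] - Q0.[t] = e * Sm.[t] - Q0.[t] * (1 - Sm.[t] / s) ^+ k.
  have geo : s^-1 * Sm.[t] * (\sum_(j < k) r ^+ j).[t] = 1 - (1 - Sm.[t] / s) ^+ k.
    have -> : s^-1 * Sm.[t] * (\sum_(j < k) r ^+ j).[t] = ((s^-1 *: Sm) * (\sum_(j < k) r ^+ j)).[t].
      by rewrite !hornerE.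
    have -> : (s^-1 *: Sm) * (\sum_(j < k) r ^+ j) = 1 - r ^+ k.
      have := subrX1 r k; rewrite {2}/r => h.
      have -> : 1 - r ^+ k = - (r ^+ k - 1) by ring.
      by rewrite h; ring.
    by rewrite /r hornerD hornerN horner_exp !hornerE mulrC.
  rewrite /q hornerD hornerM hornerZ hornerC.
  transitivity (Q0.[t] * (s^-1 * Sm.[t] * (\sum_(j < k) r ^+ j).[t]) + e * Sm.[t] - Q0.[t]); first by ring.
  by rewrite geo; ring.
have small t : 0 <= t -> t <= B -> `|Q0.[t] * (1 - Sm.[t] / s) ^+ k| <= e * Sm.[t].
  move=> t0 tB; have St := S0t t t0; have Ss := SB t t0 tB.
  have a0 : 0 <= 1 - Sm.[t] / s by rewrite subr_ge0 ler_pdivrMr // mul1r.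
  have a1 : 1 - Sm.[t] / s <= 1 - u by rewrite lerD2l lerN2 ler_pM2r ?invr_gt0.
  rewrite normrM normrX (ger0_norm a0).
  apply: (@le_trans _ _ (M * (1 - u) ^+ k)).
    by apply: ler_pM; rewrite ?exprn_ge0 ?hM // lerXn2r ?nnegrE // subr_ge0.
  apply: (@le_trans _ _ (e * Sm`_0)); last by rewrite ler_pM2l.
  have := pow_bernoulli k (ltW u0) u1 => hb.
  have ku : M <= e * Sm`_0 * (1 + k%:R * u).
    move: kP; rewrite ltr_pdivrMr ?(mulr_gt0 (mulr_gt0 e0 S0) u0) // => /ltW h; apply: le_trans h _.
    have : 0 < e * Sm`_0 by rewrite mulr_gt0.
    by set E := e * Sm`_0 => E0; rewrite mulrCA ler_pM2l // lerDr.
  apply: (@le_trans _ _ (e * Sm`_0 * (1 + k%:R * u) * (1 - u) ^+ k)).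
    by rewrite ler_wpM2r // exprn_ge0 // subr_ge0.
  by rewrite -mulrA ler_piMr ?mulr_ge0 ?(ltW e0) ?(ltW S0) // mulrC.
exists q => t t0 tB.
have St := pade_S_gt0 t0; have Sn := lt0r_neq0 St.
have := small t t0 tB; rewrite ler_norml => /andP[sm1 sm2].
have rat : 2 * t ^+ 2 * pade_rat Rm Sm t = ((t - 1) ^+ 2 * Q0.[t] + (t ^+ 2 - 1) * Sm.[t]) / Sm.[t].
  by rewrite QE /pade_rat; field.
have qE : q.[t] = Q0.[t] / Sm.[t] + (e * Sm.[t] - Q0.[t] * (1 - Sm.[t] / s) ^+ k) / Sm.[t].
  by apply: (mulfI Sn); rewrite mulrDr !(mulrCA Sm.[t]) divff // !mulr1 -SqE; ring.
set dl := (e * _ - _) / Sm.[t] in qE.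
have d0 : 0 <= dl by rewrite divr_ge0 ?(ltW St) // subr_ge0.
have d1 : dl <= 2 * e by rewrite ler_pdivrMr //; lra.
have z0 := sqr_ge0 (t - 1).
have ratE : 2 * t ^+ 2 * pade_rat Rm Sm t = (t - 1) ^+ 2 * (Q0.[t] / Sm.[t]) + (t ^+ 2 - 1).
  by rewrite rat; field.
split.
  by rewrite ratE qE; have := mulr_ge0 z0 d0; lra.
have cl : 2 * t ^+ 2 * pade_rat Rm Sm t <= 2 * t ^+ 2 * ln t + e * (t - 1) ^+ 2.
  (* At [t = 0] the factor [t^2] removes the logarithm, and [pade_close] covers [t > 0]. *)
  have [t00|tn] := eqVneq t 0.
    by rewrite t00 expr0n /= !mulr0 !mul0r add0r mulr_ge0 ?sqr_ge0 // ltW.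
  have tgt : 0 < t by rewrite lt_neqAle eq_sym tn.
  have := pade_close pade tgt tB B1 => h.
  have : 2 * (B ^+ 2 / m.+1%:R * (t - 1) ^+ 2) <= e * (t - 1) ^+ 2.
    apply: le_trans (ler_wpM2r z0 me); rewrite le_eqVlt; apply/orP; left.
    by apply/eqP; ring.
  have aux (X Y' a r' l : R) : a * (r' - l) <= X -> 2 * X <= Y' -> 2 * a * r' <= 2 * a * l + Y' by lra.
  exact: aux h.
have := ler_wpM2l z0 d1; rewrite qE; lra.
Qed.

End IntervalCondition.

(** * Feasibility *)

Lemma common_bound (a b c e f : nat) : exists d,
  (2 <= d)%N /\ [/\ (a <= (2 * d).+1)%N, (b <= 2 * d)%N, (c <= d)%N, (e <= d.-1)%N & (f <= 2 * d - 2)%N].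
Proof. by exists (2 + a + b + c + e + f)%N; split; [|split]; lia. Qed.

Lemma feasible_mono (R : realType) n (K : 'M[R]_n) (pi : 'I_n -> R) m (Rm Sm : {poly R}) d d' gamma :
  pade_log m Rm Sm -> (2 <= d)%N -> (d <= d')%N ->
  feasible K pi Rm Sm d m gamma -> feasible K pi Rm Sm d' m gamma.
Proof.
move=> pade d2 dd [p [sp [[df [s0 [s [phi [hs0 [hs [dphi fE]]]]]]] hI]]].
exists p; split; first by move=> i; apply: leq_trans (sp i) _; rewrite ltnS leq_mul2l dd orbT.
split; last by move=> i; split; [apply: interval_size => //; [lia | apply: leq_trans (sp i) _; rewrite ltnS leq_mul2l dd orbT] | exact: (hI i).2].
split; first by apply: mdeg_leW df; rewrite leq_mul2l dd orbT.
exists s0, s, phi; split; first exact: is_sos_mono hs0.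
split; first by move=> i; apply: is_sos_mono (hs i); lia.
by split => //; apply: mdeg_leW dphi; lia.
Qed.

Section LogSobolev.
Variables (R : realType) (n : nat) (K : 'M[R]_n) (pi : 'I_n -> R).
Hypotheses (n1 : (1 < n)%N) (mk : markov_kernel K) (irr : irreducible K) (st : stationary K pi).

Let pi_gt0 i : 0 < pi i. Proof. exact: stationary_gt0 mk irr st i. Qed.
Let pi1 : \sum_i pi i = 1. Proof. by case: st => _ []. Qed.

(** One bound for all the interval endpoints; the leading [1] provides the condition [1 <= B] of
    [pade_close]. *)
Let B : R := 1 + \sum_i (Num.sqrt (pi i))^-1.

Let B_ge i : (Num.sqrt (pi i))^-1 <= B.
Proof.
rewrite /B (bigD1 i) //= addrCA lerDl addr_ge0 //; apply: sumr_ge0 => j _.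
by rewrite invr_ge0 sqrtr_ge0.
Qed.

Let B1 : 1 <= B.
Proof. by rewrite lerDl; apply: sumr_ge0 => j _; rewrite invr_ge0 sqrtr_ge0. Qed.

Let sqrt_pi_gt0 i : 0 < Num.sqrt (pi i). Proof. by rewrite sqrtr_gt0. Qed.

Let piB i : 1 <= pi i * B ^+ 2.
Proof.
have -> : 1 = pi i * ((Num.sqrt (pi i))^-1) ^+ 2 :> R.
  by rewrite exprVn sqr_sqrtr ?(ltW (pi_gt0 i)) // divff // lt0r_neq0.
rewrite ler_pM2l // lerXn2r ?nnegrE ?B_ge ?invr_ge0 ?sqrtr_ge0 //.
by have := B1; lra.
Qed.

Lemma dirichlet_ge0 x : 0 <= dirichlet K pi x.
Proof.
rewrite mulr_ge0 ?invr_ge0 //; apply: sumr_ge0 => i _; apply: sumr_ge0 => j _.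
by rewrite mulr_ge0 ?sqr_ge0 // mulr_ge0 ?(proj1 mk) // ltW.
Qed.

Lemma meval_dirichlet x : (dirichlet_poly K pi).@[x] = dirichlet K pi x.
Proof.
rewrite /dirichlet_poly mevalZ raddf_sum; congr (_ * _); apply: eq_bigr => i _ /=.
rewrite raddf_sum; apply: eq_bigr => j _ /=.
by rewrite mevalZ rmorphXn /= mevalB !mevalXU.
Qed.

Lemma le_sqrt_pi_inv x i : (forall i, 0 <= x i) -> normpi2 pi x = 1 ->
  x i <= (Num.sqrt (pi i))^-1.
Proof.
move=> x0 x1.
have h : pi i * x i ^+ 2 <= 1.
  rewrite -x1 /normpi2 (bigD1 i) //= lerDl; apply: sumr_ge0 => j _.
  by rewrite mulr_ge0 ?sqr_ge0 // ltW.
rewrite -div1r ler_pdivlMr // -(@ler_pXn2r _ 2) ?nnegrE ?mulr_ge0 ?sqrtr_ge0 //.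
by rewrite exprMn sqr_sqrtr ?(ltW (pi_gt0 i)) // expr1n mulrC.
Qed.

Lemma pi_lt1 i : pi i < 1.
Proof.
have [j ji] : exists j : 'I_n, j != i.
  have n0 : (0 < n)%N by exact: ltnW.
  have [i0|i0] := eqVneq (nat_of_ord i) 0%N.
    by exists (Ordinal n1); rewrite -val_eqE /= i0.
  by exists (Ordinal n0); rewrite -val_eqE /= eq_sym.
rewrite -pi1 (bigD1 i) //= ltrDl (bigD1 j) //= ltr_pwDl //.
by apply: sumr_ge0 => k _; exact: ltW.
Qed.

(** All mass is put on one state: the entropy is [- ln (pi i0)], positive because a second state has
    positive weight. *)
Lemma entropy_gt0 : exists x : 'I_n -> R,
  [/\ forall i, 0 <= x i, normpi2 pi x = 1 & 0 < entropy pi x].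
Proof.
pose i0 : 'I_n := Ordinal (ltnW n1).
pose x i : R := if i == i0 then (Num.sqrt (pi i0))^-1 else 0.
have x2 : x i0 ^+ 2 = (pi i0)^-1.
  by rewrite /x eqxx exprVn sqr_sqrtr // ltW.
have xn i : i != i0 -> x i = 0 by rewrite /x => /negPf ->.
have nx : normpi2 pi x = 1.
  rewrite /normpi2 (bigD1 i0) //= x2 divff ?lt0r_neq0 // big1 ?addr0 // => i /xn ->.
  by rewrite expr0n mulr0.
exists x; split => // [i|].
  by rewrite /x; case: ifP => // _; rewrite invr_ge0 sqrtr_ge0.
rewrite /entropy nx (bigD1 i0) //= x2 divff ?lt0r_neq0 // mul1r divr1.
rewrite big1 ?addr0 => [|i /xn ->]; last by rewrite expr0n mulr0 mul0r.
by rewrite ln_gt0 // -[1]invr1 ltf_pV2 ?posrE // pi_lt1.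
Qed.

Section FixedM.
Variables (m : nat) (Rm Sm : {poly R}).
Hypothesis pade : pade_log m Rm Sm.

(** Evaluating the certificate removes the sphere term, and the interval condition gives [p_i(x_i)
    >= 2 x_i^2 r(x_i) >= x_i^2 ln(x_i^2)]. *)
Lemma feasible_entropy_sphere d gamma x : feasible K pi Rm Sm d m gamma ->
  (forall i, 0 <= x i) -> normpi2 pi x = 1 -> entropy pi x <= gamma * dirichlet K pi x.
Proof.
move=> [p [_ [[_ [s0 [s [phi [hs0 [hs [_ fE]]]]]]] hI]]] x0 x1.
have : 0 <= (gamma *: dirichlet_poly K pi - \sum_(i < n) pi i *: at_coord (p i) i).@[x].
  rewrite fE !mevalD mevalM meval_sph x1 subrr mulr0 addr0.
  rewrite addr_ge0 ?(meval_is_sos x hs0) // raddf_sum; apply: sumr_ge0 => i _ /=.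
  by rewrite mevalM mevalXU mulr_ge0 // (meval_is_sos x (hs i)).
rewrite mevalB mevalZ meval_dirichlet subr_ge0; apply: le_trans.
rewrite raddf_sum /entropy x1; apply: ler_sum => i _ /=.
rewrite mevalZ meval_at_coord divr1 -mulrA ler_pM2l //.
have xi : 0 <= x i <= (Num.sqrt (pi i))^-1 by rewrite x0 le_sqrt_pi_inv.
have [_ /(_ _ xi)] := hI i; rewrite (interval_horner pade) // pmulr_rge0; last first.
  exact: pade_S_gt0 pade _ (x0 i).
rewrite subr_ge0; apply: le_trans.
have [->|xn] := eqVneq (x i) 0; first by rewrite expr0n /= mul0r mulr0 mul0r.
have xp : 0 < x i by rewrite lt_neqAle eq_sym xn x0.
have := ler_wpM2l (sqr_ge0 (x i)) (pade_ge_ln pade xp).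
by rewrite lnXn // mulr2n; lra.
Qed.

Lemma feasible_gt0 d gamma : feasible K pi Rm Sm d m gamma -> 0 < gamma.
Proof.
move=> h; have [x [x0 x1 ex]] := entropy_gt0.
have := lt_le_trans ex (feasible_entropy_sphere h x0 x1).
have := dirichlet_ge0 x; rewrite le_eqVlt => /orP[/eqP <-|E0]; first by rewrite mulr0 ltxx.
by rewrite pmulr_lgt0.
Qed.

(** Passes to [|x|] divided by its norm: entropy sees only squares, and taking absolute values does
    not increase the Dirichlet form. *)
Lemma feasible_entropy d gamma x : feasible K pi Rm Sm d m gamma ->
  entropy pi x <= gamma * dirichlet K pi x.
Proof.
move=> h; have g0 := feasible_gt0 h.
have [N0|N0] := eqVneq (normpi2 pi x) 0.
  have z := normpi2_eq0 pi_gt0 N0.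
  rewrite /entropy big1 => [|i _]; last by rewrite z expr0n mulr0 mul0r.
  by rewrite mulr_ge0 ?dirichlet_ge0 // ltW.
have N1 : 0 < normpi2 pi x by rewrite lt_neqAle eq_sym N0 normpi2_ge0.
set N := normpi2 pi x in N0 N1.
pose r := Num.sqrt N; have r0 : 0 < r by rewrite sqrtr_gt0.
have r2 : r ^+ 2 = N by rewrite sqr_sqrtr // ltW.
pose x' i := `|x i| / r.
have x'0 i : 0 <= x' i by rewrite divr_ge0 // ltW.
have x'2 i : x' i ^+ 2 = x i ^+ 2 / N by rewrite /x' expr_div_n real_normK ?num_real // r2.
have x'1 : normpi2 pi x' = 1.
  rewrite -(divff N0) {1}/N /normpi2 mulr_suml; apply: eq_bigr => i _.
  by rewrite x'2 mulrA.
have := feasible_entropy_sphere h x'0 x'1.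
have -> : entropy pi x' = entropy pi x / N.
  rewrite /entropy x'1 mulr_suml; apply: eq_bigr => i _.
  by rewrite x'2 divr1 -/N; ring.
have dE : dirichlet K pi x' <= dirichlet K pi x / N.
  rewrite /dirichlet -mulrA ler_pM2l ?invr_gt0 // mulr_suml; apply: ler_sum => i _.
  rewrite mulr_suml; apply: ler_sum => j _; rewrite -[X in _ <= X]mulrA ler_wpM2l //.
    by rewrite mulr_ge0 ?(proj1 mk) // ltW.
  rewrite /x' -mulrBl expr_div_n r2 ler_pM2r ?invr_gt0 //.
  rewrite -[leLHS]real_normK ?num_real // -[leRHS]real_normK ?num_real //.
  by rewrite lerXn2r ?nnegrE // ler_dist_dist.
move=> /le_trans/(_ (ler_wpM2l (ltW g0) dE)).
by rewrite mulrA ler_pM2r ?invr_gt0.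
Qed.

Lemma logsob_has_ub : has_ubound [set a : R | forall x, a * entropy pi x <= dirichlet K pi x].
Proof.
have [x [_ _ ex]] := entropy_gt0; exists (dirichlet K pi x / entropy pi x) => a /= /(_ x).
by rewrite ler_pdivlMr.
Qed.

Lemma feasible_logsob d gamma : feasible K pi Rm Sm d m gamma -> gamma^-1 <= logsob K pi.
Proof.
move=> h; apply: (ub_le_sup logsob_has_ub) => x /=.
have g0 := feasible_gt0 h.
by rewrite mulrC ler_pdivrMr // mulrC; exact: feasible_entropy h.
Qed.

Lemma feasible_two : exists gamma, feasible K pi Rm Sm 2 m gamma.
Proof.
have [C C0 hC] := poincare_sos mk irr st.
(* With this [M], [p - 2 t^2 (t - 1)] is [2 (B - t) (t - 1)^2], nonnegative on every interval. *)
pose M := 2 * B + 1; have M1 : 1 <= M by rewrite /M; have := B1; lra.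
pose u : {mpoly R[n]} := \sum_i pi i *: Xc R i.
pose V : {mpoly R[n]} := \sum_i pi i *: (Xc R i - 1) ^+ 2.
pose p : {poly R} := 'X ^+ 2 - 1 + M *: ('X - 1) ^+ 2.
have szp : (size p <= 5)%N.
  have s1 : (size ('X ^+ 2 - 1 : {poly R})%R <= 5)%N.
    by rewrite (leq_trans (size_polyD _ _)) // geq_max size_polyN size_polyXn size_poly1.
  rewrite (leq_trans (size_polyD _ _)) // geq_max s1 (leq_trans (size_scale_leq _ _)) //.
  by rewrite size_subX1_exp.
have pE i : at_coord p i = Xc R i ^+ 2 - 1 + M *: (Xc R i - 1) ^+ 2.
  by rewrite /p !at_coordD at_coordZ !at_coordXn at_coordD !at_coordN at_coord1 at_coordX.
have VE : V = sphere_poly pi + 2 - 2 * u by exact: Vp_sph.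
have sumE : \sum_(i < n) pi i *: at_coord p i = sphere_poly pi + M *: V.
  rewrite /sphere_poly -(sum_pi_poly pi1) scaler_sumr -sumrB -big_split; apply: eq_bigr => i _ /=.
  by rewrite pE scalerDr scalerBr -!mul_mpolyC mulr1; ring.
have dE : mdeg_le 2 (dirichlet_poly K pi).
  apply: mdeg_leZ; apply: mdeg_le_sum => i _; apply: mdeg_le_sum => j _; apply: mdeg_leZ.
  exact: (@mdeg_leXn R n 1 _ 2 (mdeg_le_XcB R i j)).
have dY i : mdeg_le 1 (Xc R i - 1 : {mpoly R[n]}).
  by apply: mdeg_leD; [exact: mdeg_leX | apply: mdeg_leN; exact: mdeg_le1].
have dV : mdeg_le 2 V.
  apply: mdeg_le_sum => i _; apply: mdeg_leZ; exact: (@mdeg_leXn R n 1 _ 2 (dY i)).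
have dS : mdeg_le 2 (sphere_poly pi).
  apply: mdeg_leD; last by apply: mdeg_leN; exact: mdeg_le1.
  apply: mdeg_le_sum => i _; apply: mdeg_leZ; exact: (@mdeg_leXn R n 1 _ 2 (mdeg_leX R i)).
exists (2 * M * C), (fun=> p); split => //; split; last first.
  move=> i; split; first by apply: interval_size.
  move=> t /andP[t0 tB]; rewrite (interval_horner pade) //.
  rewrite mulr_ge0 ?(ltW (pade_S_gt0 pade t0)) // subr_ge0.
  have tB' : t <= B := le_trans tB (B_ge i).
  have h : 2 * t ^+ 2 * pade_rat Rm Sm t <= 2 * t ^+ 2 * (t - 1).
    have [->|tn] := eqVneq t 0; first by rewrite expr0n /= mulr0 !mul0r.
    rewrite ler_wpM2l ?mulr_ge0 ?sqr_ge0 //; apply: (pade_le_sub1 pade).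
    by rewrite lt_neqAle eq_sym tn.
  apply: le_trans h _.
  have -> : p.[t] = t ^+ 2 - 1 + M * (t - 1) ^+ 2.
    by rewrite /p hornerD hornerZ horner_exp !hornerE.
  rewrite -subr_ge0 (_ : _ - _ = (t - 1) ^+ 2 * (2 * (B - t))); last by rewrite /M; ring.
  by rewrite mulr_ge0 ?sqr_ge0 // mulr_ge0 // subr_ge0.
rewrite sumE; split.
  apply: mdeg_leD; first by apply: mdeg_leZ; exact: mdeg_leW dE.
  apply: mdeg_leN; apply: mdeg_leD; first exact: mdeg_leW dS.
  by apply: mdeg_leZ; exact: mdeg_leW dV.
have M0 : 0 <= M by lra.
(* On the sphere [V = 2 (1 - u)] and the variance is [1 - u^2], so [V] is twice the variance minus
   [u V]; the term [u V] has the shape of coordinates times squares. *)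
exists ((2 * M) *: (C *: dirichlet_poly K pi - var_poly pi)),
  (fun i => (M * pi i) *: V), ((M - 1)%:MP - M *: u); split.
  by apply: is_sosZ; [rewrite mulr_ge0 | exact: is_sos_mono hC].
split.
  move=> i; apply: is_sosZ; first by rewrite mulr_ge0 // ltW.
  by apply: is_sos_sum => j _; apply: is_sosZ; [exact: ltW | apply: is_sos_sqr; exact: dY].
split.
  apply: mdeg_leD; first exact: mdeg_leC.
  apply: mdeg_leN; apply: mdeg_leZ; apply: mdeg_le_sum => i _; apply: mdeg_leZ.
  exact: mdeg_leW (mdeg_leX R i).
have vE : var_poly pi = sphere_poly pi + 1 - u ^+ 2 by rewrite /var_poly /sphere_poly subrK.
have -> : \sum_(i < n) Xc R i * ((M * pi i) *: V) = M *: (u * V).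
  rewrite /u mulr_suml scaler_sumr; apply: eq_bigr => i _.
  by rewrite -scalerAr -scalerAl scalerA.
move: (dirichlet_poly K pi) => E.
rewrite vE VE -!mul_mpolyC !mpolyCM mpolyCB mpolyC1 mpolyC_nat; ring.
Qed.

End FixedM.

Lemma meval_var x : (var_poly pi).@[x] = normpi2 pi x - (\sum_i pi i * x i) ^+ 2.
Proof.
rewrite /var_poly mevalB rmorphXn /= !raddf_sum /=; congr (_ - _ ^+ 2).
  by apply: eq_bigr => i _; rewrite mevalZ rmorphXn /= mevalXU.
by apply: eq_bigr => i _; rewrite mevalZ mevalXU.
Qed.

(** Poincare turns the slack in the log-Sobolev inequality into a multiple of the squared distance
    to [1]. For large [m] the majorant of [pade_majorant] uses up only half of it, and
    [positive_certificate] applies to what is left. *)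
Lemma feasible_eventually gamma : 0 < gamma -> gamma^-1 < logsob K pi ->
  exists m0 : nat, forall m (Rm Sm : {poly R}), (m0 <= m)%N -> pade_log m Rm Sm ->
    exists2 d, (2 <= d)%N & feasible K pi Rm Sm d m gamma.
Proof.
move=> g0 glt.
have ne : [set a : R | forall x, a * entropy pi x <= dirichlet K pi x] !=set0.
  by exists 0 => x /=; rewrite mul0r dirichlet_ge0.
have [a aA ga] := sup_gt ne glt.
have a0 : 0 < a by apply: lt_trans ga; rewrite invr_gt0.
have [C C0 hC] := poincare_sos mk irr st.
pose kappa := gamma - a^-1.
have k0 : 0 < kappa by rewrite subr_gt0 -[gamma]invrK ltf_pV2 ?posrE ?invr_gt0.
(* The squared distance to [1] is [2 (1 - u)] and Poincare gives [1 - u <= C * dirichlet]; so the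
   slack [kappa * dirichlet] is at least [2 delta] times that distance. *)
pose delta := kappa / (4 * C); have d0 : 0 < delta by rewrite divr_gt0 ?mulr_gt0.
(* The majorant loses [3 e], that is [delta]. *)
pose e := delta / 3; have e0 : 0 < e by rewrite divr_gt0.
have gap x : (forall i, 0 <= x i) -> normpi2 pi x = 1 ->
    2 * delta * normpi2 pi (fun i => x i - 1) <= gamma * dirichlet K pi x - entropy pi x.
  move=> x0 x1; have E0 := dirichlet_ge0 x.
  have h1 : entropy pi x <= a^-1 * dirichlet K pi x.
    by rewrite mulrC ler_pdivlMr // mulrC; exact: aA.
  have h2 : kappa * dirichlet K pi x <= gamma * dirichlet K pi x - entropy pi x.
    by rewrite /kappa mulrBl; lra.
  apply: le_trans h2.
  rewrite (normpi2_sub1 pi1) x1; set u := \sum_i pi i * x i.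
  have := meval_is_sos x hC; rewrite mevalB mevalZ meval_dirichlet meval_var x1 -/u => h3.
  have u0 : 0 <= u by apply: sumr_ge0 => i _; rewrite mulr_ge0 // ltW.
  have u1 : u <= 1.
    have := normpi2_ge0 pi_gt0 (fun i => x i - 1); rewrite (normpi2_sub1 pi1) x1 -/u; lra.
  have h4 : 1 - u <= C * dirichlet K pi x.
    have : 0 <= u * (1 - u) by rewrite mulr_ge0 // subr_ge0.
    by move: h3; lra.
  have -> : 2 * delta * (1 - 2 * u + 1) = kappa * ((1 - u) / C).
    by rewrite /delta; field; rewrite lt0r_neq0.
  by rewrite ler_pM2l // ler_pdivrMr // mulrC.
exists (Num.bound (2 * B ^+ 2 / e)) => m Rm Sm mm pade.
have me : 2 * B ^+ 2 / m.+1%:R <= e.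
  have h : 2 * B ^+ 2 / e < (Num.bound (2 * B ^+ 2 / e))%:R.
    by apply: archi_boundP; exact: divr_ge0 (mulr_ge0 (ler0n _ 2) (sqr_ge0 _)) (ltW e0).
  rewrite ler_pdivrMr // [e * _]mulrC -ler_pdivrMr // (le_trans (ltW h)) // ler_nat.
  exact: leqW.
have [q hq] := pade_majorant pade B1 e0 me.
have star x : (forall i, 0 <= x i) -> normpi2 pi x = 1 ->
  delta * normpi2 pi (fun i => x i - 1) <=
  gamma * dirichlet K pi x - \sum_i pi i * (x i - 1) ^+ 2 * q.[x i].
  move=> x0 x1; have := gap x x0 x1.
  have : \sum_i pi i * (x i - 1) ^+ 2 * q.[x i] <=
     entropy pi x + delta * normpi2 pi (fun i => x i - 1).
    (* The subtracted sum is zero on the sphere; it supplies the [t^2 - 1] that makes the comparison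
       hold coordinate by coordinate. *)
    have -> : entropy pi x = entropy pi x - \sum_i pi i * (x i ^+ 2 - 1).
      under [X in _ - X]eq_bigr => i _ do rewrite mulrBr mulr1.
      by rewrite sumrB pi1 -/(normpi2 pi x) x1 subrr subr0.
    rewrite /entropy x1 -sumrB /normpi2 mulr_sumr -big_split; apply: ler_sum => i _ /=.
    have [|_ h] := hq (x i) (x0 i).
      exact: le_trans (le_sqrt_pi_inv i x0 x1) (B_ge i).
    rewrite divr1 [X in _ <= X](_ : _ =
      pi i * (x i ^+ 2 * ln (x i ^+ 2) - (x i ^+ 2 - 1) + delta * (x i - 1) ^+ 2)); last by ring.
    rewrite -[X in X <= _]mulrA ler_pM2l //; apply: le_trans h _.
    have [->|xn] := eqVneq (x i) 0.
      by rewrite expr0n /= !mulr0 !mul0r /e; lra.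
    have xp : 0 < x i by rewrite lt_neqAle eq_sym xn x0.
    by rewrite lnXn // mulr2n /e; lra.
  by lra.
have B0 : 0 < B by apply: lt_le_trans B1.
have [s0 [s [phi [[k0' hs0] hs fE]]]] := positive_certificate pi_gt0 pi1 B0 piB d0 star.
have /choice[ks hks] i : exists k, is_sos k (s i) := hs i.
pose p : {poly R} := 'X ^+ 2 - 1 + ('X - 1) ^+ 2 * q.
pose f := gamma *: dirichlet_poly K pi - \sum_(i < n) pi i *: at_coord p i.
(* The parts [t^2 - 1] of the [p_i] add up to the sphere polynomial, absorbed by replacing [phi]
   with [phi - 1]. *)
have fE2 : f = s0 + \sum_(i < n) Xc R i * s i + (phi - 1) * sphere_poly pi.
  have -> : f = gamma *: dirichlet_poly K pi - \sum_i pi i *: (at_coord q i * (Xc R i - 1) ^+ 2)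
     - sphere_poly pi.
    have -> : sphere_poly pi = \sum_i pi i *: (Xc R i ^+ 2 - 1).
      rewrite /sphere_poly -[X in _ - X = _](sum_pi_poly pi1) -sumrB; apply: eq_bigr => i _.
      by rewrite scalerBr -[pi i *: 1]mul_mpolyC mulr1.
    rewrite /f -addrA -opprD -big_split; congr (_ - _); apply: eq_bigr => i _ /=.
    rewrite -scalerDr /p at_coordD at_coordM !at_coordXn !at_coordD !at_coordN at_coordXn.
    by rewrite at_coord1 at_coordX; congr (_ *: _); ring.
  by rewrite fE; ring.
have [d [d2 [szd fd s0d sd phid]]] :=
  common_bound (size p) (msize f) k0' (\sum_i ks i) (msize (phi - 1)).
exists d => //; exists (fun=> p); split => //; split; last first.
  move=> i; split; first exact: interval_size.
  move=> t /andP[t0 tB]; rewrite (interval_horner pade) //.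
  rewrite mulr_ge0 ?(ltW (pade_S_gt0 pade t0)) // subr_ge0.
  have [h _] := hq t t0 (le_trans tB (B_ge i)); apply: le_trans h _.
  by rewrite le_eqVlt; apply/orP; left; apply/eqP; rewrite /p hornerD hornerM horner_exp !hornerE.
split; first exact: mdeg_leW (mdeg_le_msize f).
exists s0, s, (phi - 1); split; first exact: is_sos_mono hs0.
split.
  move=> i; apply: is_sos_mono (hks i); apply: leq_trans sd.
  by rewrite (bigD1 i) //= leq_addr.
by split => //; exact: mdeg_leW (mdeg_le_msize (phi - 1)).
Qed.

End LogSobolev.

(** * Feasibility, bounds and the iterated limit *)

Theorem mainTheorem1 (R : realType) (n : nat) (K : 'M[R]_n) (pi : 'I_n -> R)
    (Rm Sm : nat -> {poly R}) :
  (1 < n)%N ->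
  markov_kernel K -> irreducible K -> stationary K pi ->
  (forall m, pade_log m (Rm m) (Sm m)) ->
  (forall d m : nat, (2 <= d)%N ->
     (exists gamma, feasible K pi (Rm m) (Sm m) d m gamma) /\
     0 < alpha_dm K pi (Rm m) (Sm m) d m /\
     alpha_dm K pi (Rm m) (Sm m) d m <= logsob K pi) /\
  exists L : nat -> R,
    (forall m, (fun d => alpha_dm K pi (Rm m) (Sm m) d m) @ \oo --> L m) /\
    L @ \oo --> logsob K pi.
Proof.
move=> n1 mk irr st pade.
have fne d m : (2 <= d)%N -> exists gamma, feasible K pi (Rm m) (Sm m) d m gamma.
  move=> d2; have [g hg] := feasible_two mk irr st (pade m).
  by exists g; exact: (feasible_mono (pade m) (leqnn 2) d2 hg).
have ls0 : 0 < logsob K pi.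
  have [g hg] := fne 2%N 0%N isT.
  apply: lt_le_trans (feasible_logsob n1 mk irr st (pade 0%N) hg).
  by rewrite invr_gt0; exact: (feasible_gt0 n1 mk irr st (pade 0%N) hg).
have lb d m : lbound [set g | feasible K pi (Rm m) (Sm m) d m g] (logsob K pi)^-1.
  move=> g /= hg; have g0 := feasible_gt0 n1 mk irr st (pade m) hg.
  rewrite -[g]invrK lef_pV2 ?posrE ?invr_gt0 //.
  exact: (feasible_logsob n1 mk irr st (pade m) hg).
have infge d m : (2 <= d)%N ->
    (logsob K pi)^-1 <= inf [set g | feasible K pi (Rm m) (Sm m) d m g].
  by move=> d2; apply: lb_le_inf => //; exact: fne.
have infgt d m : (2 <= d)%N -> 0 < inf [set g | feasible K pi (Rm m) (Sm m) d m g].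
  by move=> d2; apply: lt_le_trans (infge d m d2); rewrite invr_gt0.
have age0 d m : (2 <= d)%N -> 0 < alpha_dm K pi (Rm m) (Sm m) d m.
  by move=> d2; rewrite invr_gt0 infgt.
have ale d m : (2 <= d)%N -> alpha_dm K pi (Rm m) (Sm m) d m <= logsob K pi.
  move=> d2; rewrite /alpha_dm -[leRHS]invrK lef_pV2 ?posrE ?invr_gt0 ?infgt //.
  exact: infge.
have age d m g : (2 <= d)%N -> feasible K pi (Rm m) (Sm m) d m g ->
    g^-1 <= alpha_dm K pi (Rm m) (Sm m) d m.
  move=> d2 hg; rewrite /alpha_dm lef_pV2 ?posrE ?infgt //.
    by apply: ge_inf => //; exists (logsob K pi)^-1; exact: lb.
  exact: (feasible_gt0 n1 mk irr st (pade m) hg).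
split; first by move=> d m d2; split; [exact: fne | split; [exact: age0 | exact: ale]].
(* The shift by [2] keeps the whole sequence in the range [d >= 2], where feasibility, hence
   monotonicity in [d], is available. *)
pose A m d := alpha_dm K pi (Rm m) (Sm m) (d + 2) m.
have ub m : has_ubound (range (A m)).
  by exists (logsob K pi) => _ [d _ <-]; apply: ale; rewrite addn2.
have nd m : nondecreasing_seq (A m).
  move=> d d' dd'; rewrite /A /alpha_dm lef_pV2 ?posrE ?infgt ?addn2 //.
  apply: lb_le_inf; first by apply: fne.
  move=> g /= hg; apply: ge_inf; first by exists (logsob K pi)^-1; exact: lb.
  by apply: feasible_mono hg => //; rewrite !ltnS.
exists (fun m => sup (range (A m))); split.
  move=> m; rewrite -(cvg_shiftn 2).
  exact: nondecreasing_cvgn (nd m) (ub m).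
apply/cvgrPdist_lt => e e0.
pose l := logsob K pi.
(* A positive value below [l] by at most [e / 2]; its inverse is the [gamma] to be made feasible for
   all large [m]. *)
pose t := Num.max (l / 2) (l - e / 2).
have t0 : 0 < t by rewrite lt_max divr_gt0.
have tl : t < l by rewrite gt_max; apply/andP; split; rewrite /l; move: ls0; lra.
have ti0 : 0 < t^-1 by rewrite invr_gt0.
have ti1 : t^-1^-1 < logsob K pi by rewrite invrK.
have [m0 hm0] := feasible_eventually mk irr st ti0 ti1.
near=> m.
have mm0 : (m0 <= m)%N by near: m; exact: nbhs_infty_ge.
have [d d2 hd] := hm0 m _ _ mm0 (pade m).
have h1 : sup (range (A m)) <= l.
  apply: ge_sup; first by exists (A m 0%N), 0%N.
  by move=> _ [d' _ <-]; apply: ale; rewrite addn2.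
have h2 : t <= sup (range (A m)).
  apply: (@le_trans _ _ (A m (d - 2)%N)); last by apply: ub_le_sup => //; exists (d - 2)%N.
  by rewrite /A subnK //; have := age d m _ d2 hd; rewrite invrK.
have h3 : l - e / 2 <= t by rewrite le_max lexx orbT.
rewrite ger0_norm ?subr_ge0 //; move: e0; rewrite /l in h1 h3 *; lra.
Unshelve. all: by end_near.
Qed.
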